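(* Let $f:X\longrightarrow Y$ be a locally flat branched covering, where $X$ is a closed topological manifold of dimension $n$, $Y$ is a closed topological pseudomanifold, and the branch locus is a closed topologically stratified subspace $R\subset Y$ of codimension $2$. Let $Y=\bigsqcup_\alpha S_\alpha$ and $R=\bigsqcup_\beta T_\beta$ be the intrinsic stratifications, let $S_{\alpha_{\mathrm{top}}}$ be the top stratum of $Y$, and consider the refined stratification $$Y=\big(S_{\alpha_{\mathrm{top}}}\setminus(R\cap S_{\alpha_{\mathrm{top}}})\big)\ \sqcup\ \bigsqcup_{\alpha,\beta}(S_\alpha\cap T_\beta).$$ Let $\overline p$ be either the lower or the upper middle perversity. Then, in $D^b_c(Y)$, $$Rf_{\ast}\underline{\mathbb{Q}}_{X}[n]\simeq IC^{\overline p}_{Y}(\underline{\mathbb{Q}}_{Y\setminus R})\oplus IC^{\overline p}_{Y}(\mathcal{L}_{Y\setminus R}),$$ where $\mathcal{L}_{Y\setminus R}$ is the local system associated with the unbranched covering $f|_{X\setminus f^{-1}(R)}:X\setminus f^{-1}(R)\longrightarrow Y\setminus R$, and Deligne's sheaf complexes $IC^{\overline p}_Y(-)$ are computed with respect to the refined stratification.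
   Context: **Branched coverings.** Let $X$ and $Y$ be path-connected, locally compact Hausdorff spaces. A continuous, open, finite-to-one, proper surjection $f:X\to Y$ is a (topological) branched covering if there is a closed nowhere dense subset $R\subset Y$ such that $f|:f^{-1}(Y\setminus R)\to Y\setminus R$ is a finite covering map. The branch locus $R$ of $f$ always means the minimal such set, i.e. the set of all $y\in Y$ having no evenly covered neighborhood. **Stratified spaces.** A $0$-dimensional topologically stratified space is a countable discrete set. For $m>0$, an $m$-dimensional topologically stratified space is a paracompact Hausdorff space $Z$ with a filtration by closed subsets $Z=Z_m\supseteq Z_{m-1}\supseteq\dots\supseteq Z_0\supseteq Z_{-1}=\emptyset$ such that every $x\in Z_j\setminus Z_{j-1}$ has a (distinguished) neighborhood $\mathcal{N}_x$ in $Z$, a compact $(m-j-1)$-dimensional topologically stratified space $L=L_{m-j-1}\supseteq\dots\supseteq L_0\supseteq L_{-1}=\emptyset$ (a link) and a homeomorphism $\phi:\mathcal{N}_x\to\mathbb{R}^j\times C(L)$ ($C$ = open cone) taking $\mathcal{N}_x\cap Z_{j+i+1}$ homeomorphically onto $\mathbb{R}^j\times C(L_i)$ for $m-j-1\ge i\ge 0$ and $\mathcal{N}_x\cap Z_j$ onto $\mathbb{R}^j\times\{\text{vertex}\}$. The strata are the connected components of the manifolds $Z_j\setminus Z_{j-1}$. An $m$-dimensional topological pseudomanifold is a paracompact Hausdorff space admitting such a stratification with $Z_{m-1}=Z_{m-2}$ and $Z\setminus Z_{m-1}$ dense. Unless said otherwise, ''stratification'' refers to the intrinsic stratification: the top stratum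 is the largest open submanifold, and one proceeds inductively on the dimension of the strata. **Local flatness.** Let $Y=\bigsqcup_\alpha S_\alpha$ and $R=\bigsqcup_\beta T_\beta$ be topologically stratified spaces with $R\subseteq Y$. The inclusion $R\hookrightarrow Y$ is locally flat at $r\in S_\alpha\cap T_\beta$ with $\dim S_\alpha\le\dim T_\beta$ if there are distinguished neighborhoods $U\subset R$ and $U'\subset Y$ of $r$ with $U\subset U'$ such that there are homeomorphisms $U'\cap S_\alpha\to\mathbb{R}^{\dim S_\alpha}$ and $U\cap T_\beta\to\mathbb{R}^{\dim T_\beta}$ making the square with the inclusion $U'\cap S_\alpha\hookrightarrow U\cap T_\beta$ and the standard inclusion $\mathbb{R}^{\dim S_\alpha}\hookrightarrow\mathbb{R}^{\dim T_\beta}$ commute. If $\dim S_\alpha\ge\dim T_\beta$ the condition is the same with roles exchanged (inclusion $U\cap T_\beta\hookrightarrow U'\cap S_\alpha$ and standard inclusion $\mathbb{R}^{\dim T_\beta}\hookrightarrow\mathbb{R}^{\dim S_\alpha}$). The inclusion is locally flat if it is so at every $r\in R$. A branched covering $f:X\to Y$ of topological pseudomanifolds with branch locus $R$ is locally flat if $R\hookrightarrow Y$ and $f^{-1}(R)\hookrightarrow X$ are locally flat. **Associated local system.** For the finite covering $f|:X\setminus f^{-1}(R)\to Y\setminus R$, $\mathcal{L}_{Y\setminus R}$ is the local system on $Y\setminus R$ with $(f|)_\ast\underline{\mathbb{Q}}_{X\setminus f^{-1}(R)}\cong\underline{\mathbb{Q}}_{Y\setminus R}\oplus\mathcal{L}_{Y\setminus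 R}$, namely the kernel of the trace map $(f|)_\ast\underline{\mathbb{Q}}_{X\setminus f^{-1}(R)}\to\underline{\mathbb{Q}}_{Y\setminus R}$ given by summation over the sheets; its rank is one less than the degree. **Deligne's sheaf complex.** The lower and upper middle perversities are $\overline m(k)=\lfloor (k-2)/2\rfloor$ and $\overline n(k)=\lfloor (k-1)/2\rfloor$. For an $n$-dimensional pseudomanifold $Y$ with filtration $Y=Y_n\supseteq Y_{n-2}\supseteq\cdots\supseteq Y_0\supseteq\emptyset$, put $U_k=Y\setminus Y_{n-k}$ for $k\ge2$, with inclusions $j_k:U_k\hookrightarrow U_{k+1}$ (so $U_{n+1}=Y$). For a local system $\mathcal{M}$ on $U_2$, $$IC^{\overline p}_Y(\mathcal{M})=\tau_{\le\overline p(n)-n}Rj_{n\ast}\cdots\tau_{\le\overline p(3)-n}Rj_{3\ast}\,\tau_{\le\overline p(2)-n}Rj_{2\ast}\mathcal{M}[n].$$ Here the filtration is the one of the refined stratification, with $Y_{n-2}=R$. $D^b_c(Y)$ is the bounded derived category of constructible complexes of sheaves of $\mathbb{Q}$-vector spaces. *)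

(* Defs.v *)
From HB Require Import structures.
From mathcomp Require Import all_boot all_order all_algebra.
From mathcomp Require Import all_classical all_reals.
From mathcomp Require Import topology normedtype.

Set Implicit Arguments.
Unset Strict Implicit.
Unset Printing Implicit Defensive.

Import Order.TTheory GRing.Theory Num.Theory.
Import numFieldNormedType.Exports.

Local Open Scope classical_set_scope.
Local Open Scope ring_scope.

(** * Topology *)

Definition homeomorphism (S T : topologicalType) (f : S -> T) : Prop :=
  continuous f /\
  exists g : T -> S, [/\ continuous g, cancel f g & cancel g f].

Definition path_connected (R : realType) (T : topologicalType) : Prop :=
  forall x y : T, exists g : R -> T,
    [/\ {within `[0, 1], continuous g}, g 0 = x & g 1 = y].

Definition locally_finite (T : topologicalType) (C : set (set T)) : Prop :=
  forall x : T, exists2 N, nbhs x N & finite_set [set A | C A /\ A `&` N !=set0].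

Definition paracompact (T : topologicalType) : Prop :=
  forall C : set (set T), (forall A, C A -> open A) -> \bigcup_(A in C) A = setT ->
  exists D : set (set T),
    [/\ forall A, D A -> open A, \bigcup_(A in D) A = setT,
        forall A, D A -> exists2 A', C A' & A `<=` A' & locally_finite D].

Definition nowhere_dense (T : topologicalType) (A : set T) : Prop :=
  interior (closure A) = set0.

Definition locally_euclidean_at (R : realType) (d : nat) (T : topologicalType)
    (x : T) : Prop :=
  exists2 N : set T, open_nbhs x N &
    exists h : set_type N -> 'rV[R]_d, homeomorphism h.

Definition closed_manifold (R : realType) (d : nat) (T : topologicalType) : Prop :=
  [/\ hausdorff_space T, @second_countable T, compact [set: T] &
      forall x : T, locally_euclidean_at R d x].

(** * Branched coverings *)

Definition evenly_covered (E B : topologicalType) (p : E -> B) (b : B) : Prop :=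
  exists2 V : set B, open_nbhs b V &
  exists (I : Type) (W : I -> set E),
    [/\ forall i, open (W i),
        forall i j, W i `&` W j !=set0 -> i = j,
        p @^-1` V = \bigcup_i W i &
        forall i, exists2 h : set_type (W i) -> set_type V,
          homeomorphism h & forall w, set_val (h w) = p (set_val w)].

Definition finite_fibers (E B : Type) (p : E -> B) : Prop :=
  forall b, finite_set (p @^-1` [set b]).

Definition finite_covering_map (E B : topologicalType) (p : E -> B) : Prop :=
  [/\ continuous p, finite_fibers p & forall b, evenly_covered p b].

Lemma restrict_preimage_subproof (E B : Type) (p : E -> B) (A : set B)
  (e : set_type (p @^-1` A)) : p (set_val e) \in A.
Proof. by apply/mem_set; exact: (set_mem (valP e)). Qed.

Definition restrict_preimage (E B : Type) (p : E -> B) (A : set B)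
    (e : set_type (p @^-1` A)) : set_type A :=
  exist _ (p (set_val e)) (restrict_preimage_subproof e).

Definition branch_locus (X Y : topologicalType) (f : X -> Y) : set Y :=
  [set y | ~ evenly_covered f y].

Record branched_covering (R : realType) (X Y : topologicalType) (f : X -> Y) :
    Prop := BranchedCovering {
  bc_pathX : path_connected R X;
  bc_pathY : path_connected R Y;
  bc_lcX : locally_compact [set: X];
  bc_lcY : locally_compact [set: Y];
  bc_hausX : hausdorff_space X;
  bc_hausY : hausdorff_space Y;
  bc_cont : continuous f;
  bc_open : forall U, open U -> open (f @` U);
  bc_fin : finite_fibers f;
  bc_proper : forall K, compact K -> compact (f @^-1` K);
  bc_surj : forall y, exists x, f x = y;
  bc_cover : exists B : set Y, [/\ closed B, nowhere_dense B &
    finite_covering_map (restrict_preimage (p := f) (A := ~` B))] }.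

(** * Open cones *)

(* The open cone [L * [0,1[ / L * {0}], with the convention that the cone on the
   empty space is a point: [None] is the vertex. *)
Definition cone (R : realType) (L : topologicalType) : Type :=
  option (L * set_type [set t : R | 0 < t < 1]).

HB.instance Definition _ (R : realType) (L : topologicalType) :=
  Choice.on (cone R L).

Section Cone.
Context {R : realType} {L : topologicalType}.

Definition cone_proj (p : L * set_type [set t : R | 0 <= t < 1]) : cone R L :=
  if pselect (set_val p.2 \in [set t : R | 0 < t < 1]) is left h
  then Some (p.1, exist _ (set_val p.2) h) else None.

(* Quotient topology; when [L] is empty, it is the topology of a point. *)
Definition cone_open (U : set (cone R L)) : Prop := open (cone_proj @^-1` U).

Lemma cone_openT : cone_open setT.
Proof. by rewrite /cone_open preimage_setT; apply: openT. Qed.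

Lemma cone_openI : setI_closed cone_open.
Proof. by move=> A B oA oB; rewrite /cone_open preimage_setI; exact: openI. Qed.

Lemma cone_open_bigcup (I : Type) (f : I -> set (cone R L)) :
  (forall i, cone_open (f i)) -> cone_open (\bigcup_i f i).
Proof.
move=> of_; rewrite /cone_open preimage_bigcup.
by apply: bigcup_open => i _; exact: of_.
Qed.

HB.instance Definition _ := isOpenTopological.Build (cone R L)
  cone_openT cone_openI cone_open_bigcup.

Definition subcone (A : set L) : set (cone R L) :=
  [set c | if c is Some p then A p.1 else True].

End Cone.

(** * Topologically stratified spaces *)

(* A filtration [Z_0, Z_1, ...] of a space; the skeleton of index -1 is empty. *)
Definition skeleton_below (Z : Type) (F : nat -> set Z) (j : nat) : set Z :=
  if j is i.+1 then F i else set0.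

Definition strata (Z : Type) (F : nat -> set Z) (j : nat) : set Z :=
  F j `\` skeleton_below F j.

(* [N] is a distinguished neighborhood of the point [x] of [Z_j - Z_{j-1}], with
   respect to the class [strat] of admissible links. For [j = m] the link is the
   empty space of dimension -1, whose cone is a point. *)
Definition distinguished_for (R : realType)
    (strat : nat -> forall L : topologicalType, (nat -> set L) -> Prop)
    (m : nat) (Z : topologicalType) (F : nat -> set Z) (j : nat)
    (x : Z) (N : set Z) : Prop :=
  nbhs x N /\
  ((j = m /\ exists phi : set_type N -> 'rV[R]_m, homeomorphism phi) \/
   ((j < m)%N /\
    exists (L : topologicalType) (FL : nat -> set L),
    [/\ strat (m - j.+1)%N L FL, compact [set: L] &
    exists phi : set_type N -> 'rV[R]_j * cone R L,
    [/\ homeomorphism phi,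
        forall i, (i <= m - j.+1)%N ->
          phi @` (set_val @^-1` F (j + i.+1)%N) = setT `*` subcone (FL i) &
        phi @` (set_val @^-1` F j) = setT `*` subcone set0]])).

Inductive stratification (R : realType) :
    nat -> forall Z : topologicalType, (nat -> set Z) -> Prop :=
| Stratification0 (Z : topologicalType) (F : nat -> set Z) :
    countable [set: Z] -> (forall A : set Z, open A) ->
    (forall i, F i = setT) -> @stratification R 0 Z F
| StratificationS (m : nat) (Z : topologicalType) (F : nat -> set Z) :
    paracompact Z -> hausdorff_space Z ->
    (forall i, closed (F i)) -> (forall i, F i `<=` F i.+1) ->
    (forall i, (m.+1 <= i)%N -> F i = setT) ->
    (forall j x, strata F j x ->
       exists N, distinguished_for R (@stratification R) m.+1 F j x N) ->
    @stratification R m.+1 Z F.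

Definition distinguished (R : realType) (m : nat) (Z : topologicalType)
    (F : nat -> set Z) (x : Z) (N : set Z) : Prop :=
  exists2 j, strata F j x & distinguished_for R (@stratification R) m F j x N.

Definition pseudomanifold (R : realType) (m : nat) (Z : topologicalType) : Prop :=
  [/\ paracompact Z, hausdorff_space Z & exists F : nat -> set Z,
    [/\ stratification R m F, skeleton_below F m = skeleton_below F m.-1 &
        dense (~` skeleton_below F m)]].

(* The top stratum is the largest open submanifold; inductively, once the strata
   of dimension [> j] are given, those of dimension [j] are as large as possible
   among all stratifications. *)
Definition intrinsic (R : realType) (m : nat) (Z : topologicalType)
    (F : nat -> set Z) : Prop :=
  [/\ stratification R m F,
      ~` skeleton_below F m = [set x | locally_euclidean_at R m x] &
      forall j (G : nat -> set Z), (j <= m)%N -> stratification R m G ->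
        (forall i, (j <= i)%N -> G i = F i) ->
        skeleton_below F j `<=` skeleton_below G j].

(** * Local flatness *)

Definition std_incl (R : realType) (a b : nat) (v : 'rV[R]_a) : 'rV[R]_b :=
  \row_(j < b) (if insub (val j) is Some i then v 0 i else 0).

(* [P : set A] and [Q : set B] have Euclidean charts in which the restriction to
   [P] of [i : A -> B] takes values in [Q] and is the standard inclusion. *)
Definition flat_chart (R : realType) (A B : topologicalType) (i : A -> B -> Prop)
    (a b : nat) (P : set A) (Q : set B) : Prop :=
  exists (h : set_type P -> 'rV[R]_a) (k : set_type Q -> 'rV[R]_b),
    [/\ homeomorphism h, homeomorphism k &
        forall p, exists2 q, i (set_val p) (set_val q) & k q = std_incl b (h p)].

Definition stratum_of (Z : topologicalType) (F : nat -> set Z) (j : nat) (x : Z) :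
    set Z :=
  connected_component (strata F j) x.

(* [B], of dimension [m], is a subspace of [Y], of dimension [n]. *)
Definition locally_flat (R : realType) (n : nat) (Y : topologicalType)
    (FY : nat -> set Y) (m : nat) (B : set Y) (FB : nat -> set (set_type B)) : Prop :=
  forall (r : set_type B) (a b : nat),
    strata FY a (set_val r) -> strata FB b r ->
    exists (U : set (set_type B)) (U' : set Y),
    [/\ distinguished R m FB r U, distinguished R n FY (set_val r) U',
        set_val @` U `<=` U' &
        let S := U' `&` stratum_of FY a (set_val r) in
        let T := U `&` stratum_of FB b r in
        if (a <= b)%N
        then flat_chart R (fun (y : Y) (t : set_type B) => set_val t = y) a b S T
        else flat_chart R (fun (t : set_type B) (y : Y) => set_val t = y) b a T S].

(** * Sheaves of rational vector spaces *)

Record opens (T : topologicalType) := Opens {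
  oset :> set T;
  oset_open : open oset }.

Definition opreim (S T : topologicalType) (f : S -> T) (cf : continuous f)
    (U : opens T) : opens S :=
  Opens ((continuousP f).1 cf _ (oset_open U)).

Record presheaf (T : topologicalType) := Presheaf {
  sec :> opens T -> lmodType rat;
  res : forall U V : opens T, V `<=` U -> sec U -> sec V;
  res_linear : forall (U V : opens T) (h : V `<=` U), linear (res h);
  res_id : forall (U : opens T) (h : U `<=` U) s, res h s = s;
  res_comp : forall (U V W : opens T) (h : V `<=` U) (k : W `<=` V) (l : W `<=` U) s,
    res k (res h s) = res l s }.

Definition sheaf_axiom (T : topologicalType) (F : presheaf T) : Prop :=
  forall (U : opens T) (I : Type) (V : I -> opens T)
    (VU : forall i, V i `<=` U), U `<=` \bigcup_i V i ->
  forall s : forall i, F (V i),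
    (forall i j (W : opens T) (h : W `<=` V i) (k : W `<=` V j),
       res h (s i) = res k (s j)) ->
  exists! t : F U, forall i, res (VU i) t = s i.

Record sheaf (T : topologicalType) := Sheaf {
  presheaf_of :> presheaf T;
  sheafP : sheaf_axiom presheaf_of }.

Record sheaf_map (T : topologicalType) (F G : sheaf T) := SheafMap {
  smap :> forall U : opens T, F U -> G U;
  smap_linear : forall U, linear (smap (U := U));
  smap_res : forall (U V : opens T) (h : V `<=` U) s, smap (res h s) = res h (smap s) }.

(** ** Subsheaves *)

Section SubModule.
Variables (V : lmodType rat) (P : V -> Prop).

Definition submodP : Prop :=
  P 0 /\ forall a u v, P u -> P v -> P (a *: u + v).

Definition asboolP_pred : pred V := fun v => `[< P v >].

Definition submod (_ : submodP) : Type := {v : V | asboolP_pred v}.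

Hypothesis HP : submodP.

Lemma submod_closedP : subsemimod_closed asboolP_pred.
Proof.
split; first split.
- exact/asboolP/HP.1.
- move=> u v /asboolP Pu /asboolP Pv; apply/asboolP.
  by rewrite -[u]scale1r; exact: HP.2.
- move=> a u /asboolP Pu; apply/asboolP.
  by rewrite -[_ *: _]addr0; apply: HP.2 => //; exact: HP.1.
Qed.

HB.instance Definition _ := SubChoice.copy (submod HP) {v : V | asboolP_pred v}.
HB.instance Definition _ := GRing.SubChoice_isSubLmodule.Build rat V asboolP_pred
  (submod HP) submod_closedP.

Definition submod_lmod : lmodType rat := submod HP.

Definition submod_val (v : submod_lmod) : V := val (v : submod HP).

Definition submod_mk (v : V) (Pv : P v) : submod_lmod :=
  exist _ v (asboolT Pv).

Lemma submod_valP v : P (submod_val v).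
Proof. exact/asboolP/(valP (v : submod HP)). Qed.

Lemma submod_val_inj : injective submod_val.
Proof. by move=> u v; exact: val_inj. Qed.

End SubModule.

Record local_condition (T : topologicalType) (F : sheaf T)
    (P : forall U, F U -> Prop) : Prop := LocalCondition {
  lc_submod : forall U, submodP (@P U);
  lc_res : forall (U V : opens T) (h : V `<=` U) s, P U s -> P V (res h s);
  lc_local : forall (U : opens T) (I : Type) (V : I -> opens T)
    (VU : forall i, V i `<=` U) (s : F U), U `<=` \bigcup_i V i ->
    (forall i, P (V i) (res (VU i) s)) -> P U s }.

Section Subsheaf.
Variables (T : topologicalType) (F : sheaf T) (P : forall U, F U -> Prop).
Hypothesis HP : local_condition P.

Definition subsheaf_sec (U : opens T) : lmodType rat := submod_lmod (lc_submod HP U).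

Definition subsheaf_res (U V : opens T) (h : V `<=` U) (s : subsheaf_sec U) :
    subsheaf_sec V :=
  submod_mk (lc_submod HP V) (lc_res HP h (submod_valP s)).

Lemma subsheaf_res_linear (U V : opens T) (h : V `<=` U) :
  linear (subsheaf_res h).
Proof. by move=> a u v; apply: submod_val_inj; exact: res_linear. Qed.

Lemma subsheaf_res_id (U : opens T) (h : U `<=` U) s : subsheaf_res h s = s.
Proof. by apply: submod_val_inj; exact: res_id. Qed.

Lemma subsheaf_res_comp (U V W : opens T) (h : V `<=` U) (k : W `<=` V)
  (l : W `<=` U) s : subsheaf_res k (subsheaf_res h s) = subsheaf_res l s.
Proof. by apply: submod_val_inj; exact: res_comp. Qed.

Definition subpresheaf : presheaf T :=
  Presheaf subsheaf_res_linear subsheaf_res_id subsheaf_res_comp.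

Lemma subsheafP : sheaf_axiom subpresheaf.
Proof.
move=> U I V VU cov s scompat.
have [t [tE tU]] := @sheafP T F U I V VU cov (fun i => submod_val (s i))
  (fun i j W h k => congr1 (@submod_val _ _ _) (scompat i j W h k)).
have Pt : P t.
  by apply: (@lc_local T F P HP U I V VU t cov) => i; rewrite tE; exact: submod_valP.
exists (submod_mk (lc_submod HP U) Pt); split=> [i|t' t'E].
  by apply: submod_val_inj; exact: tE.
apply: submod_val_inj; apply: tU => i.
by rewrite -(t'E i).
Qed.

Definition subsheaf : sheaf T := Sheaf subsheafP.

End Subsheaf.

(** ** Basic sheaves and operations *)

Section FunctionSheaf.
Variable T : topologicalType.

Definition fun_res (U V : opens T) (h : V `<=` U) (s : set_type U -> rat^o) :
    set_type V -> rat^o :=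
  fun x => s (exist _ (set_val x) (mem_set (h _ (set_mem (valP x))))).

Lemma fun_res_linear (U V : opens T) (h : V `<=` U) : linear (fun_res h).
Proof. by []. Qed.

Lemma fun_res_id (U : opens T) (h : U `<=` U) s : fun_res h s = s.
Proof. by apply: funext => x; congr s; exact: val_inj. Qed.

Lemma fun_res_comp (U V W : opens T) (h : V `<=` U) (k : W `<=` V)
  (l : W `<=` U) s : fun_res k (fun_res h s) = fun_res l s.
Proof. by apply: funext => x; congr s; exact: val_inj. Qed.

Definition fun_presheaf : presheaf T :=
  @Presheaf T (fun U => (set_type U -> rat^o)%type) fun_res
    fun_res_linear fun_res_id fun_res_comp.

Lemma fun_sheafP : sheaf_axiom fun_presheaf.
Proof.
move=> U I V VU cov s scompat.
have cov' (x : set_type U) : exists i, oset (V i) (set_val x).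
  by have [i _ Vi] := cov _ (set_mem (valP x)); exists i.
pose idx x := sval (cid (cov' x)).
have idxP x : oset (V (idx x)) (set_val x) by exact: (svalP (cid (cov' x))).
pose t : set_type U -> rat^o := fun x =>
  s (idx x) (exist _ (set_val x) (mem_set (idxP x))).
have tE i : fun_res (VU i) t = s i.
  apply: funext => x; rewrite /fun_res /t.
  set y := exist _ _ _.
  have oW : open (V (idx y) `&` V i).
    by apply: openI; exact: oset_open.
  have Wx : (V (idx y) `&` V i) (set_val x).
    by split; [exact: (idxP y) | exact: (set_mem (valP x))].
  have := scompat (idx y) i (Opens oW) (@subIsetl _ _ _) (@subIsetr _ _ _).
  move=> /(congr1 (fun g => g (exist _ (set_val x) (mem_set Wx)))).
  rewrite /= /fun_res /= => e.
  by apply: etrans (etrans e _); congr (s _ _); exact: val_inj.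
exists t; split=> // t' t'E; apply: funext => x.
rewrite /t -(t'E (idx x)) /= /fun_res /=.
by congr t'; exact: val_inj.
Qed.

Definition fun_sheaf : sheaf T := Sheaf fun_sheafP.

Definition locally_constant (U : opens T) (s : fun_sheaf U) : Prop :=
  forall x : set_type U, \forall y \near x, s y = s x.

Lemma locally_constant_local : local_condition locally_constant.
Proof.
constructor.
- move=> U; split=> [x|a u v lu lv x]; first exact: filterE.
  apply: filterS2 (lu x) (lv x) => y uy vy.
  by rewrite -[LHS]/(a * u y + v y) uy vy.
- move=> U V h s ls x.
  pose g (y : set_type V) : set_type U :=
    exist _ (set_val y) (mem_set (h _ (set_mem (valP y)))).
  have cg : continuous g.
    apply: continuous_comp_initial; exact: initial_continuous.
  exact: (cg x _ (ls (g x))).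
- move=> U I V VU s cov ls x.
  have [i _ Vix] := cov _ (set_mem (valP x)).
  have := ls i (exist _ (set_val x) (mem_set Vix)).
  rewrite /prop_near1 nbhsE => -[_ [[O oO <-] Ox] sO].
  have oOV : open (set_val @^-1` (O `&` V i) : set (set_type U)).
    by exists (O `&` V i) => //; apply: openI => //; exact: oset_open.
  have Wx : nbhs x (set_val @^-1` (O `&` V i)) by exact: open_nbhs_nbhs.
  apply: filterS Wx => y [Oy Vy].
  have := sO (exist _ (set_val y) (mem_set Vy)) Oy.
  rewrite /= /fun_res /= => e.
  by apply: etrans (etrans e _); congr s; exact: val_inj.
Qed.

(* The constant sheaf with stalk the rational numbers. *)
Definition constant_sheaf : sheaf T := subsheaf locally_constant_local.

End FunctionSheaf.

Section Pushforward.
Variables (S T : topologicalType) (f : S -> T) (cf : continuous f).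

Definition pushs_presheaf (F : presheaf S) : presheaf T.
Proof.
refine (@Presheaf T (fun U => F (opreim cf U))
  (fun U V h => @res S F (opreim cf U) (opreim cf V) (fun x Vx => h _ Vx))
  _ _ _).
- by move=> U V h; exact: res_linear.
- by move=> U h s; exact: res_id.
- by move=> U V W h k l s; exact: res_comp.
Defined.

Lemma pushs_sheafP (F : sheaf S) : sheaf_axiom (pushs_presheaf F).
Proof.
move=> U I V VU cov s scompat.
apply: (@sheafP S F (opreim cf U) I (fun i => opreim cf (V i))
  (fun i x Vx => VU i _ Vx)).
  by move=> x /cov[i _ Vi]; exists i.
move=> i j W h k.
have oVij : open (V i `&` V j) by apply: openI; exact: oset_open.
have WV : W `<=` opreim cf (Opens oVij) by move=> x Wx; split; [exact: h|exact: k].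
have := scompat i j (Opens oVij) (@subIsetl _ _ _) (@subIsetr _ _ _).
move=> /(congr1 (res WV)) /=.
by rewrite !(res_comp _ _ h) !(res_comp _ _ k).
Qed.

Definition pushs (F : sheaf S) : sheaf T := Sheaf (@pushs_sheafP F).

Definition pushs_map (F G : sheaf S) (phi : sheaf_map F G) :
  sheaf_map (pushs F) (pushs G).
Proof.
refine (@SheafMap T (pushs F) (pushs G) (fun U => phi (opreim cf U)) _ _).
- by move=> U; exact: (@smap_linear S F G phi (opreim cf U)).
- by move=> U V h s; exact: (@smap_res S F G phi (opreim cf U) (opreim cf V)).
Defined.

End Pushforward.

Section DirectSum.
Variables (T : topologicalType) (F G : sheaf T).

Definition dsums_presheaf : presheaf T.
Proof.
refine (@Presheaf T (fun U => (F U * G U)%type)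
  (fun U V h s => (res h s.1, res h s.2)) _ _ _).
- by move=> U V h a u v; congr pair; exact: res_linear.
- by move=> U h [s1 s2]; congr pair; exact: res_id.
- by move=> U V W h k l s; congr pair; exact: res_comp.
Defined.

Lemma dsums_sheafP : sheaf_axiom dsums_presheaf.
Proof.
move=> U I V VU cov s scompat.
have [t1 [t1E t1U]] := @sheafP T F U I V VU cov (fun i => (s i).1)
  (fun i j W h k => congr1 fst (scompat i j W h k)).
have [t2 [t2E t2U]] := @sheafP T G U I V VU cov (fun i => (s i).2)
  (fun i j W h k => congr1 snd (scompat i j W h k)).
exists (t1, t2); split=> [i|[t1' t2'] t'E].
  by apply: injective_projections; [exact: t1E | exact: t2E].
congr pair; first by apply: t1U => i; rewrite -(t'E i).
by apply: t2U => i; rewrite -(t'E i).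
Qed.

Definition dsums : sheaf T := Sheaf dsums_sheafP.

End DirectSum.

Definition dsums_map (T : topologicalType) (F F' G G' : sheaf T)
    (phi : sheaf_map F F') (psi : sheaf_map G G') :
  sheaf_map (dsums F G) (dsums F' G').
Proof.
refine (@SheafMap T (dsums F G) (dsums F' G')
  (fun U s => (phi U s.1, psi U s.2)) _ _).
- by move=> U a u v; congr pair; exact: smap_linear.
- by move=> U V h s; congr pair; exact: smap_res.
Defined.

Section ZeroSheaf.
Variable T : topologicalType.

Definition zero_presheaf : presheaf T.
Proof.
refine (@Presheaf T (fun=> 'rV[rat]_0) (fun _ _ _ s => s) _ _ _).
- by move=> U V h a u v.
- by [].
- by [].
Defined.

Lemma zero_sheafP : sheaf_axiom zero_presheaf.
Proof.
move=> U I V VU cov s _; exists 0.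
by split=> [i|t _]; exact: (etrans (thinmx0 _) (esym (thinmx0 _))).
Qed.

Definition zero_sheaf : sheaf T := Sheaf zero_sheafP.

End ZeroSheaf.

Definition zero_map (T : topologicalType) (F G : sheaf T) : sheaf_map F G.
Proof.
refine (@SheafMap T F G (fun _ _ => 0) _ _).
- by move=> U a u v; rewrite scaler0 addr0.
- move=> U V h s; have := res_linear h (-1) (0 : G U) 0.
  by rewrite scaler0 addr0 scaleN1r addNr => ->.
Defined.

Definition id_map (T : topologicalType) (F : sheaf T) : sheaf_map F F.
Proof. by refine (@SheafMap T F F (fun _ s => s) _ _). Defined.

Definition comp_map (T : topologicalType) (F G H : sheaf T)
    (psi : sheaf_map G H) (phi : sheaf_map F G) : sheaf_map F H.
Proof.
refine (@SheafMap T F H (fun U s => psi U (phi U s)) _ _).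
- by move=> U a u v; rewrite (smap_linear phi) (smap_linear psi).
- by move=> U V h s; rewrite !smap_res.
Defined.

Definition scale_map (T : topologicalType) (F G : sheaf T) (c : rat)
    (phi : sheaf_map F G) : sheaf_map F G.
Proof.
refine (@SheafMap T F G (fun U s => c *: phi U s) _ _).
- move=> U a u v; rewrite (smap_linear phi) scalerDr !scalerA.
  by rewrite [c * a]mulrC.
- move=> U V h s; rewrite smap_res.
  have := res_linear h c (phi U s) 0.
  have := res_linear h (-1) (0 : G U) 0.
  by rewrite scaler0 addr0 scaleN1r addNr => ->; rewrite !addr0 => ->.
Defined.

(** ** The local system of a finite covering *)

(* The value of a section of the constant sheaf over [U], extended by 0. *)
Definition constant_val (T : topologicalType) (U : opens T)
    (s : constant_sheaf T U) (x : T) : rat :=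
  if pselect (oset U x) is left Ux
  then (submod_val s : set_type U -> rat) (exist _ x (mem_set Ux)) else 0.

Section TraceKernel.
Variables (E B : topologicalType) (p : E -> B) (cp : continuous p).
Hypothesis fp : finite_fibers p.

Definition trace_zero (U : opens B) (s : pushs cp (constant_sheaf E) U) : Prop :=
  forall b, oset U b ->
    \sum_(e \in p @^-1` [set b]) constant_val (U := opreim cp U) s e = 0.

Lemma trace_zero_local : local_condition trace_zero.
Proof.
have val_res (U V : opens B) (h : V `<=` U) s b e : oset V b -> p e = b ->
    constant_val (U := opreim cp V) (res h s : pushs cp (constant_sheaf E) V) e =
    constant_val (U := opreim cp U) s e.
  move=> Vb pe; rewrite /constant_val; case: pselect => [Ve|]; last first.
    by case; rewrite /opreim /= pe.
  case: pselect => [Ue|[]]; last by rewrite /opreim /= pe; exact: h.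
  by rewrite /= /fun_res; congr (submod_val s _); exact: val_inj.
constructor=> [U|U V h s s0 b Vb|U I V VU s cov s0 b Ub].
- split=> [b Ub|a u v u0 v0 b Ub].
    apply: fsbig1 => e _; rewrite /constant_val; case: pselect => // Ue.
  transitivity (a * (\sum_(e \in p @^-1` [set b])
        constant_val (U := opreim cp U) u e) +
      \sum_(e \in p @^-1` [set b]) constant_val (U := opreim cp U) v e); last first.
    by rewrite u0 // v0 // mulr0 addr0.
  rewrite mulr_fsumr -fsbig_split; last exact: fp.
  apply: eq_fsbigr => e _; rewrite /constant_val; case: pselect => // _.
  by rewrite /= mulr0 addr0.
- rewrite -[RHS](s0 b (h _ Vb)); apply: eq_fsbigr => e /set_mem pe.
  exact: (val_res _ _ h s b).
- have [i _ Vb] := cov _ Ub; rewrite -[RHS](s0 i b Vb).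
  apply: eq_fsbigr => e /set_mem pe; exact/esym/(val_res _ _ (VU i) s b).
Qed.

(* Kernel of the trace map [p_* Q_E -> Q_B], the summation over the sheets. *)
Definition trace_kernel : sheaf B := subsheaf trace_zero_local.

End TraceKernel.

(** * Complexes and the derived category *)

(* Differentials [cdiff i j] vanish unless [j = i + 1]. *)
Record complex (T : topologicalType) := Complex {
  cob :> int -> sheaf T;
  cdiff : forall i j, sheaf_map (cob i) (cob j);
  diff_off : forall i j U s, j != i + 1 -> cdiff i j U s = 0;
  diff_diff : forall i j k U s, cdiff j k U (cdiff i j U s) = 0 }.

Record cochain_map (T : topologicalType) (K L : complex T) := CochainMap {
  cmap :> forall i, sheaf_map (K i) (L i);
  cmap_diff : forall i j U s, cmap j U (cdiff K i j U s) = cdiff L i j U (cmap i U s) }.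

Definition id_cmap (T : topologicalType) (K : complex T) : cochain_map K K.
Proof. by refine (@CochainMap T K K (fun i => id_map (K i)) _). Defined.

Definition comp_cmap (T : topologicalType) (K L M : complex T)
    (psi : cochain_map L M) (phi : cochain_map K L) : cochain_map K M.
Proof.
refine (@CochainMap T K M (fun i => comp_map (psi i) (phi i)) _).
by move=> i j U s; rewrite /= !cmap_diff.
Defined.

Lemma smap0 (T : topologicalType) (F G : sheaf T) (phi : sheaf_map F G)
  (U : opens T) : phi U 0 = 0.
Proof.
have := smap_linear phi (-1) (0 : F U) 0.
by rewrite scaler0 addr0 scaleN1r addNr.
Qed.

Lemma res0 (T : topologicalType) (F : presheaf T) (U V : opens T)
  (h : V `<=` U) : res h (0 : F U) = 0.
Proof.
have := res_linear h (-1) (0 : F U) 0.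
by rewrite scaler0 addr0 scaleN1r addNr.
Qed.

(* A section vanishing locally is zero. *)
Lemma sec_eq0 (T : topologicalType) (F : sheaf T) (U : opens T) (I : Type)
  (V : I -> opens T) (VU : forall i, V i `<=` U) (s : F U) :
  U `<=` \bigcup_i V i -> (forall i, res (VU i) s = 0) -> s = 0.
Proof.
move=> cov s0.
have [|t [_ tU]] := @sheafP T F U I V VU cov (fun i => 0).
  by move=> i j W h k; rewrite !res0.
by rewrite -(tU s s0); apply: tU => i; exact: res0.
Qed.

Section ComplexOperations.
Variable T : topologicalType.

(* [F] placed in degree 0. *)
Definition conc (F : sheaf T) : complex T.
Proof.
by refine (@Complex T (fun i => if i == 0 then F else zero_sheaf T)
  (fun i j => zero_map _ _) _ _).
Defined.

(* [K[n]]: [K[n]^i = K^(i + n)], with differential [(-1)^n d]. *)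
Definition cshift (K : complex T) (n : int) : complex T.
Proof.
refine (@Complex T (fun i => K (i + n))
  (fun i j => scale_map ((-1) ^ n) (cdiff K (i + n) (j + n))) _ _).
- move=> i j U s ij; rewrite /= diff_off ?scaler0 //.
  by apply: contra ij => /eqP e; apply/eqP/(addIr n); rewrite e addrAC.
- move=> i j k U s /=.
  have -> : forall x, cdiff K (j + n) (k + n) U ((-1) ^ n *: x) =
    (-1) ^ n *: cdiff K (j + n) (k + n) U x.
    move=> x; have := smap_linear (cdiff K (j + n) (k + n)) ((-1) ^ n) x 0.
    by rewrite smap0 !addr0.
  by rewrite diff_diff !scaler0.
Defined.

Definition dsum (K L : complex T) : complex T.
Proof.
refine (@Complex T (fun i => dsums (K i) (L i))
  (fun i j => dsums_map (cdiff K i j) (cdiff L i j)) _ _).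
- by move=> i j U s ij; rewrite /= !diff_off.
- by move=> i j k U s; rewrite /= !diff_diff.
Defined.

Definition trunc_cond (K : complex T) (p i : int) (U : opens T) (s : K i U) : Prop :=
  if i < p then True else if i == p then cdiff K i (i + 1) U s = 0 else s = 0.

Lemma trunc_cond_local (K : complex T) (p i : int) :
  local_condition (@trunc_cond K p i).
Proof.
rewrite /trunc_cond; case: (ltP i p) => ip; first by constructor.
case: (i == p).
- constructor=> [U|U V h s s0|U I V VU s cov s0].
  + split=> [|a u v u0 v0]; first exact: smap0.
    by rewrite smap_linear u0 v0 scaler0 addr0.
  + by rewrite smap_res s0 res0.
  + by apply: (sec_eq0 (VU := VU) cov) => j; rewrite -smap_res.
- constructor=> [U|U V h s ->|U I V VU s cov s0].
  + by split=> // a u v -> ->; rewrite scaler0 addr0.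
  + exact: res0.
  + exact: (sec_eq0 cov s0).
Qed.

Definition trunc_obj (K : complex T) (p i : int) : sheaf T :=
  subsheaf (trunc_cond_local K p i).

Lemma trunc_cond_diff (K : complex T) (p i j : int) U (s : K i U) :
  trunc_cond p s -> trunc_cond p (cdiff K i j U s).
Proof.
move=> Ps; rewrite /trunc_cond; case: (ltP j p) => // pj.
case: eqVneq => jp; first exact: diff_diff.
have [ij|ij] := eqVneq j (i + 1); last exact: diff_off.
subst j; move: Ps; rewrite /trunc_cond.
case: (ltgtP i p) => [ip _|_ ->|_ //]; last exact: smap0.
by move: jp; rewrite eq_le pj andbT lezD1 ip.
Qed.

Definition trunc_diff (K : complex T) (p i j : int) :
  sheaf_map (trunc_obj K p i) (trunc_obj K p j).
Proof.
refine (@SheafMap T (trunc_obj K p i) (trunc_obj K p j)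
  (fun U s => submod_mk (lc_submod (trunc_cond_local K p j) U)
     (@trunc_cond_diff K p i j U _ (submod_valP s))) _ _).
- by move=> U a u v; apply: submod_val_inj; exact: smap_linear.
- by move=> U V h s; apply: submod_val_inj; exact: smap_res.
Defined.

(* The truncation: [K^i] for [i < p], the kernel of [d] for [i = p], zero for
   [i > p]. *)
Definition trunc (p : int) (K : complex T) : complex T.
Proof.
refine (@Complex T (trunc_obj K p) (trunc_diff K p) _ _).
- by move=> i j U s ij; apply: submod_val_inj; exact: diff_off.
- by move=> i j k U s; apply: submod_val_inj; exact: diff_diff.
Defined.

End ComplexOperations.

Definition push (S T : topologicalType) (f : S -> T) (cf : continuous f)
    (K : complex S) : complex T.
Proof.
refine (@Complex T (fun i => pushs cf (K i)) (fun i j => pushs_map cf (cdiff K i j))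
  _ _).
- by move=> i j U s ij; exact: (@diff_off S K i j (opreim cf U)).
- by move=> i j k U s; exact: (@diff_diff S K i j k (opreim cf U)).
Defined.

(** ** Quasi-isomorphisms *)

Section Cohomology.
Variable T : topologicalType.

Definition cocycle (K : complex T) (i : int) (U : opens T) (s : K i U) : Prop :=
  cdiff K i (i + 1) U s = 0.

(* The germ of [s] at [x] is a coboundary. *)
Definition coboundary_at (K : complex T) (i : int) (U : opens T) (s : K i U)
    (x : T) : Prop :=
  exists (V : opens T) (VU : V `<=` U) (t : K (i - 1) V),
    oset V x /\ res VU s = cdiff K (i - 1) i V t.

(* [phi] induces isomorphisms of the cohomology sheaves: injectivity and
   surjectivity of [H^i(K)_x -> H^i(L)_x] for all [i] and [x]. *)
Definition quasi_iso (K L : complex T) (phi : cochain_map K L) : Prop :=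
  forall (i : int) (x : T) (U : opens T), oset U x ->
    (forall s : K i U, cocycle s ->
       coboundary_at (phi i U s) x -> coboundary_at s x) /\
    (forall t : L i U, cocycle t ->
       exists (V : opens T) (VU : V `<=` U) (s : K i V),
         [/\ oset V x, cocycle s & coboundary_at (res VU t - phi i V s) x]).

(** ** Localization at the quasi-isomorphisms *)

Inductive dhom : complex T -> complex T -> Type :=
| Dmap K L : cochain_map K L -> dhom K L
| Dinv K L (phi : cochain_map K L) : quasi_iso phi -> dhom L K
| Dcomp K L M : dhom L M -> dhom K L -> dhom K M.

(* Equality of morphisms in the derived category. *)
Inductive deq : forall K L, dhom K L -> dhom K L -> Prop :=
| Deq_refl K L (a : dhom K L) : deq a a
| Deq_sym K L (a b : dhom K L) : deq a b -> deq b a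
| Deq_trans K L (a b c : dhom K L) : deq a b -> deq b c -> deq a c
| Deq_comp K L M (a a' : dhom L M) (b b' : dhom K L) :
    deq a a' -> deq b b' -> deq (Dcomp a b) (Dcomp a' b')
| Deq_assoc K L M N (a : dhom M N) (b : dhom L M) (c : dhom K L) :
    deq (Dcomp a (Dcomp b c)) (Dcomp (Dcomp a b) c)
| Deq_idl K L (a : dhom K L) : deq (Dcomp (Dmap (id_cmap L)) a) a
| Deq_idr K L (a : dhom K L) : deq (Dcomp a (Dmap (id_cmap K))) a
| Deq_map_comp K L M (psi : cochain_map L M) (phi : cochain_map K L) :
    deq (Dmap (comp_cmap psi phi)) (Dcomp (Dmap psi) (Dmap phi))
| Deq_invl K L (phi : cochain_map K L) (h : quasi_iso phi) :
    deq (Dcomp (Dinv h) (Dmap phi)) (Dmap (id_cmap K))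
| Deq_invr K L (phi : cochain_map K L) (h : quasi_iso phi) :
    deq (Dcomp (Dmap phi) (Dinv h)) (Dmap (id_cmap L)).

Definition derived_iso (K L : complex T) : Prop :=
  exists (a : dhom K L) (b : dhom L K),
    deq (Dcomp b a) (Dmap (id_cmap K)) /\ deq (Dcomp a b) (Dmap (id_cmap L)).

(** ** The bounded constructible derived category *)

(* The classes of the cocycles [s j] form a basis of the stalk [H^i(K)_y]. *)
Definition cohomology_basis_at (K : complex T) (i : int) (V : opens T) (r : nat)
    (s : 'I_r -> K i V) (y : T) : Prop :=
  (forall c : 'I_r -> rat, coboundary_at (\sum_j c j *: s j) y ->
     forall j, c j = 0) /\
  (forall (W : opens T) (WV : W `<=` V) (z : K i W), oset W y -> cocycle z ->
     exists c : 'I_r -> rat,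
       coboundary_at (z - res WV (\sum_j c j *: s j)) y).

(* The restriction to [A] of the cohomology sheaf [H^i(K)] is locally constant
   with finite-dimensional stalks. *)
Definition locally_constant_cohomology (K : complex T) (i : int) (A : set T) :
    Prop :=
  forall x, A x -> exists (V : opens T) (r : nat) (s : 'I_r -> K i V),
    [/\ oset V x, forall j, cocycle (s j) &
        forall y, oset V y -> A y -> cohomology_basis_at s y].

(* Constructibility is relative to some finite filtration by closed subsets. *)
Definition bounded_constructible (K : complex T) : Prop :=
  exists (N : nat) (Z : nat -> set T),
    [/\ forall i : int, (N%:Z < `|i|) -> forall (U : opens T) (s : K i U) x,
          cocycle s -> oset U x -> coboundary_at s x,
        forall j, closed (Z j), forall j, Z j `<=` Z j.+1, Z N = setT &
        forall (i : int) (j : nat), locally_constant_cohomology K i (strata Z j)].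

(* [D^b_c] is the full subcategory on the bounded constructible complexes. *)
Definition iso_Dbc (K L : complex T) : Prop :=
  [/\ bounded_constructible K, bounded_constructible L & derived_iso K L].

(** ** Injective resolutions *)

Definition injective_sheaf (I : sheaf T) : Prop :=
  forall (A B : sheaf T) (m : sheaf_map A B) (g : sheaf_map A I),
    (forall U : opens T, injective (m U)) ->
    exists g' : sheaf_map B I, forall U s, g' U (m U s) = g U s.

Definition injective_resolution (K I : complex T) : Prop :=
  [/\ forall i, injective_sheaf (I i),
      exists N : int, forall i, i < N -> forall U (s : I i U), s = 0 &
      exists phi : cochain_map K I, quasi_iso phi].

(* A chosen injective resolution; the default value is only reached for complexes
   whose cohomology is not bounded below. *)
Definition injective_model (K : complex T) : complex T :=
  if pselect (exists I, injective_resolution K I) is left h then sval (cid h)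
  else K.

End Cohomology.

Definition Rpush (S T : topologicalType) (f : S -> T) (cf : continuous f)
    (K : complex S) : complex T :=
  push cf (injective_model K).

(** * Deligne's complex *)

Definition lower_middle (k : nat) : nat := (k - 2)./2.
Definition upper_middle (k : nat) : nat := (k - 1)./2.

Definition set_incl (Y : Type) (A B : set Y) (AB : A `<=` B) (a : set_type A) :
    set_type B :=
  exist _ (set_val a) (mem_set (AB _ (set_mem (valP a)))).

Lemma set_incl_continuous (Y : topologicalType) (A B : set Y) (AB : A `<=` B) :
  continuous (set_incl AB).
Proof. by apply: continuous_comp_initial; exact: initial_continuous. Qed.

Lemma set_val_continuous (Y : topologicalType) (A : set Y) :
  continuous (set_val : set_type A -> Y).
Proof. exact: initial_continuous. Qed.

Section Deligne.
Variables (Y : topologicalType) (n : nat) (p : nat -> nat).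
Variables (U : nat -> set Y) (UU : forall k, U k `<=` U k.+1).

(* The complex on [U_(j+2)]. *)
Fixpoint deligne_step (A : complex (set_type (U 2))) (j : nat) :
    complex (set_type (U j.+2)) :=
  match j with
  | 0 => A
  | j'.+1 =>
      trunc ((p j'.+2)%:Z - n%:Z)
        (Rpush (@set_incl_continuous Y _ _ (@UU j'.+2)) (deligne_step A j'))
  end.

(* The last step lives on [U_(n+1)], the whole of [Y]. *)
Definition deligne (M : sheaf (set_type (U 2))) : complex Y :=
  push (@set_val_continuous Y (U n.-1.+2))
    (deligne_step (cshift (conc M) n%:Z) n.-1).

End Deligne.

(** * The refined stratification *)

Section Refined.
Variables (Y : topologicalType) (n : nat) (FY : nat -> set Y) (B : set Y).
Variable FB : nat -> set (set_type B).

(* The skeleton of codimension [k]. By local flatness, the piece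
   [S_alpha `&` T_beta] has dimension the minimum of those of [S_alpha] and
   [T_beta]; the pieces of codimension at least 2 cover [B]. *)
Definition refined_skeleton (k : nat) : set Y :=
  if (k <= 2)%N then B
  else [set y | exists (b : set_type B) (i j : nat),
    [/\ set_val b = y, strata FY i y, strata FB j b & (minn i j + k <= n)%N]].

Definition refined_open (k : nat) : set Y := ~` refined_skeleton k.

Lemma refined_open_sub k : refined_open k `<=` refined_open k.+1.
Proof.
apply: subsetC => y; rewrite /refined_skeleton.
case: (leqP k.+1 2) => [k2|_]; first by rewrite (ltnW k2).
move=> [b [i [j [by_ Si Sj ijk]]]]; case: ifP => _.
  by rewrite -by_; exact: set_valP.
by exists b, i, j; split=> //; apply: leq_trans ijk; rewrite leq_add2l.
Qed.

Definition IC (p : nat -> nat) (M : sheaf (set_type (~` B))) : complex Y :=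
  deligne n p refined_open_sub M.

End Refined.

(** * The covering away from the branch locus *)

Lemma restrict_preimage_continuous (X Y : topologicalType) (f : X -> Y)
  (cf : continuous f) (A : set Y) :
  continuous (restrict_preimage (p := f) (A := A)).
Proof.
apply: continuous_comp_initial => x.
apply: (@continuous_comp _ _ _ set_val f); first exact: initial_continuous.
exact: cf.
Qed.

Lemma restrict_preimage_fibers (X Y : topologicalType) (f : X -> Y)
  (ff : finite_fibers f) (A : set Y) :
  finite_fibers (restrict_preimage (p := f) (A := A)).
Proof.
move=> b; apply: (@sub_finite_set _ _
  ((set_val : set_type (f @^-1` A) -> X) @^-1` (f @^-1` [set set_val b]))).
  by move=> e; exact: congr1.
by apply: finite_preimage (ff _) => e e' _ _; exact: val_inj.
Qed.

Definition branch_local_system (R : realType) (X Y : topologicalType) (f : X -> Y)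
    (hf : branched_covering R f) : sheaf (set_type (~` branch_locus f)) :=
  trace_kernel (@restrict_preimage_continuous X Y f (bc_cont hf) (~` branch_locus f))
    (@restrict_preimage_fibers X Y f (bc_fin hf) (~` branch_locus f)).

(* Main.v *)
(* The direct image [f_* Q_X] has no higher direct images, as [f] is finite. Over the
   complement of the branch locus, averaging over the sheets splits it as [Q + L].
   Deligne's construction extends this splitting across the refined strata: the
   preimage [Z] in [X] of the skeleton of codimension [k] is filtered by pieces that
   map finite-to-one to [R^(n - k)], so the cohomology of the manifold [X] with
   support in [Z] vanishes below degree [k], and classes of degree at most [k - 2]
   extend uniquely across [Z]. As the middle perversities satisfy [p(k) <= k - 2],
   the truncated direct image of [f_* Q_X] restricted to [U_k] is its restriction to
   [U_(k+1)].

   The vanishing is local. In a chart, a compact set [Z] with a continuous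
   finite-to-one map to [R^m] has, by Ostrand's colouring of [R^m], arbitrarily fine
   closed covers of multiplicity at most [m + 1]; a nerve argument for such covers
   reduces the claim to closed boxes in [R^n], whose local cohomology is computed by
   Mayer-Vietoris. *)

Require Import Defs.
From HB Require Import structures.
From mathcomp Require Import all_boot all_order all_algebra.
From mathcomp Require Import all_classical all_reals.
From mathcomp Require Import topology normedtype.
From mathcomp Require Import ring lra zify.

Set Implicit Arguments.
Unset Strict Implicit.
Unset Printing Implicit Defensive.

Import Order.TTheory GRing.Theory Num.Theory.
Import numFieldNormedType.Exports.

Local Open Scope classical_set_scope.
Local Open Scope ring_scope.

(** * Sheaves and injective resolutions *)

(** The invariant carried through Deligne's steps concerns the direct sum of the two complexes: over
    each U_k its cohomology lives in the single degree -n, where it is f_* Q_X. Every complex with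
    this property receives a quasi-isomorphism from f_* Q_X [n], so the two sides are joined by a
    zigzag and no direct morphism between them is built.

    The obstacle is that Rj_* uses an arbitrarily chosen injective model, while the vanishing is
    known for a resolution of Q_X on X. The model is compared with the direct image of that
    resolution on sections over every open set, through a flabby exact mapping cone; what is then
    needed is that cocycles extend across the skeleton.

    Resolutions are by products of skyscrapers, so cochains are arbitrary functions on a set of
    indexed points: extending by zero and choosing point by point are free, and only the
    differential is constrained.

    Constructibility uses another filtration, by the cardinality of the fibres. It is bounded
    because the number of sheets, a class of degree 0, extends across codimension 2. *)

Section LinearExtension.
Variables (V : lmodType rat) (G0 : set (V * rat)).
Hypothesis G00 : G0 (0, 0).
Hypothesis G0L : forall a u q v r, G0 (u, q) -> G0 (v, r) ->
  G0 (a *: u + v, a * q + r).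
Hypothesis G01 : forall q, G0 (0, q) -> q = 0.

(** Zorn's lemma on single-valued linear graphs; a maximal one is defined everywhere, since a vector
    outside its domain could be sent to 0. *)
Lemma linear_extension : exists L : V -> rat,
  (forall a u v, L (a *: u + v) = a * L u + L v) /\
  forall v q, G0 (v, q) -> L v = q.
Proof.
(* [Zorn_bigcup] also takes the union of the empty chain, so the empty set has to satisfy [P]. *)
pose P (G : set (V * rat)) := [/\ G !=set0 -> G0 `<=` G,
  forall a u q v r, G (u, q) -> G (v, r) -> G (a *: u + v, a * q + r) &
  forall q, G (0, q) -> q = 0].
have [|G [[Gn GL G1] Gmax]] := @Zorn_bigcup _ P.
  move=> F FP tF; split.
  - move=> [x [A FA Ax]] y Gy; exists A => //; have [An _ _] := FP _ FA.
    by apply: An => //; exists x.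
  - move=> a u q v r [A FA Au] [B FB Bv].
    have [AB|BA] := tF _ _ FA FB.
      exists B => //; have [_ BL _] := FP _ FB.
      by apply: BL => //; exact: AB.
    exists A => //; have [_ AL _] := FP _ FA.
    by apply: AL => //; exact: BA.
  - by move=> q [A FA Aq]; have [_ _] := FP _ FA; apply.
have G0G : G0 `<=` G.
  apply: Gn; apply: contrapT => Ge.
  apply: (Gmax G0); last by split=> // _ y.
  rewrite properEneq; split; last by move=> x Gx; case: Ge; exists x.
  by apply/eqP => GG; apply: Ge; exists (0, 0); rewrite GG.
have Gu v q r : G (v, q) -> G (v, r) -> q = r.
  move=> /(GL (-1)) Gq /Gq; rewrite scaleN1r addNr mulN1r => /G1 /eqP.
  by rewrite addrC subr_eq0 => /eqP.
have Gt v : exists q, G (v, q).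
  apply: contrapT => vG.
  pose H := [set w | exists2 u, G u & exists c, w = (c *: v + u.1, u.2)].
  apply: (Gmax H).
    rewrite properEneq; split.
      apply/eqP => GH; apply: vG; exists 0; rewrite GH.
      by exists (0, 0); [exact: G0G | exists 1; rewrite scale1r addr0].
    by move=> u Gu'; exists u => //; exists 0; rewrite scale0r add0r; case: u {Gu'}.
  split.
  - by move=> _ w /G0G Gw; exists w => //; exists 0; rewrite scale0r add0r; case: w {Gw}.
  - move=> a u q w r [[u' q'] Gu' [c [-> ->]]] [[w' r'] Gw' [d [-> ->]]] /=.
    exists (a *: u' + w', a * q' + r'); first exact: GL.
    exists (a * c + d); congr pair => /=.
    by rewrite scalerDr scalerDl scalerA addrACA.
  - move=> q [[u q'] Gu' [c [/esym e ->]]] /=.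
    have [c0|cn] := eqVneq c 0.
      by move: e Gu'; rewrite c0 scale0r add0r /= => ->; exact: G1.
    case: vG; exists (- c^-1 * q' + 0).
    have := GL (- c^-1) _ _ _ _ Gu' (G0G _ G00).
    rewrite addr0; congr (G (_, _)).
    move: e => /= /eqP; rewrite addrC addr_eq0 => /eqP ->.
    by rewrite scalerN scaleNr opprK scalerA mulVf // scale1r.
pose L v := sval (cid (Gt v)); have LG v : G (v, L v) := svalP (cid (Gt v)).
exists L; split=> [a u v|v q /G0G]; last exact: Gu.
by apply: Gu (LG _) _; exact: GL.
Qed.

End LinearExtension.

(** Used with [I] the open sets of the space: a germ is represented by the family of its
    restrictions, which replaces the stalk, a colimit, by a plain product. *)
Definition secfam (I : Type) (F : I -> lmodType rat) : Type := forall i, F i.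

Section Family.
Variables (I : Type) (F : I -> lmodType rat).
Implicit Types u v w : secfam F.

HB.instance Definition _ := gen_eqMixin (secfam F).
HB.instance Definition _ := gen_choiceMixin (secfam F).

Let fzero : secfam F := fun i => 0.
Let fopp u : secfam F := fun i => - u i.
Let fadd u v : secfam F := fun i => u i + v i.
Let fscale (a : rat) u : secfam F := fun i => a *: u i.

Let faddA : associative fadd.
Proof. by move=> u v w; apply: functional_extensionality_dep => i; exact: addrA. Qed.
Let faddC : commutative fadd.
Proof. by move=> u v; apply: functional_extensionality_dep => i; exact: addrC. Qed.
Let fadd0 : left_id fzero fadd.
Proof. by move=> u; apply: functional_extensionality_dep => i; exact: add0r. Qed.
Let faddN : left_inverse fzero fopp fadd.
Proof. by move=> u; apply: functional_extensionality_dep => i; exact: addNr. Qed.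

HB.instance Definition _ := GRing.isZmodule.Build (secfam F) faddA faddC fadd0 faddN.

Let fscaleA a b u : fscale a (fscale b u) = fscale (a * b) u.
Proof. by apply: functional_extensionality_dep => i; exact: scalerA. Qed.
Let fscale1 : left_id 1 fscale.
Proof. by move=> u; apply: functional_extensionality_dep => i; exact: scale1r. Qed.
Let fscaleDr : right_distributive fscale +%R.
Proof. by move=> a u v; apply: functional_extensionality_dep => i; exact: scalerDr. Qed.
Let fscaleDl u : {morph (fscale^~ u : rat -> secfam F) : a b / a + b}.
Proof. by move=> a b; apply: functional_extensionality_dep => i; exact: scalerDl. Qed.

HB.instance Definition _ := GRing.Zmodule_isLmodule.Build rat (secfam F)
  fscaleA fscale1 fscaleDr fscaleDl.

Lemma secfamE a u v i : (a *: u + v) i = a *: u i + v i.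
Proof. by []. Qed.

End Family.

Section Restriction.
Variables (T : topologicalType) (F : presheaf T).

Lemma resD (U V : opens T) (h : V `<=` U) (s t : F U) : res h (s + t) = res h s + res h t.
Proof. by have := res_linear h 1 s t; rewrite !scale1r. Qed.

Lemma resZ (U V : opens T) (h : V `<=` U) a (s : F U) : res h (a *: s) = a *: res h s.
Proof. by have := res_linear h a s 0; rewrite res0 !addr0. Qed.

Lemma resN (U V : opens T) (h : V `<=` U) (s : F U) : res h (- s) = - res h s.
Proof. by rewrite -!scaleN1r resZ. Qed.

Lemma resB (U V : opens T) (h : V `<=` U) (s t : F U) : res h (s - t) = res h s - res h t.
Proof. by rewrite resD resN. Qed.

Lemma res_res (U V W : opens T) (h : V `<=` U) (k : W `<=` V) (s : F U) :
  res k (res h s) = res (subset_trans k h) s.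
Proof. exact: res_comp. Qed.

Lemma res_irr (U V : opens T) (h k : V `<=` U) (s : F U) : res h s = res k s.
Proof. by rewrite -(res_comp h (@subset_refl _ V) k) res_id. Qed.

End Restriction.

Section SheafMap.
Variables (T : topologicalType) (F G : sheaf T) (f : sheaf_map F G).

Lemma smapD U s t : f U (s + t) = f U s + f U t.
Proof. by have := smap_linear f 1 s t; rewrite !scale1r. Qed.

Lemma smapZ U a s : f U (a *: s) = a *: f U s.
Proof. by have := smap_linear f a s 0; rewrite smap0 !addr0. Qed.

Lemma smapN U s : f U (- s) = - f U s.
Proof. by rewrite -!scaleN1r smapZ. Qed.

Lemma smapB U s t : f U (s - t) = f U s - f U t.
Proof. by rewrite smapD smapN. Qed.

End SheafMap.

Definition opensI (T : topologicalType) (U V : opens T) : opens T :=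
  Opens (openI (oset_open U) (oset_open V)).

Definition opensU (T : topologicalType) (U V : opens T) : opens T :=
  Opens (openU (oset_open U) (oset_open V)).

Definition opensT (T : topologicalType) : opens T := Opens (@openT T).

Lemma opensIl (T : topologicalType) (U V : opens T) : opensI U V `<=` U.
Proof. exact: subIsetl. Qed.

Lemma opensIr (T : topologicalType) (U V : opens T) : opensI U V `<=` V.
Proof. exact: subIsetr. Qed.

Arguments opensIl {T U V}.
Arguments opensIr {T U V}.

Lemma opens_eq (T : topologicalType) (U V : opens T) : oset U = oset V -> U = V.
Proof.
case: U V => [U oU] [V oV] /= e; subst V.
by congr Opens; exact: Prop_irrelevance.
Qed.

Section GermFunctional.
Variables (T : topologicalType) (C : sheaf T) (x : T).

(* A linear functional on the stalk of [C] at [x]. *)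
Record germ_functional := GermFunctional {
  gfun :> forall U : opens T, C U -> rat;
  gfun_linear : forall U a s t, gfun (U := U) (a *: s + t) = a * gfun s + gfun t;
  gfun_out : forall (U : opens T) (s : C U), ~ oset U x -> gfun s = 0;
  gfun_res : forall (U V : opens T) (h : V `<=` U) s, oset V x ->
    gfun (res h s) = gfun s }.

Variable G : forall U : opens T, C U -> rat -> Prop.
Arguments G : clear implicits.
Hypothesis G0 : forall U, oset U x -> G U 0 0.
Hypothesis GL : forall (U : opens T) a s q t r, oset U x -> G U s q -> G U t r ->
  G U (a *: s + t) (a * q + r).
Hypothesis GR : forall (U V : opens T) (h : V `<=` U) s q, oset V x ->
  G U s q -> G V (res h s) q.
Hypothesis G1 : forall (U : opens T) q, oset U x -> G U 0 q -> q = 0.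

(** [G] is a partial functional on germs at [x]. A family of sections is given a value when it
    agrees with a germ on all small neighbourhoods of [x]; [linear_extension] then applies, and its
    result does not depend on the neighbourhood where a germ is taken. *)
Lemma germ_functional_extension : exists phi : germ_functional,
  forall (U : opens T) s q, oset U x -> G U s q -> phi U s = q.
Proof.
pose V := secfam (fun U : opens T => C U).
pose H : set (V * rat) := [set w | exists (W : opens T) (s : C W),
  [/\ oset W x, G W s w.2 & forall (W' : opens T) (h : W' `<=` W), oset W' x ->
    w.1 W' = res h s]].
have H0 : H (0, 0).
  exists (opensT T), 0; split=> //; first exact: G0.
  by move=> W' h _; rewrite res0.
have [||L [LL LH]] := linear_extension H0.
- move=> a u q v r [W [s [Wx Gs sE]]] [W' [s' [W'x Gs' s'E]]].
  exists (opensI W W'), (a *: res opensIl s + res opensIr s'); split=> //.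
    by apply: GL => //; apply: GR.
  move=> O h Ox; rewrite [LHS]secfamE resD resZ !res_res.
  by rewrite -(sE _ _ Ox) -(s'E _ _ Ox).
- move=> q [W [s [Wx Gs sE]]]; apply: (G1 Wx).
  by have := sE W (@subset_refl _ _) Wx; rewrite res_id => e; move: Gs; rewrite -e.
have L0 : L 0 = 0 by apply: LH.
pose fam (U : opens T) (s : C U) : V := fun W =>
  match pselect (oset U x /\ W `<=` U) with left h => res h.2 s | right _ => 0 end.
have famL U a s t : fam U (a *: s + t) = a *: fam U s + fam U t.
  apply: functional_extensionality_dep => W; rewrite secfamE /fam.
  by case: pselect => [h|_]; rewrite ?scaler0 ?addr0 // resD resZ.
have fam_res (U W : opens T) (h : W `<=` U) s : oset W x ->
    L (fam W (res h s)) = L (fam U s).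
  move=> Wx.
  have : H (-1 *: fam U s + fam W (res h s), 0).
    exists W, 0; split=> //; first exact: G0.
    move=> W' h' W'x; rewrite res0 [LHS]secfamE /fam.
    case: pselect => [k|[]]; last by split; [exact: h|exact: subset_trans h' h].
    case: pselect => [k'|[]//]; rewrite res_res scaleN1r.
    by rewrite (res_irr _ k.2) addNr.
  by move=> /LH; rewrite LL mulN1r => /eqP; rewrite addrC subr_eq0 => /eqP.
have fam_out U (s : C U) : ~ oset U x -> L (fam U s) = 0.
  move=> Ux; rewrite -L0; congr L; apply: functional_extensionality_dep => W.
  by rewrite /fam; case: pselect => // -[].
exists (@GermFunctional (fun U s => L (fam U s))
  (fun U a s t => etrans (congr1 L (famL U a s t)) (LL a _ _)) fam_out fam_res).
move=> U s q Ux Gs /=; apply: LH; exists U, s; split=> // W h W'x.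
rewrite /= /fam; case: pselect => [k|[]]; first exact: res_irr.
by split=> //; exact: h.
Qed.

End GermFunctional.

(** * Products of skyscrapers as injective sheaves *)

Section ProductOfSkyscrapers.
Variables (T : topologicalType) (I : Type) (pi : I -> T).

(** Sections over every open set are functions on the whole of [I], zero at the indices lying
    outside; restriction merely cuts off, and sections over different open sets are compared as
    functions. *)
Definition supported (U : opens T) (s : I -> rat^o) : Prop :=
  forall i, ~ oset U (pi i) -> s i = 0.

Lemma supported_submod U : submodP (supported U).
Proof.
split=> // a u v u0 v0 i Ui.
by rewrite -[LHS]/(a * u i + v i) u0 // v0 // mulr0 addr0.
Qed.

Definition sky_sec (U : opens T) : lmodType rat := submod_lmod (supported_submod U).

Definition cut (A : set T) (s : I -> rat^o) : I -> rat^o :=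
  fun i => if `[< A (pi i) >] then s i else 0.

Lemma cut_supported (V : opens T) s : supported V (cut V s).
Proof. by move=> i Vi; rewrite /cut; case: asboolP. Qed.

Definition sky_mk (U : opens T) (s : I -> rat) : sky_sec U :=
  submod_mk (supported_submod U) (@cut_supported U s).

Definition sky_val (U : opens T) (s : sky_sec U) : I -> rat := submod_val s.

Definition sky_res (U V : opens T) (h : V `<=` U) (s : sky_sec U) : sky_sec V :=
  sky_mk V (sky_val s).

Lemma sky_valE (U V : opens T) (h : V `<=` U) (s : sky_sec U) i : oset V (pi i) ->
  sky_val (sky_res h s) i = sky_val s i.
Proof. by move=> Vi; rewrite -[LHS]/(if `[< oset V (pi i) >] then sky_val s i else 0) asboolT. Qed.

Lemma sky_mkE (U : opens T) (s : I -> rat) i : oset U (pi i) ->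
  sky_val (sky_mk U s) i = s i.
Proof. by move=> Vi; rewrite -[LHS]/(if `[< oset U (pi i) >] then s i else 0) asboolT. Qed.

Lemma sky_out (U : opens T) (s : sky_sec U) i : ~ oset U (pi i) -> sky_val s i = 0.
Proof. by move=> Ui; apply: (submod_valP s). Qed.

Lemma sky_eq (U : opens T) (s t : sky_sec U) :
  (forall i, oset U (pi i) -> sky_val s i = sky_val t i) -> s = t.
Proof.
move=> st; apply: submod_val_inj; apply: funext => i.
have [Ui|Ui] := pselect (oset U (pi i)); first exact: st.
by rewrite [LHS]sky_out // [RHS]sky_out.
Qed.

Lemma sky_valL (U : opens T) a (s t : sky_sec U) i :
  sky_val (a *: s + t) i = a * sky_val s i + sky_val t i.
Proof. by []. Qed.

Lemma sky_res_linear (U V : opens T) (h : V `<=` U) : linear (sky_res h).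
Proof.
move=> a s t; apply: sky_eq => i Vi.
by rewrite sky_valL !sky_valE // sky_valL.
Qed.

Lemma sky_res_id (U : opens T) (h : U `<=` U) s : sky_res h s = s.
Proof. by apply: sky_eq => i Ui; rewrite sky_valE. Qed.

Lemma sky_res_comp (U V W : opens T) (h : V `<=` U) (k : W `<=` V)
  (l : W `<=` U) s : sky_res k (sky_res h s) = sky_res l s.
Proof.
by apply: sky_eq => i Wi; rewrite !sky_valE //; apply: (k).
Qed.

Definition sky_presheaf : presheaf T :=
  Presheaf sky_res_linear sky_res_id sky_res_comp.

Lemma sky_sheafP : sheaf_axiom sky_presheaf.
Proof.
move=> U J V VU cov s scompat.
have cov' (i : I) : oset U (pi i) -> exists j, oset (V j) (pi i).
  by move=> /cov[j _ Vj]; exists j.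
pose t : I -> rat := fun i =>
  if pselect (oset U (pi i)) is left h then sky_val (s (sval (cid (cov' i h)))) i else 0.
have tE j : sky_res (VU j) (sky_mk U t) = s j.
  apply: sky_eq => i Vi; have Ui := VU j _ Vi.
  rewrite sky_valE // sky_mkE // /t; case: pselect => // h.
  case: cid => j' /= Vi'.
  have := scompat j' j (opensI (V j') (V j)) opensIl opensIr.
  move=> /(congr1 (fun g => sky_val g i)); rewrite !sky_valE //; exact: conj.
exists (sky_mk U t); split=> // t' t'E; apply: sky_eq => i Ui.
have [j Vj] := cov' i Ui.
by rewrite -(sky_valE (VU j) _ Vj) tE -(t'E j) [LHS]sky_valE.
Qed.

Definition sky : sheaf T := Sheaf sky_sheafP.

End ProductOfSkyscrapers.

Section SkyMap.
Variables (T : topologicalType) (C : sheaf T) (I : Type) (pi : I -> T).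
Variable phi : forall i, germ_functional C (pi i).

Lemma sky_map_supported (U : opens T) (s : C U) : supported pi U (fun i => phi i U s).
Proof. by move=> i Ui; exact: gfun_out. Qed.

Definition sky_map : sheaf_map C (sky pi).
Proof.
refine (@SheafMap T C (sky pi)
  (fun U s => submod_mk (supported_submod pi U) (sky_map_supported s)) _ _).
- by move=> U a s t; apply: submod_val_inj; apply: funext => i; exact: gfun_linear.
- move=> U V h s; apply: sky_eq => i Vi; rewrite [RHS]sky_valE //.
  exact: gfun_res.
Defined.

End SkyMap.

Definition exact_at (T : topologicalType) (A B C : sheaf T) (f : sheaf_map A B)
    (g : sheaf_map B C) (x : T) : Prop :=
  forall (U : opens T) (s : B U), oset U x -> g U s = 0 ->
    exists (V : opens T) (h : V `<=` U) (t : A V), oset V x /\ res h s = f V t.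

Definition flabby (T : topologicalType) (F : sheaf T) : Prop :=
  forall (U V : opens T) (h : V `<=` U) (s : F V), exists t : F U, res h t = s.

Section Sky.
Variable T : topologicalType.

Lemma sky_flabby (I : Type) (pi : I -> T) : flabby (sky pi).
Proof.
move=> U V h s; exists (sky_mk pi U (sky_val s)); apply: sky_eq => i Vi.
by rewrite [LHS]sky_valE // sky_mkE //; exact: h.
Qed.

(** A map into a skyscraper at a point is a functional on the stalk there, so each coordinate
    extends by [germ_functional_extension]; the values forced on the image of [m] are consistent
    because [m] is injective. *)
Lemma sky_injective (I : Type) (pi : I -> T) : injective_sheaf (sky pi).
Proof.
move=> A B m g mI.
have ext i : exists phi : germ_functional B (pi i), forall (U : opens T) (s : A U),
    oset U (pi i) -> phi U (m U s) = sky_val (g U s) i.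
  pose G (U : opens T) (s : B U) (q : rat) :=
    exists (W : opens T) (h : W `<=` U) (a : A W),
      [/\ oset W (pi i), res h s = m W a & sky_val (g W a) i = q].
  have [U Ui|U a s q t r Ui|U V h s q Vi|U q Ui|phi phiE] :=
      @germ_functional_extension T B (pi i) G.
  - by exists U, (@subset_refl _ _), 0; rewrite res0 !smap0.
  - move=> [W [h [b [Wi sE bE]]]] [W' [h' [b' [Wi' sE' bE']]]].
    exists (opensI W W'), (subset_trans opensIl h), (a *: res opensIl b + res opensIr b').
    have WWi : oset (opensI W W') (pi i) by [].
    split=> //.
      rewrite resD resZ smapD smapZ !smap_res -sE -sE' !res_res.
      by congr (_ + _); exact: res_irr.
    by rewrite smapD smapZ sky_valL !smap_res !sky_valE // bE bE'.
  - move=> [W [k [b [Wi sE bE]]]].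
    exists (opensI V W), opensIl, (res opensIr b); split=> //.
      by rewrite smap_res -sE !res_res; exact: res_irr.
    by rewrite smap_res [LHS]sky_valE.
  - move=> [W [h [a [Wi /esym]]]]; rewrite res0 -(smap0 m) => /mI -> <-.
    by rewrite smap0.
  - exists phi => U s Ui; apply: phiE => //.
    by exists U, (@subset_refl _ _), s; rewrite res_id.
pose phi i := sval (cid (ext i)).
exists (sky_map phi) => U s; apply: sky_eq => i Ui.
exact: (svalP (cid (ext i))).
Qed.

(** One coordinate for every functional on a stalk of [C] that kills the image of [f]: a germ
    outside the image is detected by one of them, whence exactness. *)
Lemma sky_cokernel (A C : sheaf T) (f : sheaf_map A C) :
  exists (I : Type) (pi : I -> T) (D : sheaf_map C (sky pi)),
    (forall U s, D U (f U s) = 0) /\ forall x, exact_at f D x.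
Proof.
pose I := {x : T & {phi : germ_functional C x | forall U s, phi U (f U s) = 0}}.
pose pi (i : I) := projT1 i.
pose D := @sky_map T C I pi (fun i => sval (projT2 i)).
exists I, pi, D; split=> [U s|x U c Ux Dc].
  by apply: sky_eq => i Ui; exact: (svalP (projT2 i)).
apply: contrapT => nex.
(* The functional that is 0 on the image and 1 on the germ of [c]; it is single-valued because that
   germ is not in the image. *)
pose G (U' : opens T) (s : C U') (q : rat) :=
  exists (W : opens T) (h : W `<=` U') (k : W `<=` U) (a : A W),
    oset W x /\ res h s = f W a + q *: res k c.
have [V Vx|V a s q t r Vx|V V' h s q Vx|V q Vx|phi phiE] :=
    @germ_functional_extension T C x G.
- exists (opensI V U), opensIl, opensIr, 0; split=> //.
  by rewrite res0 smap0 scale0r addr0.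
- move=> [W [h [k [b [Wi sE]]]]] [W' [h' [k' [b' [Wi' sE']]]]].
  exists (opensI W W'), (subset_trans opensIl h), (subset_trans opensIl k),
    (a *: res opensIl b + res opensIr b'); split=> //.
  have hh : opensI W W' `<=` V := subset_trans opensIr h'.
  rewrite resD resZ -[res _ s](res_comp h opensIl) sE.
  rewrite (res_irr _ hh) -[res _ t](res_comp h' opensIr) sE'.
  rewrite !resD !resZ smapD smapZ !smap_res !res_res.
  rewrite (res_irr _ (subset_trans opensIl k)) scalerDr scalerDl !scalerA.
  by rewrite addrACA.
- move=> [W [k [l [b [Wi sE]]]]].
  exists (opensI V' W), opensIl, (subset_trans opensIr l), (res opensIr b); split=> //.
  rewrite res_res (res_irr _ (subset_trans opensIr k)) -(res_comp k opensIr) sE.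
  by rewrite resD resZ smap_res res_res.
- move=> [W [h [k [a [Wx /esym]]]]]; rewrite res0 => /eqP.
  rewrite addrC addr_eq0 => /eqP e; apply: contrapT => /eqP qn; apply: nex.
  exists W, k, (- q^-1 *: a); split=> //.
  by rewrite smapZ scaleNr -scalerN -e scalerA mulVf // scale1r.
have phif V s : phi V (f V s) = 0.
  have [Vx|Vx] := pselect (oset V x); last exact: gfun_out.
  apply: phiE => //; exists (opensI V U), opensIl, opensIr, (res opensIl s); split=> //.
  by rewrite scale0r addr0 smap_res.
have := congr1 (fun s => sky_val s (existT _ x (exist _ phi phif) : I)) Dc.
rewrite -[LHS]/(phi U c).
have -> : phi U c = 1.
  apply: phiE => //; exists U, (@subset_refl _ _), (@subset_refl _ _), 0.
  by rewrite smap0 add0r scale1r.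
by move/eqP; rewrite oner_eq0.
Qed.

(** [J] embeds into a product of skyscrapers, of which injectivity makes it a retract; sections are
    extended in the product and retracted. *)
Lemma injective_flabby (J : sheaf T) : injective_sheaf J -> flabby J.
Proof.
move=> Jinj; have [I [pi [D [_ DE]]]] := sky_cokernel (zero_map (zero_sheaf T) J).
have [|r rD] := Jinj _ _ D (id_map J).
  move=> U s t st; apply/eqP; rewrite -subr_eq0; apply/eqP.
  have ex (x : {x | oset U x}) := DE (sval x) U (s - t) (svalP x).
  have ex0 : D U (s - t) = 0 by rewrite smapB st subrr.
  pose V x := sval (cid (ex x ex0)).
  have VU x : V x `<=` U := sval (cid (svalP (cid (ex x ex0)))).
  apply: (sec_eq0 (VU := VU)).
    move=> x Ux; exists (exist _ x Ux) => //.
    by have [a []] := svalP (cid (svalP (cid (ex (exist _ x Ux) ex0)))).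
  move=> x; have [a [_ e]] := svalP (cid (svalP (cid (ex x ex0)))).
  exact: (etrans (res_irr _ _ _) e).
move=> U V h s; have [t tE] := sky_flabby h (D V s).
by exists (r U t); rewrite -smap_res tE rD.
Qed.

End Sky.

Section PairMaps.
Variable T : topologicalType.

Definition pair_map (A B C : sheaf T) (f : sheaf_map A B) (g : sheaf_map A C) :
  sheaf_map A (dsums B C).
Proof.
refine (@SheafMap T A (dsums B C) (fun U s => (f U s, g U s)) _ _).
- by move=> U a u v; rewrite !smap_linear.
- by move=> U V h s; rewrite !smap_res.
Defined.

Definition fst_map (A B : sheaf T) : sheaf_map (dsums A B) A.
Proof. by refine (@SheafMap T (dsums A B) A (fun U s => s.1) _ _). Defined.

Definition snd_map (A B : sheaf T) : sheaf_map (dsums A B) B.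
Proof. by refine (@SheafMap T (dsums A B) B (fun U s => s.2) _ _). Defined.

Definition inl_map (A B : sheaf T) : sheaf_map A (dsums A B) :=
  pair_map (id_map A) (zero_map A B).

Definition inr_map (A B : sheaf T) : sheaf_map B (dsums A B) :=
  pair_map (zero_map B A) (id_map B).

Lemma zero_sheaf_eq0 (U : opens T) (s : zero_sheaf T U) : s = 0.
Proof. exact: (etrans (thinmx0 _) (esym (thinmx0 _))). Qed.

Lemma zero_sheaf_injective : injective_sheaf (zero_sheaf T).
Proof.
move=> A B m g _; exists (zero_map B _) => U s.
by rewrite [RHS]zero_sheaf_eq0.
Qed.

End PairMaps.

(** * Injective resolutions of complexes bounded below *)

Section Resolution.
Variables (T : topologicalType) (K : complex T) (N : int).
Hypothesis K0 : forall i, i < N -> forall U (s : K i U), s = 0.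

Local Notation KN j := (K (N + j%:Z)).
Local Notation dK j := (cdiff K (N + j%:Z) (N + j.+1%:Z)).

Record stage (j : nat) := Stage {
  st_prev : sheaf T;
  st_idx : Type;
  st_pi : st_idx -> T;
  st_map : sheaf_map (dsums (KN j) st_prev) (sky st_pi) }.

(** Differential of the mapping cone of the augmentation built so far, with the sign [- d] on the
    [K] part. Embedding its cokernel into the next term makes the cone exact, which is what makes
    the augmentation a quasi-isomorphism. *)
Definition cone_map j (s : stage j) :
  sheaf_map (dsums (KN j) (st_prev s)) (dsums (KN j.+1) (sky (@st_pi j s))) :=
  pair_map (scale_map (-1) (comp_map (dK j) (fst_map _ _))) (@st_map j s).

Definition next_spec j (s : stage j) := sky_cokernel (cone_map s).

Definition stage_next j (s : stage j) : stage j.+1 :=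
  let c1 := cid (next_spec s) in let c2 := cid (svalP c1) in
  let c3 := cid (svalP c2) in
  @Stage j.+1 (sky (@st_pi j s)) (sval c1) (sval c2) (sval c3).

Definition stage0 : stage 0 :=
  let c1 := cid (sky_cokernel (zero_map (zero_sheaf T) (dsums (KN 0) (zero_sheaf T)))) in
  let c2 := cid (svalP c1) in let c3 := cid (svalP c2) in
  @Stage 0 (zero_sheaf T) (sval c1) (sval c2) (sval c3).

Fixpoint stages j : stage j :=
  match j with 0 => stage0 | j'.+1 => stage_next (stages j') end.

Lemma stage_next_kills j (s : stage j) U e : @st_map _ (stage_next s) U (cone_map s U e) = 0.
Proof. exact: (svalP (cid (svalP (cid (svalP (cid (next_spec s))))))).1. Qed.

Lemma stage_next_exact j (s : stage j) x : exact_at (cone_map s) (@st_map _ (stage_next s)) x.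
Proof. exact: (svalP (cid (svalP (cid (svalP (cid (next_spec s))))))).2. Qed.

Lemma stage0_exact x : exact_at (zero_map (zero_sheaf T) _) (@st_map _ stage0) x.
Proof.
exact: (svalP (cid (svalP (cid (svalP (cid (sky_cokernel
  (zero_map (zero_sheaf T) (dsums (KN 0) (zero_sheaf T)))))))))).2.
Qed.

Lemma st_mapD j (s : stage j) U a b :
  @st_map j s U (a, 0) + @st_map j s U (0, b) = @st_map j s U (a, b).
Proof.
rewrite -smapD; congr (st_map _ _ _).
by congr pair; rewrite /= ?addr0 ?add0r.
Qed.

Definition res_aug j : sheaf_map (KN j) (sky (@st_pi j (stages j))) :=
  comp_map (@st_map j (stages j)) (inl_map _ _).
Definition res_diff j :
    sheaf_map (sky (@st_pi j (stages j))) (sky (@st_pi j.+1 (stages j.+1))) :=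
  comp_map (@st_map j.+1 (stages j.+1)) (inr_map _ _).

Lemma res_kills j U a b :
  res_aug j.+1 U (- dK j U a) + res_diff j U (@st_map j (stages j) U (a, b)) = 0.
Proof.
rewrite -scaleN1r.
exact: (etrans (@st_mapD j.+1 (stages j.+1) U (-1 *: dK j U a) (st_map (stages j) U (a, b)))
  (@stage_next_kills j (stages j) U (a, b))).
Qed.

Lemma res_aug_diff j U s : res_aug j.+1 U (dK j U s) = res_diff j U (res_aug j U s).
Proof.
have := @res_kills j U s 0; rewrite [X in X + _]smapN => /eqP.
by rewrite addrC subr_eq0 => /eqP /esym.
Qed.

Lemma res_diff_diff j U s : res_diff j.+1 U (res_diff j U s) = 0.
Proof.
apply: etrans (@res_kills j.+1 U 0 s); apply: esym.
by rewrite [X in X + _](_ : _ = 0) ?add0r // smap0 oppr0 smap0.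
Qed.

Lemma res_aug_inj U x (s : KN 0 U) : oset U x -> res_aug 0 U s = 0 ->
  exists (V : opens T) (h : V `<=` U), oset V x /\ res h s = 0.
Proof.
move=> Ux s0; have [V [h [t [Vx e]]]] := @stage0_exact x U (s, 0) Ux s0.
by exists V, h; split=> //; exact: (congr1 fst e).
Qed.

Lemma res_exact j U x (s : KN j.+1 U) (e : sky (@st_pi j (stages j)) U) : oset U x ->
  res_aug j.+1 U s + res_diff j U e = 0 ->
  exists (V : opens T) (h : V `<=` U) (t : KN j V) (r : st_prev (stages j) V),
    [/\ oset V x, res h s = - dK j V t & res h e = @st_map j (stages j) V (t, r)].
Proof.
move=> Ux se0.
have [|V [h [[t r] [Vx E]]]] := @stage_next_exact j (stages j) x U (s, e) Ux.
  exact: (etrans (esym (@st_mapD j.+1 (stages j.+1) U s e)) se0).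
exists V, h, t, r; split=> //; last exact: (congr1 snd E).
by rewrite -scaleN1r; exact: (congr1 fst E).
Qed.

(** The outcome of [stages] without its recursion. The last three fields are the exactness of the
    cone, split by degree because the term before degree 0 is zero. *)
Record sky_resolution := SkyResolution {
  rs_idx : nat -> Type;
  rs_pi : forall j, rs_idx j -> T;
  rs_aug : forall j, sheaf_map (KN j) (sky (@rs_pi j));
  rs_diff : forall j, sheaf_map (sky (@rs_pi j)) (sky (@rs_pi j.+1));
  rs_aug_diff : forall j U s, rs_aug j.+1 U (dK j U s) = rs_diff j U (rs_aug j U s);
  rs_diff_diff : forall j U s, rs_diff j.+1 U (rs_diff j U s) = 0;
  rs_aug_inj : forall U x (s : KN 0 U), oset U x -> rs_aug 0 U s = 0 ->
    exists (V : opens T) (h : V `<=` U), oset V x /\ res h s = 0;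
  rs_exact0 : forall U x (s : KN 1 U) (e : sky (@rs_pi 0) U), oset U x ->
    rs_aug 1 U s + rs_diff 0 U e = 0 ->
    exists (V : opens T) (h : V `<=` U) (t : KN 0 V),
    [/\ oset V x, res h s = - dK 0 V t & res h e = rs_aug 0 V t];
  rs_exactS : forall j U x (s : KN j.+2 U) (e : sky (@rs_pi j.+1) U), oset U x ->
    rs_aug j.+2 U s + rs_diff j.+1 U e = 0 ->
    exists (V : opens T) (h : V `<=` U) (t : KN j.+1 V) (r : sky (@rs_pi j) V),
    [/\ oset V x, res h s = - dK j.+1 V t &
        res h e = rs_aug j.+1 V t + rs_diff j V r] }.

Lemma sky_resolutionP : exists R : sky_resolution, True.
Proof.
suff R : sky_resolution by exists R.
apply: (@SkyResolution (fun j => st_idx (stages j)) (fun j => @st_pi j (stages j))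
  res_aug res_diff res_aug_diff res_diff_diff res_aug_inj).
- move=> U x s e Ux /(res_exact Ux) [V [h [t [r [Vx E1 E2]]]]].
  exists V, h, t; split=> //; apply: etrans E2 _.
  by have -> : r = 0 by exact: zero_sheaf_eq0.
- move=> j U x s e Ux /(res_exact Ux) [V [h [t [r [Vx E1 E2]]]]].
  exists V, h, t, r; split=> //; apply: etrans E2 _.
  exact: (esym (@st_mapD j.+1 (stages j.+1) V t r)).
Qed.

End Resolution.

Section NatComplex.
Variables (T : topologicalType) (F : nat -> sheaf T).
Variable D : forall j, sheaf_map (F j) (F j.+1).
Hypothesis DD : forall j U s, D j.+1 U (D j U s) = 0.

Definition nc_ob (a : int) : sheaf T :=
  match a with Posz j => F j | Negz _ => zero_sheaf T end.

(** A complex has a differential between any two indices, so [D j] is transported along a decided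
    equality [j.+1 = k]; [eq_axiomK] removes the transport when [k] is literally [j.+1]. *)
Definition nc_diff (a b : int) : sheaf_map (nc_ob a) (nc_ob b) :=
  match a, b return sheaf_map (nc_ob a) (nc_ob b) with
  | Posz j, Posz k =>
      match eq_comparable j.+1 k with
      | left e => eq_rect j.+1 (fun k => sheaf_map (F j) (F k)) (D j) k e
      | right _ => zero_map _ _
      end
  | _, _ => zero_map _ _
  end.

Lemma nc_diffS (j : nat) : nc_diff (Posz j) (Posz j.+1) = D j.
Proof. by rewrite /nc_diff; case: eq_comparable => // e; rewrite (eq_axiomK e). Qed.

Lemma nc_diff_off a b U s : b != a + 1 -> nc_diff a b U s = 0.
Proof.
case: a b s => [j|j] [k|k] s //= jk; case: eq_comparable => // e.
by case/eqP: jk; rewrite -e -addn1 PoszD.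
Qed.

Lemma nc_diff_diff a b c U s : nc_diff b c U (nc_diff a b U s) = 0.
Proof.
have [ab|ab] := eqVneq b (a + 1); last first.
  rewrite (@nc_diff_off a b) //; exact: smap0.
have [bc|bc] := eqVneq c (b + 1); last by rewrite nc_diff_off.
case: a ab s => [j|j] ab s; last exact: smap0.
have {}ab : b = j.+1 by rewrite ab -PoszD addn1.
have {}bc : c = j.+2 by rewrite bc ab -PoszD addn1.
by subst b c; rewrite !nc_diffS DD.
Qed.

Definition nat_complex (N : int) : complex T.
Proof.
refine (@Complex T (fun i => nc_ob (i - N)) (fun i j => nc_diff (i - N) (j - N)) _ _).
- move=> i j U s ij; apply: nc_diff_off; apply: contra ij => /eqP e; apply/eqP.
  by apply: (addIr (- N)); rewrite e addrAC.
- by move=> i j k U s; exact: nc_diff_diff.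
Defined.

End NatComplex.

Definition cast_map (T : topologicalType) (K : complex T) (i j : int) (e : i = j) :
  sheaf_map (K i) (K j) := eq_rect i (fun j => sheaf_map (K i) (K j)) (id_map _) j e.

Section ResolutionComplex.
Variables (T : topologicalType) (K : complex T) (N : int).
Hypothesis K0 : forall i, i < N -> forall U (s : K i U), s = 0.

Variable R : sky_resolution K N.

Local Notation F := (fun j => sky (@rs_pi T K N R j)).
Local Notation D := (@rs_diff T K N R).

Definition sky_complex : complex T := nat_complex (@rs_diff_diff T K N R) N.

Definition nc_aug (a i : int) (e : i = N + a) : sheaf_map (K i) (nc_ob F a) :=
  match a return i = N + a -> sheaf_map (K i) (nc_ob F a) with
  | Posz j => fun e => comp_map (rs_aug R j) (cast_map K e)
  | Negz _ => fun _ => zero_map _ _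
  end e.

Lemma nc_aug_diff (a b i k : int) (ea : i = N + a) (eb : k = N + b) U s :
  nc_aug eb U (cdiff K i k U s) = nc_diff D a b U (nc_aug ea U s).
Proof.
have [ab|ab] := eqVneq b (a + 1); last first.
  rewrite nc_diff_off // diff_off ?smap0 //.
  by apply: contra ab => /eqP e; apply/eqP/(addrI N); rewrite -eb e ea addrA.
case: a ea ab => [j|j] ea ab.
  have {}ab : b = j.+1 by rewrite ab -PoszD addn1.
  by subst b i k; rewrite nc_diffS; exact: rs_aug_diff.
have -> : s = 0 by apply: K0; rewrite ea NegzE -ltrBrDl subrr oppr_lt0.
by rewrite !smap0.
Qed.

Lemma subrKC' (i : int) : i = N + (i - N).
Proof. by rewrite addrC subrK. Qed.

Definition sky_aug : cochain_map K sky_complex.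
Proof.
refine (@CochainMap T K sky_complex (fun i => nc_aug (subrKC' i)) _).
by move=> i j U s; exact: nc_aug_diff.
Defined.

Lemma nc_aug_inj (a b k i : int) (ab : b = a + 1) (ea : k = N + a) (eb : i = N + b)
    (U V : opens T) (VU : V `<=` U) (s : K i U) (t : nc_ob F a V) x : oset V x ->
  nc_aug eb V (res VU s) = nc_diff D a b V t ->
  exists (W : opens T) (WU : W `<=` U) (u : K k W),
    oset W x /\ res WU s = cdiff K k i W u.
Proof.
move=> Vx; case: a ab ea t => [j|j] ab ea t e.
  have {}ab : b = j.+1 by rewrite ab -PoszD addn1.
  subst b; rewrite nc_diffS in e; subst i k.
  have {}e : rs_aug R j.+1 V (- res VU s) + D j V t = 0.
    by rewrite smapN -e; exact: addNr.
  have [W [h [u [Wx e1]]]] : exists (W : opens T) (h : W `<=` V) (u : K (N + j%:Z) W),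
      oset W x /\ res h (- res VU s) = - cdiff K (N + j%:Z) (N + j.+1%:Z) W u.
    case: j t s e => [|j] t s e.
      by have [W [h [u [Wx e1 _]]]] := rs_exact0 Vx e; exists W, h, u.
    by have [W [h [u [r [Wx e1 _]]]]] := rs_exactS Vx e; exists W, h, u.
  exists W, (subset_trans h VU), u; split=> //.
  by apply: oppr_inj; rewrite -e1 resN res_res.
case: j ab ea t e => [|j] ab ea t e.
  have {}ab : b = Posz 0 by rewrite ab.
  subst b i.
  have {}e : rs_aug R 0 V (res VU s) = 0 by exact: e.
  have [W [h [Wx e1]]] := rs_aug_inj Vx e.
  exists W, (subset_trans h VU), 0; split=> //.
  by rewrite smap0 -e1 res_res.
have -> : s = 0.
  by apply: K0; rewrite eb ab NegzE -ltrBrDl subrr -addn1 PoszD opprD addrK oppr_lt0.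
by exists V, VU, 0; split=> //; rewrite res0 smap0.
Qed.

Lemma nc_aug_surj (a b c i : int) (ab : b = a + 1) (bc : c = b + 1)
    (eb : i = N + b) (U : opens T) (t : nc_ob F b U) x : oset U x ->
  nc_diff D b c U t = 0 ->
  exists (V : opens T) (VU : V `<=` U) (s : K i V), [/\ oset V x, cocycle s &
    exists (W : opens T) (WV : W `<=` V) (r : nc_ob F a W), oset W x /\
    res WV (res VU t - nc_aug eb V s) = nc_diff D a b W r].
Proof.
move=> Ux.
case: b ab bc eb t => [j|j] ab bc eb t t0; last first.
  exists U, (@subset_refl _ _), 0; split=> //; first exact: smap0.
  exists U, (@subset_refl _ _), 0; split=> //.
  by rewrite [LHS]zero_sheaf_eq0 [RHS]zero_sheaf_eq0.
have {}bc : c = j.+1 by rewrite bc -PoszD addn1.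
subst c; rewrite nc_diffS in t0.
have ei : i + 1 = N + j.+1%:Z by rewrite eb -addrA -PoszD addn1.
have {}t0 : rs_aug R j.+1 U 0 + D j U t = 0 by rewrite smap0 add0r.
subst i; case: j ab t t0 ei => [|j] ab t t0 ei.
  have [V [h [s [Vx /eqP ds e]]]] := rs_exact0 Ux t0.
  rewrite res0 eq_sym oppr_eq0 in ds; move: ds => /eqP ds.
  exists V, h, s; split=> //; first by rewrite /cocycle ei.
  exists V, (@subset_refl _ _), 0; split=> //; rewrite res_id smap0 e.
  exact: subrr.
have {}ab : a = j by apply: (addIr 1); rewrite -ab -PoszD addn1.
have [V [h [s [r [Vx /eqP ds e]]]]] := rs_exactS Ux t0.
rewrite res0 eq_sym oppr_eq0 in ds; move: ds => /eqP ds.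
exists V, h, s; split=> //; first by rewrite /cocycle ei.
subst a; exists V, (@subset_refl _ _), r; split=> //.
by rewrite res_id nc_diffS e [X in X - _]addrC; exact: addrK.
Qed.

Lemma sky_aug_quasi_iso : quasi_iso sky_aug.
Proof.
have predE (i : int) : i - N = i - 1 - N + 1 by rewrite addrAC subrK.
have succE (i : int) : i + 1 - N = i - N + 1 by rewrite addrAC.
move=> i x U Ux; split=> [s s0 [V [VU [t [Vx e]]]]|t t0].
  have [|W [h [u [Wx E]]]] := @nc_aug_inj _ _ (i - 1) i (predE i) (subrKC' _)
    (subrKC' i) U V VU s t x Vx; last by exists W, h, u.
  by rewrite -e -[RHS](@smap_res _ _ _ (sky_aug i)).
exact: (@nc_aug_surj _ _ _ i (predE i) (succE i) (subrKC' i) U t x Ux t0).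
Qed.

Lemma sky_complex_resolution : injective_resolution K sky_complex.
Proof.
split.
- move=> i; rewrite /sky_complex /=; case: (i - N) => j; first exact: sky_injective.
  exact: zero_sheaf_injective.
- exists N => i iN U; rewrite /sky_complex /=; have : i - N < 0 by rewrite subr_lt0.
  by case: (i - N) => // j _ s; exact: zero_sheaf_eq0.
- by exists sky_aug; exact: sky_aug_quasi_iso.
Qed.

End ResolutionComplex.

(** * Flabby sheaves and supports *)

Section Gluing.
Variables (T : topologicalType) (F : sheaf T).

Lemma sheaf_glue (U : opens T) (I : Type) (V : I -> opens T) (VU : forall i, V i `<=` U)
    (s : forall i, F (V i)) : U `<=` \bigcup_i V i ->
  (forall i j, res (@opensIl _ (V i) (V j)) (s i) = res (@opensIr _ (V i) (V j)) (s j)) ->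
  exists t : F U, forall i, res (VU i) t = s i.
Proof.
move=> cov st; have [|t [tE _]] := @sheafP T F U I V VU cov s; last by exists t.
move=> i j W h k.
have hk : W `<=` opensI (V i) (V j) by move=> x Wx; split; [exact: h|exact: k].
by rewrite -(res_comp opensIl hk) st (res_comp opensIr hk).
Qed.

Lemma sheaf_glue2 (U V W : opens T) (UW : U `<=` W) (VW : V `<=` W) (s : F U) (t : F V) :
  W `<=` U `|` V -> res (@opensIl _ U V) s = res (@opensIr _ U V) t ->
  exists r : F W, res UW r = s /\ res VW r = t.
Proof.
move=> cov st; pose O (b : bool) := if b then U else V.
pose OW b : O b `<=` W := if b as b return O b `<=` W then UW else VW.
pose r b : F (O b) := if b as b return F (O b) then s else t.
have [||z zE] := @sheaf_glue W bool O OW r.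
- by move=> x /cov[Ux|Vx]; [exists true|exists false].
- case=> -[] /=; first exact: res_irr.
  + exact: st.
  + have h : opensI V U `<=` opensI U V by move=> x [].
    by rewrite (res_irr _ (subset_trans h opensIr)) -(res_comp opensIr h) -st res_res;
      exact: res_irr.
  + exact: res_irr.
- by exists z; split; [exact: (zE true)|exact: (zE false)].
Qed.

Lemma sec_locally_eq0 (U : opens T) (s : F U) :
  (forall x, oset U x -> exists (V : opens T) (h : V `<=` U), oset V x /\ res h s = 0) ->
  s = 0.
Proof.
move=> s0; pose V (x : {x | oset U x}) := sval (cid (s0 _ (svalP x))).
pose P x := svalP (cid (s0 _ (svalP x))) : exists h : V x `<=` U, _.
apply: (@sec_eq0 T F U _ V (fun x => sval (cid (P x)))).
  move=> x Ux; exists (exist _ x Ux) => //.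
  exact: (svalP (cid (P (exist _ x Ux)))).1.
by move=> x; exact: (svalP (cid (P x))).2.
Qed.

Lemma sec_locally_eq (U : opens T) (s t : F U) :
  (forall x, oset U x -> exists (V : opens T) (h : V `<=` U),
    oset V x /\ res h s = res h t) -> s = t.
Proof.
move=> st; apply/eqP; rewrite -subr_eq0; apply/eqP; apply: sec_locally_eq0 => x.
by move=> /st[V [h [Vx e]]]; exists V, h; rewrite resB e subrr.
Qed.

End Gluing.

Section FlabbySurjective.
Variables (T : topologicalType) (B C : sheaf T) (f : sheaf_map B C).
Variables (U : opens T) (c : C U).
Hypothesis ker_ext : forall (V : opens T) (h : V `<=` U) (a : B V), f V a = 0 ->
  exists a' : B U, f U a' = 0 /\ res h a' = a.
Hypothesis loc : forall x, oset U x -> exists (V : opens T) (h : V `<=` U) (b : B V),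
  oset V x /\ res h c = f V b.

Record partial_lift := PartialLift {
  pl_dom :> opens T;
  pl_sub : pl_dom `<=` U;
  pl_val : B pl_dom;
  pl_eq : f pl_dom pl_val = res pl_sub c }.

Definition pl_le (p q : partial_lift) : Prop :=
  exists h : p `<=` q, res h (pl_val q) = pl_val p.

(** Zorn's lemma on partial lifts. A maximal one is defined everywhere: near a missing point a local
    lift differs from it by a section of the kernel, and [ker_ext] extends this difference so that
    it can be absorbed. *)
Lemma flabby_surjective : exists b : B U, f U b = c.
Proof.
pose R (p q : partial_lift) : bool := `[< pl_le p q >].
pose O0 : opens T := Opens (@open0 T).
have O0U : O0 `<=` U by [].
have e0 : f O0 0 = res O0U c.
  by apply: sec_locally_eq => x [].
have [|||p pmax] := @ZL_preorder _ (PartialLift e0) R.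
- by move=> p; apply/asboolP; exists (@subset_refl _ _); exact: res_id.
- move=> q p r /asboolP[h hE] /asboolP[k kE]; apply/asboolP.
  by exists (subset_trans h k); rewrite -hE -kE res_res.
- move=> A Atot.
  pose I := {p | A p}.
  pose V : opens T := Opens (@bigcup_open T partial_lift A
    (fun p => oset (pl_dom p)) (fun p _ => oset_open p)).
  have VU : V `<=` U by move=> x [p Ap px]; exact: (pl_sub px).
  have IV (i : I) : sval i `<=` V by move=> x ix; exists (sval i) => //; exact: svalP.
  have [||b bE] := @sheaf_glue T B V I (fun i => sval i) IV (fun i => pl_val (sval i)).
  + by move=> x [p Ap px]; exists (exist _ p Ap).
  + move=> [p Ap] [q Aq] /=.
    have [/asboolP[h <-]|/asboolP[h <-]] := Atot _ _ Ap Aq.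
      by rewrite res_res; exact: res_irr.
    by rewrite res_res; exact: res_irr.
  have bc : f V b = res VU c.
    apply: sec_locally_eq => x [p Ap px]; exists p, (IV (exist _ p Ap)); split=> //.
    have := bE (exist _ p Ap); rewrite /= => {}bE.
    by rewrite -smap_res [X in f _ X]bE pl_eq res_res; exact: res_irr.
  exists (PartialLift bc) => p Ap; apply/asboolP.
  by exists (IV (exist _ p Ap)); exact: (bE (exist _ p Ap)).
have Up : U `<=` p.
  move=> x Ux; have [W [h [b [Wx bE]]]] := loc Ux.
  have [|a [a0 aE]] := ker_ext (subset_trans (@opensIl _ p W) (@pl_sub p))
      (a := res opensIl (pl_val p) - res opensIr b).
    rewrite smapB !smap_res pl_eq -bE !res_res; apply/eqP; rewrite subr_eq0; apply/eqP.
    exact: res_irr.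
  pose V := opensU p W.
  have pV : p `<=` V by move=> y; left.
  have WV : W `<=` V by move=> y; right.
  have VU : V `<=` U by move=> y [/pl_sub|/h].
  have [//||r [rp rW]] := @sheaf_glue2 T B p W V pV WV (pl_val p) (b + res h a).
    have E : res opensIr (res h a) = res opensIl (pl_val p) - res opensIr b.
      by rewrite -aE res_res; exact: res_irr.
    by rewrite resD E addrC subrK.
  have rc : f V r = res VU c.
    apply: sec_locally_eq => y [py|Wy].
      by exists p, pV; rewrite -smap_res rp pl_eq res_res; split=> //; exact: res_irr.
    exists W, WV; split=> //; rewrite -smap_res rW smapD -bE smap_res a0 res0 addr0.
    by rewrite res_res; exact: res_irr.
  have /pmax/asboolP[k _] : R p (PartialLift rc) by apply/asboolP; exists pV.
  by apply: (k); right.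
exists (res Up (pl_val p)); rewrite smap_res pl_eq res_res.
by rewrite (res_irr _ (@subset_refl _ U)) res_id.
Qed.

End FlabbySurjective.

Section FlabbyComplex.
Variables (T : topologicalType) (K : nat -> sheaf T).
Variable D : forall j, sheaf_map (K j) (K j.+1).
Hypothesis DD : forall j U s, D j.+1 U (D j U s) = 0.
Hypothesis Kflabby : forall j, flabby (K j).

(** The acyclicity of flabby sheaves, on the level of sections: a cocycle over a smaller [V] is by
    induction the differential of a section over [V], which extends by flabbiness; so kernels extend
    and [flabby_surjective] applies. *)
Lemma flabby_exact m (U : opens T) :
  (forall (V : opens T) (h : V `<=` U) (a : K 0 V), D 0 V a = 0 ->
    exists a' : K 0 U, D 0 U a' = 0 /\ res h a' = a) ->
  (forall j x, (j < m)%N -> oset U x -> exact_at (D j) (D j.+1) x) ->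
  forall z : K m.+1 U,
  (forall x, oset U x -> exists (V : opens T) (h : V `<=` U) (t : K m V),
    oset V x /\ res h z = D m V t) ->
  exists t : K m U, D m U t = z.
Proof.
elim: m U => [|m IH] U ker0 ex z zloc; apply: flabby_surjective => // V VU a a0.
have [|j x jm Vx|x Vx|b bE] := IH V _ _ a.
- move=> W h b b0; have [b' [b'0 b'E]] := ker0 W (subset_trans h VU) b b0.
  exists (res VU b'); rewrite smap_res b'0 res0; split=> //.
  by rewrite res_res -b'E; exact: res_irr.
- by apply: ex; [exact: ltnW|exact: VU].
- by have := ex m x (ltnSn m) (VU _ Vx) V a Vx a0.
have [b' b'E] := Kflabby VU b.
by exists (D m U b'); rewrite DD -smap_res b'E bE.
Qed.

End FlabbyComplex.

(** * Sections and cohomology with supports *)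

Section Supports.
Variables (T : topologicalType) (D : opens T).

(* Sections supported on the complement of [D]. *)
Definition van_cond (F : sheaf T) (U : opens T) (s : F U) : Prop :=
  res (@opensIl _ U D) s = 0.

Lemma van_condP (F : sheaf T) (U V : opens T) (h : V `<=` U) (s : F U) :
  V `<=` D -> van_cond s -> res h s = 0.
Proof.
move=> VD s0; have k : V `<=` opensI U D by move=> x Vx; split; [exact: h|exact: VD].
by rewrite -(res_comp opensIl k) s0 res0.
Qed.

Lemma van_local (F : sheaf T) : local_condition (@van_cond F).
Proof.
constructor.
- move=> U; split=> [|a u v u0 v0]; first exact: res0.
  by rewrite /van_cond resD resZ u0 v0 scaler0 addr0.
- move=> U V h s s0; rewrite /van_cond res_res.
  by apply: van_condP s0; exact: opensIr.
- move=> U I V VU s cov s0; apply: sec_locally_eq0 => x [Ux Dx].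
  have [i _ Vx] := cov _ Ux.
  have h : opensI (V i) D `<=` opensI U D by move=> y [Vy Dy]; split=> //; exact: VU Vy.
  exists (opensI (V i) D), h; split=> //.
  by rewrite -[RHS](s0 i) !res_res; exact: res_irr.
Qed.

Definition van (F : sheaf T) : sheaf T := subsheaf (van_local F).

Definition van_val (F : sheaf T) (U : opens T) (s : van F U) : F U := submod_val s.

Definition van_mk (F : sheaf T) (U : opens T) (s : F U) (s0 : van_cond s) : van F U :=
  submod_mk (lc_submod (van_local F) U) s0.

Lemma van_eq (F : sheaf T) (U : opens T) (s t : van F U) : van_val s = van_val t -> s = t.
Proof. exact: submod_val_inj. Qed.

Lemma van_map_cond (F G : sheaf T) (f : sheaf_map F G) U (s : van F U) :
  van_cond (f U (van_val s)).
Proof.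
have s0 : van_cond (van_val s) := submod_valP s.
by rewrite /van_cond -smap_res s0 smap0.
Qed.

Definition van_map (F G : sheaf T) (f : sheaf_map F G) : sheaf_map (van F) (van G).
Proof.
refine (@SheafMap T (van F) (van G) (fun U s => van_mk (van_map_cond f s)) _ _).
- by move=> U a u v; apply: van_eq; exact: smap_linear.
- by move=> U V h s; apply: van_eq; exact: smap_res.
Defined.

(** The section is glued with zero on the part of [U] inside [D] before being extended, which keeps
    the support of the extension away from [D]. *)
Lemma van_flabby (F : sheaf T) : flabby F -> flabby (van F).
Proof.
move=> Ff U V h s.
have s0 : van_cond (van_val s) := submod_valP s.
pose UD := opensI U D; pose W := opensU V UD.
have VW : V `<=` W by move=> x; left.
have DW : UD `<=` W by move=> x; right.
have WU : W `<=` U by move=> x [/h|[]].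
have [//||r [rV rD]] := @sheaf_glue2 T F V UD W VW DW (van_val s) 0.
  by rewrite res0; apply: van_condP s0 => x [_ []].
have [t tE] := Ff _ _ WU r.
have t0 : van_cond t.
  by rewrite /van_cond -[RHS]rD -tE res_res; exact: res_irr.
exists (van_mk t0); apply: van_eq; rewrite -[RHS]rV -tE res_res.
exact: res_irr.
Qed.

End Supports.

Section SupportedComplex.
Variables (T : topologicalType) (K : nat -> sheaf T).
Variable D : forall j, sheaf_map (K j) (K j.+1).
Hypothesis DD : forall j U s, D j.+1 U (D j U s) = 0.
Hypothesis Kflabby : forall j, flabby (K j).
Hypothesis K00 : forall U (s : K 0 U), s = 0.

(* The local cohomology with support in the complement of [O] vanishes below
   degree [m] near [x]; the complex starts in degree 1. *)
Definition van_exact (O : opens T) (m : nat) (x : T) : Prop :=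
  forall j, (j < m)%N -> exact_at (van_map O (D j)) (van_map O (D j.+1)) x.

Lemma van_exact_sec (O : opens T) (m : nat) (U : opens T) :
  (forall x, oset U x -> van_exact O m x) ->
  forall j (z : K j.+1 U), (j < m)%N -> van_cond O z -> D j.+1 U z = 0 ->
  exists t : K j U, van_cond O t /\ D j U t = z.
Proof.
move=> ex j z jm z0 dz.
have [||||x Ux|t tE] := @flabby_exact T (fun j => van O (K j))
    (fun j => van_map O (D j)) _ _ j U _ _ (van_mk z0).
- by move=> i V s; apply: van_eq; exact: DD.
- by move=> i; apply: van_flabby.
- move=> V h a _; exists 0; split; first exact: smap0.
  by apply: van_eq; rewrite [RHS]K00; exact: K00.
- by move=> i x ij Ux; apply: ex => //; apply: ltn_trans jm.
- by apply: (ex x Ux j jm) => //; apply: van_eq; exact: dz.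
exists (van_val t); split; first exact: (submod_valP t).
exact: (congr1 (@van_val _ O _ _) tE).
Qed.

(** Exact sequence of the closed supports, the complement of [O2] inside that of [O1]: a primitive
    found over [O2] is extended with its support, and the error it leaves is supported off [O2]. *)
Lemma van_exact_filtration (O1 O2 : opens T) (m : nat) : O1 `<=` O2 ->
  (forall x, oset O2 x -> van_exact O1 m x) -> (forall x, van_exact O2 m x) ->
  forall x, van_exact O1 m x.
Proof.
move=> O12 ex1 ex2 x j jm U z Ux dz.
have z0 : van_cond O1 (van_val z) := submod_valP z.
have {}dz : D j.+1 U (van_val z) = 0 := congr1 (@van_val _ O1 _ _) dz.
have [|||t [t0 tE]] := @van_exact_sec O1 m (opensI U O2) _ j
    (res opensIl (van_val z)) jm.
- by move=> y [_ /ex1].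
- by apply: (lc_res (van_local O1 (K j.+1))).
- by rewrite smap_res dz res0.
have [u uE] := van_flabby (@Kflabby j) (@opensIl _ U O2) (van_mk t0).
have {}uE : res opensIl (van_val u) = t := congr1 (@van_val _ O1 _ _) uE.
have v0 : van_cond O2 (van_val z - D j U (van_val u)).
  by rewrite /van_cond resB -smap_res uE tE subrr.
have [|V [h [r [Vx rE]]]] := ex2 x j jm U (van_mk v0) Ux.
  by apply: van_eq; rewrite -[LHS]/(D j.+1 U (van_val z - D j U (van_val u)))
    smapB dz DD subrr.
have {}rE : res h (van_val z - D j U (van_val u)) = D j V (van_val r) :=
  congr1 (@van_val _ O2 _ _) rE.
have w0 : van_cond O1 (van_val r + res h (van_val u)).
  have r0 : van_cond O2 (van_val r) := submod_valP r.
  have u0 : van_cond O1 (van_val u) := submod_valP u.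
  rewrite /van_cond resD (van_condP _ _ r0) ?add0r; last first.
    by apply: subset_trans O12; exact: opensIr.
  by rewrite res_res (van_condP _ _ u0) //; exact: opensIr.
exists V, h, (van_mk w0); split=> //; apply: van_eq.
rewrite -[RHS]/(D j V (van_val r + res h (van_val u))) smapD -rE smap_res resB.
by rewrite subrK.
Qed.

(** Flabbiness extends the cocycle as a cochain; its differential is supported off [O], hence is the
    differential of a cochain with that support, which is subtracted. The differential lies one
    degree higher, whence the bound [j.+1 < m]. *)
Lemma van_exact_extend (O : opens T) (m : nat) (W : opens T) :
  (forall x, oset W x -> van_exact O m x) ->
  forall j (s : K j.+1 (opensI W O)), (j.+1 < m)%N -> D j.+1 _ s = 0 ->
  exists t : K j.+1 W, D j.+1 W t = 0 /\ res opensIl t = s.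
Proof.
move=> ex j s jm ds; have [t tE] := Kflabby (@opensIl _ W O) s.
have dt0 : van_cond O (D j.+1 W t) by rewrite /van_cond -smap_res tE ds.
have [u [u0 uE]] := @van_exact_sec O m W ex j.+1 _ jm dt0 (DD _).
by exists (t - u); rewrite smapB uE subrr resB tE (u0 : res _ u = 0) subr0.
Qed.

End SupportedComplex.

(** * Local cohomology of boxes *)

Section SegmentInduction.
Variable R : realType.

(** The supremum of the [t] with [P l t] is attained by local validity, and would be exceeded were
    it below [u]. *)
Lemma segment_induction (P : R -> R -> Prop) (l u : R) : l <= u ->
  (forall t, l <= t <= u -> exists2 e, 0 < e &
    forall a b, t - e < a -> a <= b -> b < t + e -> P a b) ->
  (forall a b c, a <= b -> b <= c -> P a b -> P b c -> P a c) -> P l u.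
Proof.
move=> lu loc glue.
pose A := [set t | l <= t <= u /\ P l t].
have Al : A l.
  split; first by rewrite lexx.
  have [|e e0] := loc l; first by rewrite lexx.
  by apply; rewrite ?ltrBlDr ?ltrDl.
have uA : ubound A u by move=> t [/andP[]].
have hA : has_sup A by split; [exists l|exists u].
pose m := sup A.
have lm : l <= m by apply: ub_le_sup => //; exists u.
have mu : m <= u by apply: ge_sup => //; exists l.
have [|e e0 em] := loc m; first by rewrite lm mu.
have [t [/andP[lt tu] Pt] mt] := sup_adherent e0 hA.
have tm : t <= m by apply: ub_le_sup => //; [exists u|split=> //; rewrite lt].
have key v : m <= v -> v <= u -> v < m + e -> P l v.
  move=> mv vu ve; apply: (glue _ t) => //; first exact: le_trans mv.
  by apply: em => //; exact: le_trans mv.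
have [um|] := leP u (m + e / 2).
  by apply: key => //; apply: le_lt_trans um _; rewrite ltrD2l ltr_pdivrMr // ltr_pMr // ltr1n.
move=> meu; have : A (m + e / 2).
  split; first by rewrite (ltW meu) (le_trans lm) // lerDl divr_ge0 // ltW.
  apply: key; first by rewrite lerDl divr_ge0 // ltW.
    exact: ltW.
  by rewrite ltrD2l ltr_pdivrMr // ltr_pMr // ltr1n.
move=> /(ub_le_sup (ex_intro _ u uA)); rewrite leNgt ltrDl divr_gt0 //.
Qed.

End SegmentInduction.

(** * Cochains compared over open sets, and Mayer-Vietoris *)

Section Eqon.
Variables (T : topologicalType) (I : nat -> Type) (pi : forall p, I p -> T).

Local Notation E p := (I p -> rat).

(** A section of a product of skyscrapers is the restriction of a function on all indices, so
    cochains are global functions throughout and only their equality is localised. *)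
Definition eqon p (s t : E p) (U : set T) : Prop := forall i, U (pi i) -> s i = t i.

Lemma eqonS p (s t : E p) (U V : set T) : V `<=` U -> eqon s t U -> eqon s t V.
Proof. by move=> VU st i /VU /st. Qed.

Lemma eqon_refl p (s : E p) U : eqon s s U.
Proof. by []. Qed.

Lemma eqon_sym p (s t : E p) U : eqon s t U -> eqon t s U.
Proof. by move=> st i /st. Qed.

Lemma eqon_trans p (t s r : E p) U : eqon s t U -> eqon t r U -> eqon s r U.
Proof. by move=> st tr i Ui; rewrite st ?tr. Qed.

Lemma eqonU p (s t : E p) U V : eqon s t U -> eqon s t V -> eqon s t (U `|` V).
Proof. by move=> sU sV i [/sU|/sV]. Qed.

Lemma eqonB p (s t s' t' : E p) U : eqon s t U -> eqon s' t' U -> eqon (s - s') (t - t') U.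
Proof. by move=> st st' i Ui; rewrite -[LHS]/(s i - s' i) st // st'. Qed.

Lemma eqonD p (s t s' t' : E p) U : eqon s t U -> eqon s' t' U -> eqon (s + s') (t + t') U.
Proof. by move=> st st' i Ui; rewrite -[LHS]/(s i + s' i) st // st'. Qed.

Lemma eqon_sub0 p (s t : E p) U : eqon s t U -> eqon (s - t) 0 U.
Proof. by move=> st; rewrite -(subrr t); exact: eqonB. Qed.

Lemma eqon_glue p (J : Type) (U : J -> set T) (s : J -> E p) :
  (forall i j, eqon (s i) (s j) (U i `&` U j)) ->
  exists t, forall j, eqon t (s j) (U j).
Proof.
move=> ss; pose t (i : I p) : rat :=
  if pselect (exists j, U j (pi i)) is left h then s (sval (cid h)) i else 0.
exists t => j i Ui; rewrite /t; case: pselect => [h|[]]; last by exists j.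
by apply: ss; split=> //; exact: (svalP (cid h)).
Qed.

Lemma eqon_glue2 p (U V : set T) (s t : E p) : eqon s t (U `&` V) ->
  exists r, eqon r s U /\ eqon r t V.
Proof.
move=> st; have [|r rE] := @eqon_glue p bool (fun b => if b then U else V)
  (fun b => if b then s else t).
  move=> [] []; [exact: eqon_refl|exact: st| |exact: eqon_refl].
  by rewrite setIC; exact: eqon_sym.
by exists r; split; [exact: (rE true)|exact: (rE false)].
Qed.

(** Constants take the place of coboundaries in the lowest degree, so the cohomology measured is the
    reduced one. *)
Definition boundary (d : forall p, E p -> E p.+1) (c : rat -> E 1) p :
    E p.+1 -> Prop :=
  match p with
  | 0 => fun s => exists a, s = c a
  | q.+1 => fun s => exists t, s = d q.+1 t
  end.

End Eqon.

(* A flabby resolution of the constant sheaf, shifted by one: the sections over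
   [U] of its term of degree [p - 1] are the functions on the points of [I p]
   lying over [U]. *)
Record fcomplex (T : topologicalType) := FComplex {
  fI : nat -> Type;
  fpi : forall p, fI p -> T;
  fd : forall p, (fI p -> rat) -> fI p.+1 -> rat;
  fdB : forall p (s t : fI p -> rat), fd (s - t) = fd s - fd t;
  fd_loc : forall p (s t : fI p -> rat) U, open U -> eqon (@fpi) s t U ->
    eqon (@fpi) (fd s) (fd t) U;
  fdd : forall p (s : fI p -> rat), fd (fd s) = 0;
  fI0 : fI 0 -> False;
  fiota : rat -> fI 1 -> rat;
  fiotaB : forall a b, fiota (a - b) = fiota a - fiota b;
  fd_iota : forall c, fd (fiota c) = 0;
  fiota_inj : forall c U, open U -> U !=set0 -> eqon (@fpi) (fiota c) 0 U -> c = 0;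
  floc : forall x p (s : fI p.+1 -> rat) U, open U -> U x -> eqon (@fpi) (fd s) 0 U ->
    exists V, [/\ open V, V x &
      exists2 e, boundary (@fd) fiota e & eqon (@fpi) s e V] }.

Section FComplexTheory.
Variables (T : topologicalType) (C : fcomplex T).

Local Notation E p := (fI C p -> rat).
Local Notation d := (@fd T C _).
Local Notation eqon := (eqon (@fpi T C)).
Local Notation iota := (@fiota T C).
Local Notation exact_form := (@boundary _ (@fd T C) iota _).

Lemma fd0 p : d (0 : E p) = 0.
Proof. by rewrite -(subrr (0 : E p)) fdB subrr. Qed.

Lemma fdN p (s : E p) : d (- s) = - d s.
Proof. by rewrite -[- s]add0r fdB fd0 add0r. Qed.

Lemma fdD p (s t : E p) : d (s + t) = d s + d t.
Proof. by rewrite -[t in LHS]opprK fdB fdN opprK. Qed.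

Lemma fd_sum p (J : Type) (r : seq J) (P : pred J) (s : J -> E p) :
  d (\sum_(j <- r | P j) s j) = \sum_(j <- r | P j) d (s j).
Proof. by apply: (big_morph (@fd T C p)); [exact: fdD|exact: fd0]. Qed.

Lemma boundary_d p (e : E p.+1) : exact_form e -> d e = 0.
Proof. by case: p e => [|p] e [t ->]; [exact: fd_iota|exact: fdd]. Qed.

Definition trivial_on p (s : E p.+1) (U : set T) : Prop :=
  exists2 e, exact_form e & eqon s e U.

Lemma trivial_onS p (s : E p.+1) (U V : set T) :
  V `<=` U -> trivial_on s U -> trivial_on s V.
Proof. by move=> VU [e ee se]; exists e => //; exact: eqonS se. Qed.

(* The reduced cohomology of [W] vanishes below degree [m - 1]. *)
Definition conn (W : set T) (m : nat) : Prop :=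
  match m with
  | 0 => True
  | m'.+1 => W !=set0 /\ forall p, (p < m')%N -> forall s : E p.+1,
      eqon (d s) 0 W -> trivial_on s W
  end.

(** Mayer-Vietoris with loss of domain: the two primitives differ on the overlap by a cocycle of one
    degree less, which becomes trivial only on a smaller overlap. [Q] remembers the shape of the
    shrunk pair. *)
Lemma glue_trivial_shrink (Q : set T -> set T -> Prop) p (s : E p.+1) (W1 W2 : set T) :
  open W1 -> open W2 -> W1 `&` W2 !=set0 -> trivial_on s W1 -> trivial_on s W2 ->
  Q W1 W2 ->
  (forall q (t : E q.+1), (q < p)%N -> eqon (d t) 0 (W1 `&` W2) ->
     exists V1 V2, [/\ open V1, open V2, V1 `<=` W1 & V2 `<=` W2] /\
       Q V1 V2 /\ trivial_on t (V1 `&` V2)) ->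
  exists V1 V2, Q V1 V2 /\ trivial_on s (V1 `|` V2).
Proof.
move=> oW1 oW2 W12 [e1 ex1 s1] [e2 ex2 s2] QW H.
have e12 : eqon e1 e2 (W1 `&` W2).
  by move=> i [Wi1 Wi2]; rewrite -s1 // s2.
case: p s e1 e2 ex1 ex2 s1 s2 e12 H => [|p] s e1 e2 ex1 ex2 s1 s2 e12 H.
  exists W1, W2; split=> //.
  exists e1 => //; apply: eqonU => //; apply: eqon_trans s2 _.
  move: ex1 ex2 e12 => [c1 ->] [c2 ->] e12; suff -> : c1 = c2 by [].
  apply/eqP; rewrite -subr_eq0; apply/eqP; apply: (@fiota_inj T C _ (W1 `&` W2)) => //.
    exact: openI.
  by rewrite fiotaB; exact: eqon_sub0.
move: ex1 ex2 e12 s1 s2 => [t1 ->] [t2 ->] e12 s1 s2.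
have [|| V1 [V2 [[oV1 oV2 VW1 VW2] [QV [f ef tf]]]]] := H p (t1 - t2) => //.
  by rewrite fdB; exact: eqon_sub0.
exists V1, V2; split=> //.
have [|t [tE1 tE2]] := @eqon_glue2 _ _ (@fpi T C) _ V1 V2 (t1 - f) t2.
  move=> i Wi; have := tf i Wi.
  by rewrite -[(t1 - f) i]/(t1 i - f i) => <-; rewrite -[(t1 - t2) i]/(t1 i - t2 i) opprB addrC subrK.
exists (d t); first by exists t.
have df : d (t1 - f) = d t1 by rewrite fdB (boundary_d ef) subr0.
apply: eqonU.
  apply: eqon_trans (eqonS VW1 s1) _.
  by rewrite -df; apply: fd_loc => //; exact: eqon_sym.
apply: eqon_trans (eqonS VW2 s2) _.
by apply: fd_loc => //; exact: eqon_sym.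
Qed.

Lemma glue_trivial p (s : E p.+1) (W1 W2 : set T) : open W1 -> open W2 ->
  W1 `&` W2 !=set0 -> trivial_on s W1 -> trivial_on s W2 ->
  (forall q (t : E q.+1), (q < p)%N -> eqon (d t) 0 (W1 `&` W2) ->
     trivial_on t (W1 `&` W2)) ->
  trivial_on s (W1 `|` W2).
Proof.
move=> oW1 oW2 W12 s1 s2 H.
have [//||V1 [V2 [[-> ->]]]] := @glue_trivial_shrink
  (fun V1 V2 => V1 = W1 /\ V2 = W2) p s W1 W2 oW1 oW2 W12 s1 s2.
by move=> q t qp dt; exists W1, W2; split=> //; split=> //; exact: H.
by [].
Qed.

Lemma conn_glue (W1 W2 : set T) m : open W1 -> open W2 -> W1 `&` W2 !=set0 ->
  conn W1 m.+1 -> conn W2 m.+1 -> conn (W1 `&` W2) m -> conn (W1 `|` W2) m.+1.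
Proof.
move=> oW1 oW2 W12 [[x W1x] c1] [_ c2] c12; split; first by exists x; left.
move=> p pm s ds; apply: glue_trivial => //.
- by apply: c1 => //; apply: eqonS ds; exact: subsetUl.
- by apply: c2 => //; apply: eqonS ds; exact: subsetUr.
- move=> q t qp dt; case: m pm c12 {c1 c2} => // m pm [_ c12].
  by apply: c12 => //; exact: leq_trans qp pm.
Qed.

(* The long exact sequence of the pair [(O, O - A)]. *)
Lemma conn_support (O A : set T) n : open O -> open (O `\` A) ->
  (forall m, conn O m) -> conn (O `\` A) n ->
  forall p (s : E p.+1), (p < n)%N -> eqon (d s) 0 O -> eqon s 0 (O `\` A) ->
  exists2 t, eqon t 0 (O `\` A) & eqon (d t) s O.
Proof.
move=> oO oW cO cW p s pn ds s0.
have [_ /(_ p (ltnSn _) s ds) [e ee se]] := cO p.+2.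
case: n pn cW => // n pn [W0 cW].
case: p pn s ds s0 e ee se => [|p] pn s ds s0 e ee se.
  exists 0 => //; move: ee se => [c ->] sc.
  suff c0 : c = 0.
    rewrite fd0; apply: eqon_sym; apply: eqon_trans sc _.
    by rewrite c0 -(subrr 0) fiotaB subrr.
  apply: (@fiota_inj T C c (O `\` A)) => //.
  apply: eqon_trans s0; apply: eqon_sym; apply: eqonS sc; exact: subDsetl.
move: ee se => [t ->] st.
have [|f ff tf] := cW p pn t.
  apply: eqon_trans s0; apply: eqon_sym; apply: eqonS st; exact: subDsetl.
exists (t - f); first exact: eqon_sub0.
by rewrite fdB (boundary_d ff) subr0; exact: eqon_sym.
Qed.

End FComplexTheory.

Lemma fin_min_gt0 (R : realType) (J : finType) (f : J -> R) :
  (forall j, 0 < f j) -> exists2 e, 0 < e & forall j, e < f j.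
Proof.
move=> f0.
have A : \forall e \near (0:R)^'+, forall j, e < f j.
  by apply: filter_forall => j; exact: (nbhs_right_lt (f0 j)).
have B : \forall e \near (0:R)^'+, 0 < e by exact: nbhs_right_gt.
by have [e [e0 ef]] := filter_ex (filterI B A); exists e.
Qed.

Lemma small_seq (R : realType) (e e0 : R) : 0 < e -> 0 < e0 ->
  exists j : nat, e0 * j.+1%:R^-1 < e.
Proof.
move=> e_gt0 e0_gt0; have [j] : exists j, 0 + j.+1%:R^-1 < e / e0.
  by apply: ltr_add_invr; exact: divr_gt0.
by rewrite add0r ltr_pdivlMr // mulrC; exists j.
Qed.

(** * Acyclicity of open boxes *)

Section Boxes.
Variables (R : realType) (n : nat).
Local Notation T := 'rV[R]_n.

Definition obox (l u : 'I_n -> R) : set T := [set x | forall c, l c < x ord0 c < u c].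

Lemma rV_ball (x y : T) e : 0 < e -> (forall c, `|x ord0 c - y ord0 c| < e) -> ball x e y.
Proof. by move=> e0 xy; split=> // i j; rewrite ord1; exact: xy. Qed.

Lemma ball_rV (x y : T) e : ball x e y -> forall c, `|x ord0 c - y ord0 c| < e.
Proof. by move=> [_ xy] c; exact: xy. Qed.

Lemma obox_open l u : open (obox l u).
Proof.
rewrite openE => x xb.
have [c|e e0 ef] := @fin_min_gt0 R _ (fun c => Num.min (x ord0 c - l c) (u c - x ord0 c)).
  by rewrite lt_min !subr_gt0; exact: xb.
apply/nbhs_ballP; exists e => //= y /ball_rV xy c.
have := ef c; rewrite lt_min => /andP[]; have := xy c; rewrite ltr_norml => /andP[].
by move=> *; apply/andP; split; lra.
Qed.

Lemma open_obox (V : set T) x : open V -> V x -> exists2 e, 0 < e &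
  obox (fun c => x ord0 c - e) (fun c => x ord0 c + e) `<=` V.
Proof.
move=> oV Vx; have /nbhs_ballP[e /= e0 eV] : nbhs x V by exact: open_nbhs_nbhs.
exists e => // y yb; apply: eV; apply: rV_ball => // c.
by have /andP[? ?] := yb c; rewrite ltr_norml; apply/andP; split; lra.
Qed.

Lemma obox_sub (l u l' u' : 'I_n -> R) : (forall c, l' c <= l c) ->
  (forall c, u c <= u' c) -> obox l u `<=` obox l' u'.
Proof.
move=> ll uu x xb c; have /andP[a b] := xb c.
by rewrite (le_lt_trans (ll c)) // (lt_le_trans b).
Qed.

Definition upd (l : 'I_n -> R) c t : 'I_n -> R := fun c' => if c' == c then t else l c'.

Lemma upd_id l c : upd l c (l c) = l.
Proof. by apply: funext => c'; rewrite /upd; case: eqP => [->|]. Qed.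

Variable C : fcomplex T.
Local Notation E p := (fI C p -> rat).
Local Notation d := (@fd T C _).
Local Notation eqon := (eqon (@fpi T C)).

Definition thick (l u : 'I_n -> R) (e : R) : set T :=
  obox (fun c => l c - e) (fun c => u c + e).

(** Acyclicity of a compact box in terms of germs along it: the thickening may shrink. Degenerate
    sides are included, so that slices of a box are boxes too. *)
Definition good_box (l u : 'I_n -> R) : Prop :=
  forall p (s : E p.+1) e, 0 < e -> eqon (d s) 0 (thick l u e) ->
  exists2 e', 0 < e' & trivial_on s (thick l u e').

(** Induction on the number of nondegenerate sides. Slices across a side are good by induction, so
    thin slabs are trivialised, and [segment_induction] joins slabs along the side, each overlap
    being a thickened slice. *)
Lemma good_boxP (l u : 'I_n -> R) : (forall c, l c <= u c) -> good_box l u.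
Proof.
have [k] := ubnP #|[set c | l c < u c]%SET|.
elim: k l u => // k IH l u lk lu.
have [[c lc]|nlu] := pselect (exists c, l c < u c); last first.
  have lE : l = u.
    apply: funext => c; apply/eqP; rewrite eq_le lu leNgt.
    by apply/negP => luc; apply: nlu; exists c.
  subst u => p s e e0 ds; pose x : T := \row_c l c.
  have xin : thick l l e x.
    by move=> c; rewrite mxE; apply/andP; split; lra.
  have [V [oV Vx [f ef sf]]] := @floc T C x p s _ (@obox_open _ _) xin ds.
  have [e' e'0 eV] := open_obox oV Vx.
  exists e' => //; exists f => //; apply: eqonS sf.
  apply: subset_trans eV; apply: obox_sub => c; by rewrite mxE.
have good_slice t : l c <= t <= u c -> good_box (upd l c t) (upd u c t).
  move=> /andP[lt tu]; apply: IH; last first.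
    by move=> c'; rewrite /upd; case: eqP.
  rewrite ltnS in lk; apply: leq_trans lk; apply: proper_card.
  apply/properP; split.
    apply/fintype.subsetP => c'; rewrite !inE /upd; case: eqP => // _.
    by rewrite ltxx.
  by exists c; rewrite !inE // /upd eqxx ltxx.
move=> p s e e0 ds.
pose P a b := exists2 e', 0 < e' & trivial_on s (thick (upd l c a) (upd u c b) e').
suff : P (l c) (u c) by rewrite /P !upd_id.
have glueP a b b' : l c <= b <= u c -> a <= b -> b <= b' -> P a b -> P b b' -> P a b'.
  move=> lbu ab bb' [e1 e10 t1] [e2 e20 t2].
  pose e' := Num.min e (Num.min e1 e2).
  have e'0 : 0 < e' by rewrite !lt_min e0 e10 e20.
  have [ee e1e e2e] : [/\ e' <= e, e' <= e1 & e' <= e2].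
    by rewrite /e' !ge_min !lexx !orbT.
  clearbody e'.
  pose W1 e := thick (upd l c a) (upd u c b) e; pose W2 e := thick (upd l c b) (upd u c b') e.
  have WI r : W1 r `&` W2 r = thick (upd l c b) (upd u c b) r.
    apply/seteqP; split=> [x [x1 x2]|x xb].
      move=> c'; have := x1 c'; have := x2 c'; rewrite /upd.
      by case: eqP => // _ /andP[? ?] /andP[? ?]; apply/andP; split.
    by split; apply: obox_sub xb => c'; rewrite /upd;
      case: eqP => // _; rewrite ?lerB ?lerD2r // lerD2l lerN2.
  have WU r : 0 < r -> thick (upd l c a) (upd u c b') r `<=` W1 r `|` W2 r.
    move=> r0 x xb; have [xc|xc] := ltP (x ord0 c) (b + r).
      left=> c'; have := xb c'; rewrite /upd; case: eqP => // ->.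
      by move=> /andP[? ?]; apply/andP; split.
    right=> c'; have := xb c'; rewrite /upd; case: eqP => // ->.
    by move=> /andP[? ?]; apply/andP; split=> //; lra.
  pose Q (V1 V2 : set T) := exists2 r, 0 < r & V1 = W1 r /\ V2 = W2 r.
  have sl := good_slice b lbu.
  have [||||||q t qp dt|V1 [V2 [[r r0 [-> ->]] st]]] :=
      @glue_trivial_shrink T C Q p s (W1 e') (W2 e').
  - exact: obox_open.
  - exact: obox_open.
  - exists (\row_c' (upd l c b c')); rewrite WI => c'; rewrite mxE.
    have := lu c'; rewrite /upd; case: eqP => _ ?; apply/andP; split; lra.
  - apply: trivial_onS t1; apply: obox_sub => c' /=; lra.
  - apply: trivial_onS t2; apply: obox_sub => c' /=; lra.
  - by exists e'.
  - rewrite WI in dt; have [r r0 tr] := sl q t e' e'0 dt.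
    pose r' := Num.min r e'.
    have [r'0 r'r r'e] : [/\ 0 < r', r' <= r & r' <= e'].
      by split; rewrite /r' ?lt_min ?ge_min ?r0 ?e'0 ?lexx ?orbT.
    exists (W1 r'), (W2 r'); split.
      split; [exact: obox_open|exact: obox_open| |]; apply: obox_sub => c' /=; lra.
    split; first by exists r'.
    by rewrite WI; apply: trivial_onS tr; apply: obox_sub => c' /=; lra.
  by exists r => //; apply: trivial_onS st; exact: WU.
pose P' a b := l c <= a -> b <= u c -> P a b.
suff : P' (l c) (u c) by apply.
apply: (@segment_induction R P') => //.
- move=> t ltu; have [|r r0 tr] := good_slice t ltu p s e e0.
    apply: eqonS ds; move: ltu => /andP[lt tu]; apply: obox_sub => c'; rewrite /upd;
    by case: eqP => // ->; lra.
  exists (r / 2); first by rewrite divr_gt0.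
  move=> a b ta ab bt _ _; exists (r / 2); first by rewrite divr_gt0.
  apply: trivial_onS tr; apply: obox_sub => c'; rewrite /upd; case: eqP => _; lra.
- move=> a b b' ab bb' Pab Pbb' la bu.
  apply: (glueP a b b') => //.
  + by rewrite (le_trans la ab) (le_trans bb' bu).
  + by apply: Pab => //; exact: le_trans bb' bu.
  + by apply: Pbb' => //; exact: le_trans la ab.
Qed.

Lemma obox_nonempty (l u : 'I_n -> R) : (forall c, l c < u c) -> obox l u !=set0.
Proof.
move=> lu; exists (\row_c ((l c + u c) / 2)) => c; rewrite mxE.
have := lu c; move: (l c) (u c) => a b ab; apply/andP; split; lra.
Qed.

Lemma obox_shrink_trivial (l u : 'I_n -> R) r p (s : E p.+1) :
  0 < r -> (forall c, l c + r <= u c - r) -> eqon (d s) 0 (obox l u) ->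
  trivial_on s (obox (fun c => l c + r) (fun c => u c - r)).
Proof.
move=> r0 lur ds.
have [|r' r'0 tr] := good_boxP lur (s := s) r0.
  by apply: eqonS ds; apply: obox_sub => c /=; lra.
by apply: trivial_onS tr; apply: obox_sub => c /=; lra.
Qed.

(** The box is exhausted by the concentric boxes [O j]. Each primitive is corrected to agree with
    its predecessor on a smaller box, where their difference is exact; the sequence then stabilises
    on every [O j] and glues. *)
Lemma obox_trivial (l u : 'I_n -> R) p (s : E p.+1) : (forall c, l c < u c) ->
  eqon (d s) 0 (obox l u) -> trivial_on s (obox l u).
Proof.
move=> lu ds.
have [c|e0 e0_gt0 e0E] := @fin_min_gt0 R _ (fun c => (u c - l c) / 2).
  by rewrite divr_gt0 // subr_gt0.
pose e (j : nat) := e0 * j.+1%:R^-1.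
have e_gt0 j : 0 < e j by rewrite mulr_gt0 // invr_gt0 ltr0n.
have e_lt j : e j.+1 < e j.
  by rewrite ltr_pM2l // ltf_pV2 ?posrE ?ltr0n // ltr_nat.
have e_le i j : (i <= j)%N -> e j <= e i.
  by move=> ij; rewrite ler_pM2l // lef_pV2 ?posrE ?ltr0n // ler_nat.
have e_e0 j : e j <= e0.
  by have := e_le 0%N j isT; rewrite /e invr1 mulr1.
have elu j c : l c + e j < u c - e j.
  have := e0E c; have := e_e0 j; rewrite ltr_pdivlMr //; lra.
pose O j := obox (fun c => l c + e j) (fun c => u c - e j).
have OS i j : (i <= j)%N -> O i `<=` O j.
  by move=> ij; have := e_le _ _ ij => eij; apply: obox_sub => c /=; lra.
have Ol j : O j `<=` obox l u by have := e_gt0 j => ej; apply: obox_sub => c /=; lra.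
have Ocov : obox l u `<=` \bigcup_j O j.
  move=> x xb.
  have [c|r r_gt0 rE] := @fin_min_gt0 R _ (fun c => Num.min (x ord0 c - l c) (u c - x ord0 c)).
    by rewrite lt_min !subr_gt0; exact: xb.
  have [j je] := small_seq r_gt0 e0_gt0; exists j => // c.
  have := rE c; rewrite lt_min => /andP[? ?]; rewrite -/(e j) in je.
  by apply/andP; split; lra.
have strict j q (t : E q.+1) : eqon (d t) 0 (O j.+1) -> trivial_on t (O j).
  move=> dt; have ej := e_lt j.
  have [||f ef tf] := @obox_shrink_trivial _ _ (e j - e j.+1) _ t _ _ dt.
  - by rewrite subr_gt0.
  - by move=> c; have := elu j c; lra.
  by exists f => //; apply: eqonS tf; apply: obox_sub => c /=; lra.
have Ot j : trivial_on s (O j).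
  by apply: obox_shrink_trivial => // c; exact: ltW.
case: p s ds Ot => [|p] s ds Ot.
  have [_ [a ->] sa] := Ot 0%N; exists (@fiota _ C a); first by exists a.
  move=> i /Ocov[j _ Oi]; have [_ [b ->] sb] := Ot j.
  suff -> : a = b by exact: sb.
  apply/eqP; rewrite -subr_eq0; apply/eqP; apply: (@fiota_inj T C _ (O 0%N)).
  - exact: obox_open.
  - exact: obox_nonempty.
  - rewrite fiotaB; apply: eqon_sub0; apply: eqon_trans (eqonS (OS 0%N j isT) sb).
    exact: eqon_sym.
(* The primitive lives one box further than where agreement is demanded: the difference of two
   primitives on [O j.+1] is exact only on the strictly smaller [O j]. *)
pose S j := {t : E p.+1 | eqon s (d t) (O j.+1)}.
have t0 j : S j by have [f /cid[t ->] st] := cid2 (Ot j.+1); exists t.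
have next j (t : S j) : {t' : S j.+1 | eqon (sval t') (sval t) (O j)}.
  apply: cid; have [t1 st1] := t0 j.+1; case: t => t st /=.
  have [|f ef tf] := strict j p (t1 - t).
    rewrite fdB; apply: eqon_sub0; apply: eqon_trans (eqon_sym (eqonS _ st1)) st.
    exact: OS.
  have st' : eqon s (d (t1 - f)) (O j.+2) by rewrite fdB (boundary_d ef) subr0.
  exists (exist _ (t1 - f) st') => /= i Oi; have := tf i Oi.
  rewrite -[(t1 - f) i]/(t1 i - f i) -[(t1 - t) i]/(t1 i - t i) => <-.
  by rewrite opprB addrC subrK.
pose fix seq j : S j := if j is j'.+1 then sval (next j' (seq j')) else t0 0%N.
have seqS j : eqon (sval (seq j.+1)) (sval (seq j)) (O j) := svalP (next j (seq j)).
have seq_le i j : (i <= j)%N -> eqon (sval (seq j)) (sval (seq i)) (O i).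
  elim: j => [|j IH]; first by rewrite leqn0 => /eqP ->.
  rewrite leq_eqVlt => /predU1P[->//|]; rewrite ltnS => ij.
  by apply: eqon_trans (IH ij); apply: eqonS (seqS j); exact: OS.
have [i j|t tE] := @eqon_glue _ _ (@fpi T C) p.+1 nat O (fun j => sval (seq j)).
  have [ij|ji] := leqP i j.
    by apply: eqon_sym; apply: eqonS (seq_le _ _ ij); exact: subIsetl.
  by apply: eqonS (seq_le _ _ (ltnW ji)); exact: subIsetr.
exists (d t); first by exists t.
move=> i /Ocov[j _ Oi].
have st : eqon s (d (sval (seq j))) (O j) by apply: eqonS (svalP (seq j)); exact: OS.
rewrite (st i Oi); apply: (fd_loc (U := O j)) => //; first exact: obox_open.
exact: eqon_sym.
Qed.

Lemma obox_acyclic (l u : 'I_n -> R) : (forall c, l c < u c) -> forall m, conn C (obox l u) m.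
Proof.
move=> lu [//|m]; split; first exact: obox_nonempty.
by move=> p _ s; exact: obox_trivial.
Qed.

End Boxes.

(** * Complements of closed boxes *)

Section ClosedBoxes.
Variables (R : realType) (n : nat).
Local Notation T := 'rV[R]_n.
Variable C : fcomplex T.
Local Notation E p := (fI C p -> rat).
Local Notation d := (@fd T C _).
Local Notation eqon := (eqon (@fpi T C)).

Lemma acyclic_glue (W1 W2 : set T) : open W1 -> open W2 ->
  (forall m, conn C W1 m) -> (forall m, conn C W2 m) ->
  (forall m, conn C (W1 `&` W2) m) -> forall m, conn C (W1 `|` W2) m.
Proof.
move=> o1 o2 c1 c2 c12 [//|m]; apply: conn_glue => //.
by have [] := c12 1%N.
Qed.

Section Constraints.
Variables a b : 'I_n -> R.
Hypothesis ab : forall c, a c <= b c.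

(** A closed box with some faces forgotten: [L] and [H] list the coordinates whose lower and upper
    inequality is kept, so that faces can be removed one at a time. *)
Definition constraints (L H : {set 'I_n}) : set T :=
  [set x | (forall c, c \in L -> a c <= x ord0 c) /\
           (forall c, c \in H -> x ord0 c <= b c)].

Lemma obox_cutl (l u : 'I_n -> R) c t :
  obox l (upd u c (Num.min (u c) t)) = obox l u `&` [set x | x ord0 c < t].
Proof.
apply/seteqP; split=> [x xb|x [xb xt] c'].
  split=> [c'|]; last by have := xb c; rewrite /upd eqxx lt_min => /and3P[].
  have := xb c'; rewrite /upd; case: eqP => // -> /andP[->].
  by rewrite lt_min => /andP[].
by have := xb c'; rewrite /upd; case: eqP => // -> /andP[lx xu]; rewrite lt_min lx xu xt.
Qed.

Lemma obox_cutr (l u : 'I_n -> R) c t :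
  obox (upd l c (Num.max (l c) t)) u = obox l u `&` [set x | t < x ord0 c].
Proof.
apply/seteqP; split=> [x xb|x [xb xt] c'].
  split=> [c'|]; last by have := xb c; rewrite /upd eqxx gt_max => /andP[/andP[]].
  have := xb c'; rewrite /upd; case: eqP => // -> /andP[+ ->].
  by rewrite gt_max => /andP[->].
have := xb c'; rewrite /upd; case: eqP => // -> /andP[lx ->].
by rewrite gt_max lx xt.
Qed.

Lemma obox_constraints_open (l u : 'I_n -> R) L H : open (obox l u `\` constraints L H).
Proof.
have -> : obox l u `\` constraints L H =
  (\bigcup_(c in [set c | c \in L]) obox l (upd u c (Num.min (u c) (a c)))) `|`
  (\bigcup_(c in [set c | c \in H]) obox (upd l c (Num.max (l c) (b c))) u).
  apply/seteqP; split=> [x [xb xn]|x].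
    have [[c cL xc]|nL] := pselect (exists2 c, c \in L & x ord0 c < a c).
      by left; exists c => //; rewrite obox_cutl.
    have [[c cL xc]|nH] := pselect (exists2 c, c \in H & b c < x ord0 c).
      by right; exists c => //; rewrite obox_cutr.
    case: xn; split=> c cL; rewrite leNgt; apply/negP => xc.
      by apply: nL; exists c.
    by apply: nH; exists c.
  move=> [[c /= cL]|[c /= cH]].
    rewrite obox_cutl => -[xb /= xc]; split=> // -[/(_ c cL)].
    by rewrite leNgt xc.
  rewrite obox_cutr => -[xb /= xc]; split=> // -[_ /(_ c cH)].
  by rewrite leNgt xc.
by apply: openU; apply: bigcup_open => c _; exact: obox_open.
Qed.

(** As [a c <= b c], a point satisfies at least one of the two inequalities on the coordinate [c];
    hence the two sets with one of them dropped have as union the set with both dropped. *)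
Lemma constraints_split c (O : set T) (L H : {set 'I_n}) : c \in L -> c \in H ->
  O `\` constraints L H =
    (O `\` constraints (L :\ c) H) `|` (O `\` constraints L (H :\ c)) /\
  (O `\` constraints (L :\ c) H) `&` (O `\` constraints L (H :\ c)) =
    O `\` constraints (L :\ c) (H :\ c).
Proof.
move=> cL cH; split; apply/seteqP; split.
- move=> x [Ox xn]; have [h|h] := pselect (constraints (L :\ c) H x); last by left.
  right; split=> // -[h1 _]; apply: xn; split=> //; exact: h.2.
- move=> x [[Ox xn]|[Ox xn]]; split=> // -[h1 h2]; apply: xn; split=> // c'.
    by rewrite !inE => /andP[_ /h1].
  by rewrite !inE => /andP[_ /h2].
- move=> x [[Ox n1] [_ n2]]; split=> // -[h1 h2].
  have [xa|xa] := leP (a c) (x ord0 c).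
    apply: n2; split=> // c' c'L; have [->//|cc] := eqVneq c' c.
    by apply: h1; rewrite !inE cc.
  apply: n1; split=> // c' c'H; have [->|cc] := eqVneq c' c.
    by rewrite (le_trans (ltW xa)).
  by apply: h2; rewrite !inE cc.
- move=> x [Ox xn]; split; split=> // -[h1 h2]; apply: xn; split=> // c'.
    by rewrite !inE => /andP[_ /h2].
  by rewrite !inE => /andP[_ /h1].
Qed.

(** [L != H] means that some coordinate is bounded on one side only; the removed set runs off in the
    other direction and its complement has no reduced cohomology. Mayer-Vietoris confirms this by
    removing one inequality at a time. *)
Lemma acyclic_mixed_constraints (L H : {set 'I_n}) (l u : 'I_n -> R) : L != H ->
  (forall c, l c < u c) -> (forall c, c \in L -> l c < a c) ->
  (forall c, c \in H -> b c < u c) ->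
  forall m, conn C (obox l u `\` constraints L H) m.
Proof.
have [k] := ubnP (#|L| + #|H|)%N.
elim: k L H l u => // k IH L H l u; rewrite ltnS => LHk LH lu la bu.
have card1 c (S : {set 'I_n}) : c \in S -> #|S| = (#|S :\ c|).+1.
  by move=> cS; rewrite (cardsD1 c) cS.
have subD c (S : {set 'I_n}) (P : 'I_n -> Prop) : (forall c', c' \in S -> P c') ->
    forall c', c' \in S :\ c -> P c'.
  by move=> h c'; rewrite !inE => /andP[_]; exact: h.
have [[c [cL cH]]|disj] := pselect (exists c, c \in L /\ c \in H).
  have [-> WI] := constraints_split (obox l u) cL cH.
  have kL := card1 c L cL; have kH := card1 c H cH.
  apply: acyclic_glue.
  - exact: obox_constraints_open.
  - exact: obox_constraints_open.
  - apply: IH => //; [lia| |exact: subD].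
    by apply: contraTneq cH => <-; rewrite !inE eqxx.
  - apply: IH => //; [lia| |exact: subD].
    by apply: contraTneq cL => ->; rewrite !inE eqxx.
  - rewrite WI; apply: IH => //; [lia| |exact: subD|exact: subD].
    apply: contra LH => /eqP e; apply/eqP/setP => c'.
    have [->|cc] := eqVneq c' c; first by rewrite cL cH.
    by have /setP/(_ c') := e; rewrite !inE cc.
have [[c cL]|L0] := pselect (exists c, c \in L).
  have kL := card1 c L cL.
  have cH : c \notin H by apply/negP => cH; apply: disj; exists c.
  pose O' := obox l (upd u c (Num.min (u c) (a c))).
  have lu' c' : l c' < upd u c (Num.min (u c) (a c)) c'.
    by rewrite /upd; case: eqP => // ->; rewrite lt_min lu la.
  have WE : obox l u `\` constraints L H = (obox l u `\` constraints (L :\ c) H) `|` O'.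
    rewrite /O' obox_cutl; apply/seteqP; split=> [x [xb xn]|x [[xb xn]|[xb xc]]].
    - have [xa|xa] := ltP (x ord0 c) (a c); first by right.
      left; split=> // -[h1 h2]; apply: xn; split=> // c' c'L.
      have [->//|cc] := eqVneq c' c; apply: h1; by rewrite !inE cc.
    - by split=> // -[h1 h2]; apply: xn; split=> //; exact: subD h1.
    - by split=> // -[/(_ c cL)]; rewrite leNgt xc.
  (* As [L] and [H] are disjoint here, equality forces both [L :\ c] and [H] to be empty: no
     inequality is left, and only the slab [O'] remains. *)
  have [e|ne] := eqVneq (L :\ c) H.
    have H0 : H = finset.set0.
      apply/setP => c'; rewrite inE; apply/negP => c'H; apply: disj; exists c'; split=> //.
      by move: c'H; rewrite -e !inE => /andP[].
    rewrite WE (_ : obox l u `\` _ = set0) ?set0U; first exact: obox_acyclic.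
    apply/seteqP; split=> // x [_ xn]; apply: xn; rewrite e H0.
    by split=> c'; rewrite inE.
  rewrite WE; apply: acyclic_glue.
  - exact: obox_constraints_open.
  - exact: obox_open.
  - by apply: IH => //; [lia|exact: subD].
  - exact: obox_acyclic.
  - rewrite (_ : _ `&` _ = O' `\` constraints (L :\ c) H).
      apply: IH => //; [lia|exact: subD|].
      move=> c' c'H; rewrite /upd; case: eqP => [e|_]; last exact: bu.
      by rewrite -e c'H in cH.
    apply/seteqP; split=> [x [[xb xn] xO]|x [xO xn]] //.
    by split=> //; move: xO; rewrite /O' obox_cutl => -[].
have [[c cH]|H0] := pselect (exists c, c \in H); last first.
  case/eqP: LH; apply/setP => c; apply/idP/idP => h; exfalso.
    by apply: L0; exists c.
  by apply: H0; exists c.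
have kH := card1 c H cH.
have cL : c \notin L by apply/negP => cL; apply: L0; exists c.
pose O' := obox (upd l c (Num.max (l c) (b c))) u.
have lu' c' : upd l c (Num.max (l c) (b c)) c' < u c'.
  by rewrite /upd; case: eqP => // ->; rewrite gt_max lu bu.
have WE : obox l u `\` constraints L H = (obox l u `\` constraints L (H :\ c)) `|` O'.
  rewrite /O' obox_cutr; apply/seteqP; split=> [x [xb xn]|x [[xb xn]|[xb xc]]].
  - have [xa|xa] := ltP (b c) (x ord0 c); first by right.
    left; split=> // -[h1 h2]; apply: xn; split=> // c' c'L.
    have [->//|cc] := eqVneq c' c; apply: h2; by rewrite !inE cc.
  - by split=> // -[h1 h2]; apply: xn; split=> //; exact: subD h2.
  - by split=> // -[_ /(_ c cH)]; rewrite leNgt xc.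
have LE : L = finset.set0.
  by apply/setP => c'; rewrite inE; apply/negP => c'L; apply: L0; exists c'.
have [e|ne] := eqVneq L (H :\ c).
  rewrite WE (_ : obox l u `\` _ = set0) ?set0U; first exact: obox_acyclic.
  apply/seteqP; split=> // x [_ xn]; apply: xn; rewrite -e LE.
  by split=> c'; rewrite inE.
rewrite WE; apply: acyclic_glue.
- exact: obox_constraints_open.
- exact: obox_open.
- by apply: IH => //; [lia|exact: subD].
- exact: obox_acyclic.
- rewrite (_ : _ `&` _ = O' `\` constraints L (H :\ c)).
    apply: IH => //; [lia| |exact: subD].
    by move=> c'; rewrite LE inE.
  apply/seteqP; split=> [x [[xb xn] xO]|x [xO xn]] //.
  by split=> //; move: xO; rewrite /O' obox_cutr => -[].
Qed.

(** The complement behaves like a sphere of dimension [#|P| - 1], seen as an iterated suspension: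
    dropping either inequality on [c] gives an acyclic set, and the two acyclic sets meet in the
    case of [P :\ c]. *)
Lemma conn_constraints (P : {set 'I_n}) (l u : 'I_n -> R) :
  (forall c, l c < u c) -> (forall c, c \in P -> l c < a c) ->
  (forall c, c \in P -> b c < u c) ->
  conn C (obox l u `\` constraints P P) #|P|.
Proof.
move=> lu; have [k] := ubnP #|P|; elim: k P => // k IH P; rewrite ltnS => Pk la bu.
have [P0|[c cP]] := set_0Vmem P; first by rewrite P0 cards0.
have kP : #|P| = (#|P :\ c|).+1 by rewrite (cardsD1 c) cP.
have subD (Q : 'I_n -> Prop) : (forall c', c' \in P -> Q c') ->
    forall c', c' \in P :\ c -> Q c'.
  by move=> h c'; rewrite !inE => /andP[_]; exact: h.
have [WE WI] := constraints_split (obox l u) cP cP.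
have PD : P :\ c != P by apply: contraTneq cP => <-; rewrite !inE eqxx.
have c1 := acyclic_mixed_constraints PD lu (subD _ la) bu.
have c2 : forall m, conn C (obox l u `\` constraints P (P :\ c)) m.
  by apply: acyclic_mixed_constraints => //; [rewrite eq_sym|exact: subD].
have c12 : conn C (obox l u `\` constraints (P :\ c) (P :\ c)) #|P :\ c|.
  by apply: IH; [lia|exact: subD|exact: subD].
rewrite kP WE; case: (#|P :\ c|) c12 => [|m] c12.
  split=> //; have [[x W1x] _] := c1 1%N.
  by exists x; left.
apply: conn_glue.
- exact: obox_constraints_open.
- exact: obox_constraints_open.
- by rewrite WI; have [] := c12.
- exact: c1.
- exact: c2.
- by rewrite WI.
Qed.

End Constraints.

Definition cbox (a b : 'I_n -> R) : set T := [set x | forall c, a c <= x ord0 c <= b c].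

(* The hypothesis on the sides keeps the closed box from meeting two opposite faces
   of the open one. *)
Lemma cbox_support (l u a b : 'I_n -> R) : (forall c, l c < u c) ->
  (forall c, b c - a c < u c - l c) ->
  forall p (s : E p.+1), (p < n)%N -> eqon (d s) 0 (obox l u) ->
    eqon s 0 (obox l u `\` cbox a b) ->
  exists2 t, eqon t 0 (obox l u `\` cbox a b) & eqon (d t) s (obox l u).
Proof.
move=> lu w p s pn ds s0.
have [ab|nab] := pselect (forall c, a c <= b c); last first.
  exists 0; first exact: eqon_refl.
  rewrite fd0; apply: eqon_sym; apply: eqonS s0 => x xO; split=> // xb.
  by apply: nab => c; have /andP[] := xb c; exact: le_trans.
(* Inequalities that hold throughout the open box are discarded; [L] and [H] retain those that cut
   it. *)
pose L := [set c | l c < a c]%SET; pose H := [set c | b c < u c]%SET.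
have cE : obox l u `\` cbox a b = obox l u `\` constraints a b L H.
  apply/seteqP; split=> x [xO xn]; split=> // h; apply: xn.
    case: h => hL hH c; have /andP[lx xu] := xO c; apply/andP; split.
      have [lc|lc] := ltP (l c) (a c); first by apply: hL; rewrite inE.
      exact: le_trans lc (ltW lx).
    have [uc|uc] := ltP (b c) (u c); first by apply: hH; rewrite inE.
    exact: le_trans (ltW xu) uc.
  by split=> c _; have /andP[] := h c.
have la c : c \in L -> l c < a c by rewrite inE.
have bu c : c \in H -> b c < u c by rewrite inE.
have cn : conn C (obox l u `\` constraints a b L H) n.
  have [LH|LH] := eqVneq L H; last exact: acyclic_mixed_constraints.
  (* A coordinate outside [L = H] would have [a c <= l c] and [u c <= b c], against the bound on the
     sides. *)
  have LT : L = finset.setT.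
    apply/setP => c; rewrite !inE; apply/idP; rewrite ltNge; apply/negP => al.
    have : c \notin L by rewrite inE -leNgt.
    rewrite LH inE -leNgt => ub; have := w c; lra.
  have buL c : c \in L -> b c < u c by rewrite LH; exact: bu.
  have := @conn_constraints a b ab L l u lu la buL.
  by rewrite -LH LT cardsT card_ord.
rewrite cE in s0 *; apply: (@conn_support _ C _ _ n) => //.
- exact: obox_open.
- exact: obox_constraints_open.
- exact: obox_acyclic.
Qed.

Definition small_box (r : R) (B : set T) : Prop :=
  exists a b, B = cbox a b /\ forall c, b c - a c <= r.

Lemma small_boxI r B B' : small_box r B -> small_box r B' -> small_box r (B `&` B').
Proof.
move=> [a [b [-> ab]]] [a' [b' [-> ab']]].
exists (fun c => Num.max (a c) (a' c)), (fun c => Num.min (b c) (b' c)); split.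
  apply/seteqP; split=> [x [xb xb'] c|x xb].
    have /andP[? ?] := xb c; have /andP[? ?] := xb' c.
    by rewrite ge_max le_min; apply/andP; split; apply/andP.
  by split=> c; have := xb c; rewrite ge_max le_min => /andP[/andP[? ?] /andP[? ?]];
    apply/andP.
move=> c; apply: le_trans (ab c).
by rewrite lerB // ?ge_min ?le_max lexx.
Qed.

End ClosedBoxes.

(** * Supports admitting finite-to-one maps *)

Section SimplexChains.
Variable J : finType.
Implicit Types (S : {set J}) (s : {set J} -> rat).

Definition bd_sign (j : J) S : bool :=
  odd #|[set i in S | (enum_rank i < enum_rank j)%N]|.

(** [s] is read as the chain on the full simplex with vertices [J] whose coefficient at the face [S]
    is [s S], the empty face giving the augmentation; [bd s S] is the coefficient of its boundary at
    [S]. *)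
Definition bd s S : rat := \sum_(j | j \notin S) (-1) ^+ bd_sign j S * s (j |: S).

Lemma bd_sign_add i j S : i \notin S ->
  bd_sign j (i |: S) = bd_sign j S (+) (enum_rank i < enum_rank j)%N.
Proof.
move=> iS; rewrite /bd_sign; have [ij|/negbTE ij] := boolP (enum_rank i < enum_rank j)%N.
  rewrite (_ : [set k in i |: S | (enum_rank k < enum_rank j)%N] =
    i |: [set k in S | (enum_rank k < enum_rank j)%N]).
    by rewrite cardsU1 !inE (negbTE iS) /= addbT.
  by apply/setP => k; rewrite !inE; case: eqP => // ->; rewrite ij.
rewrite addbF; congr odd; apply: eq_card => k; rewrite !inE.
by case: eqP => //= ->; rewrite ij (negbTE iS).
Qed.

Lemma bd_sign_self j S : j \notin S -> bd_sign j (j |: S) = bd_sign j S.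
Proof. by move=> jS; rewrite (bd_sign_add j jS) ltnn addbF. Qed.

Lemma bd_bd s S : bd (bd s) S = 0.
Proof.
pose F j i : rat := (-1) ^+ bd_sign j S * ((-1) ^+ bd_sign i (j |: S) * s (i |: (j |: S))).
have E : bd (bd s) S = \sum_(j | j \notin S) \sum_(i | (i \notin S) && (i != j)) F j i.
  apply: eq_bigr => j jS; rewrite mulr_sumr; apply: eq_bigl => i.
  by rewrite !inE negb_or andbC.
have anti i j : i \notin S -> j \notin S -> i != j -> F j i = - F i j.
  move=> iS jS ij; rewrite /F (bd_sign_add i jS) (bd_sign_add j iS) !signr_addb finset.setUCA.
  have [ltij|ltji|eij] := ltngtP (enum_rank i) (enum_rank j) => /=.
  - by rewrite expr1 expr0; ring.
  - by rewrite expr1 expr0; ring.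
  - by move/val_inj/enum_rank_inj: eij ij => ->; rewrite eqxx.
have : bd (bd s) S = - bd (bd s) S.
  rewrite {1}E (exchange_big_dep (fun i => i \notin S)) /=; last by move=> j i _ /andP[].
  rewrite E -sumrN; apply: eq_bigr => i iS; rewrite -sumrN.
  apply: eq_big => [j|j /andP[jS /andP[_ ij]]]; first by rewrite iS /= eq_sym.
  exact: anti.
by move/eqP; rewrite -addr_eq0 -mulr2n mulrn_eq0 => /eqP.
Qed.

(* The contraction of the simplex chains by coning with the vertex [j]. *)
Definition cone_off (j : J) s S : rat :=
  if j \in S then (-1) ^+ bd_sign j S * s (S :\ j) else 0.

Lemma bd_cone_off j s : (forall S, bd s S = 0) -> forall S, bd (cone_off j s) S = s S.
Proof.
move=> s0 S; have sgn2 (b : bool) (x : rat) : (-1) ^+ b * ((-1) ^+ b * x) = x.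
  by case: b; rewrite ?expr1 ?expr0; ring.
have [jS|jS] := boolP (j \in S); last first.
  rewrite /bd (bigD1 j) //= big1 ?addr0 => [|i /andP[iS ij]].
    by rewrite /cone_off !inE eqxx bd_sign_self //= sgn2 finset.setU1K.
  by rewrite /cone_off !inE (negbTE jS) eq_sym (negbTE ij) mulr0.
have := s0 (S :\ j); rewrite /bd (bigD1 j) ?inE ?eqxx //= finset.setD1K //.
have jSj : j \notin S :\ j by rewrite !inE eqxx.
have sj : bd_sign j S = bd_sign j (S :\ j) by rewrite -{1}(finset.setD1K jS) bd_sign_self.
move=> e; rewrite -[RHS](sgn2 (bd_sign j S)) sj.
have -> : (-1) ^+ bd_sign j (S :\ j) * s S =
  - \sum_(i | (i \notin S :\ j) && (i != j)) (-1) ^+ bd_sign i (S :\ j) * s (i |: S :\ j).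
  by apply/eqP; rewrite -addr_eq0; apply/eqP.
rewrite mulrN mulr_sumr -sumrN; apply: eq_big => [i|i iS].
  by rewrite !inE; case: eqP => [->|_]; rewrite ?jS ?andbF ?andbT.
have ij : i != j by apply: contra iS => /eqP ->.
have iSj : i \notin S :\ j by rewrite !inE (negbTE iS) andbF.
rewrite /cone_off !inE jS orbT.
have -> : (i |: S) :\ j = i |: (S :\ j).
  by apply/setP => k; rewrite !inE; case: eqP => [->|] //=; rewrite eq_sym (negbTE ij).
have sji : bd_sign i S = bd_sign i (S :\ j) (+) (enum_rank j < enum_rank i)%N.
  by rewrite -{1}(finset.setD1K jS) bd_sign_add.
rewrite (bd_sign_add _ iS) sji sj !signr_addb.
have [ltij|ltji|eij] := ltngtP (enum_rank i) (enum_rank j) => /=.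
- by rewrite expr1 expr0; ring.
- by rewrite expr1 expr0; ring.
- by move/val_inj/enum_rank_inj: eij ij => ->; rewrite eqxx.
Qed.

End SimplexChains.

(** * The double complex of a finite closed cover *)

Section Nerve.
Variables (T : topologicalType) (C : fcomplex T).
Local Notation E p := (fI C p -> rat).
Local Notation d := (@fd T C _).
Local Notation eqon := (eqon (@fpi T C)).
Variables (J : finType) (O : set T) (A B : J -> set T) (Bt : set T) (k N : nat).
Hypothesis oO : open O.

Definition nerve_in (S : {set J}) : set T :=
  [set x | (exists j, A j x) /\ forall j, j \in S -> A j x].
Definition nerve_out (S : {set J}) : set T :=
  [set x | Bt x /\ forall j, j \in S -> B j x].

Hypothesis AB : forall j, A j `<=` B j.
Hypothesis BBt : forall j, B j `<=` Bt.
Hypothesis oA : forall S, open (O `\` nerve_in S).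
Hypothesis order : forall S : {set J}, (k < #|S|)%N -> O `&` nerve_in S = set0.
Hypothesis vanish : forall S, S != finset.set0 -> forall p (s : E p.+1), (p < N)%N ->
  eqon (d s) 0 O -> eqon s 0 (O `\` nerve_out S) ->
  exists2 t, eqon t 0 (O `\` nerve_out S) & eqon (d t) s O.

Definition fam_bd p (s : {set J} -> E p) (S : {set J}) : E p :=
  \sum_(j | j \notin S) (if bd_sign j S then - s (j |: S) else s (j |: S)).

Lemma fam_bdE p (s : {set J} -> E p) S i : fam_bd s S i = bd (fun S => s S i) S.
Proof.
rewrite /fam_bd fct_sumE; apply: eq_bigr => j _.
by case: bd_sign; rewrite ?expr1 ?expr0 ?mulN1r ?mul1r.
Qed.

Lemma fam_bd_d p (s : {set J} -> E p) S : d (fam_bd s S) = fam_bd (fun S => d (s S)) S.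
Proof.
rewrite /fam_bd fd_sum; apply: eq_bigr => j _.
by case: bd_sign; rewrite ?fdN.
Qed.

Definition first_piece (x : T) : option J := [pick j | `[< A j x >]].

Lemma first_pieceP x : match first_piece x with
  | Some j => A j x | None => forall j, ~ A j x end.
Proof.
rewrite /first_piece; case: pickP => [j /asboolP //|h j Aj].
by have := h j; rewrite asboolT.
Qed.

(** The cone vertex is chosen point by point as the first piece containing the point, which is
    possible because cochains are arbitrary functions of the index; this choice keeps the support
    inside the pieces. *)
Definition fam_cone p (s : {set J} -> E p) (S : {set J}) : E p :=
  fun i => if first_piece (fpi i) is Some j then cone_off j (fun S => s S i) S else 0.

Lemma fam_cone_in p (s : {set J} -> E p) :
  (forall S, eqon (s S) 0 (O `\` nerve_in S)) ->
  forall S, eqon (fam_cone s S) 0 (O `\` nerve_in S).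
Proof.
move=> sA S i [Oi nA]; rewrite /fam_cone; have := first_pieceP (fpi i).
case: first_piece => // j Aj; rewrite /cone_off; case: ifP => // jS.
rewrite (sA (S :\ j)) ?mulr0 //; split=> // -[_ h]; apply: nA; split; first by exists j.
move=> j' j'S; have [->//|jj] := eqVneq j' j.
by apply: h; rewrite !inE jj.
Qed.

Lemma fam_cone_level p (s : {set J} -> E p) q :
  (forall S : {set J}, #|S| != q -> eqon (s S) 0 O) ->
  forall S : {set J}, #|S| != q.+1 -> eqon (fam_cone s S) 0 O.
Proof.
move=> sq S Sq i Oi; rewrite /fam_cone; case: first_piece => // j.
rewrite /cone_off; case: ifP => // jS; rewrite (sq (S :\ j)) ?mulr0 //.
by apply: contra Sq => /eqP e; rewrite (cardsD1 j) jS e.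
Qed.

Lemma fam_bd_cone p (s : {set J} -> E p) :
  (forall S, eqon (s S) 0 (O `\` nerve_in S)) ->
  (forall S, eqon (fam_bd s S) 0 O) ->
  forall S, eqon (fam_bd (fam_cone s) S) (s S) O.
Proof.
move=> sA bs S i Oi; rewrite fam_bdE /fam_cone; have := first_pieceP (fpi i).
case: first_piece => [j Aj|nA].
  by apply: bd_cone_off => S'; rewrite -fam_bdE; exact: bs.
rewrite (sA S) /bd ?big1 // => [j _|]; first exact: mulr0.
by split=> // -[[j /nA]].
Qed.

(** A staircase in the double complex of [d] and [fam_bd], descending from the order [k] of the
    cover. With [c] the cone of [s], [d c] is a family of the next level, so [d c = d t] with
    [fam_bd t = 0] and [t] supported in the larger sets; [c - t] is closed and has a primitive [r]
    by [vanish], and [fam_bd r] is a primitive of [s]. *)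
Lemma nerve_vanish m q p (s : {set J} -> E p.+1) : (q + m = k)%N -> (p + m <= N)%N ->
  (forall S, eqon (s S) 0 (O `\` nerve_in S)) ->
  (forall S : {set J}, #|S| != q -> eqon (s S) 0 O) ->
  (forall S, eqon (d (s S)) 0 O) -> (forall S, eqon (fam_bd s S) 0 O) ->
  exists t : {set J} -> E p,
    [/\ forall S, eqon (t S) 0 (O `\` nerve_out S),
        forall S : {set J}, #|S| != q -> eqon (t S) 0 O,
        forall S, eqon (d (t S)) (s S) O & forall S, eqon (fam_bd t S) 0 O].
Proof.
elim: m q p s => [|m IH] q p s qm pm sA sq ds bs;
  have cA := fam_cone_in sA; have cq := fam_cone_level sq; have bc := fam_bd_cone sA bs.
(* The cone of a family of level [k] lives on intersections of [k + 1] pieces, which are empty; so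
   [s] itself vanishes. *)
- exists (fun=> 0); split=> S; rewrite ?fd0.
  + exact: eqon_refl.
  + by move=> _; exact: eqon_refl.
  + have c0 S' : eqon (fam_cone s S') 0 O.
      have [e|/cq//] := eqVneq #|S'| q.+1.
      move=> i Oi; apply: (cA S') => //; split=> // nA.
      have : (O `&` nerve_in S') (fpi i) by [].
      by rewrite order // e -qm addn0.
    apply: eqon_sym; apply: eqon_trans (eqon_sym (bc S)) _ => i Oi.
    rewrite fam_bdE /bd big1 // => j _; rewrite c0 //; exact: mulr0.
  + by move=> i _; rewrite fam_bdE /bd big1 // => j _; exact: mulr0.
have [||||||t [tB tq dt bt]] := IH q.+1 p.+1 (fun S => d (fam_cone s S)).
- by rewrite -qm addnS.
- by move: pm; rewrite addnS addSn.
- by move=> S; rewrite -(fd0 C p.+1); apply: fd_loc => //; exact: cA.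
- by move=> S Sq; rewrite -(fd0 C p.+1); apply: fd_loc => //; exact: cq.
- by move=> S; rewrite fdd; exact: eqon_refl.
- move=> S; rewrite -fam_bd_d; apply: eqon_trans (ds S); apply: fd_loc => //.
have pN : (p < N)%N by apply: leq_trans pm; rewrite addnS ltnS leq_addr.
have ex S : exists r : E p, [/\ eqon r 0 (O `\` nerve_out S),
    #|S| != q.+1 -> eqon r 0 O & eqon (d r) (fam_cone s S - t S) O].
  have [e|Sq] := eqVneq #|S| q.+1; last first.
    exists 0; split=> //; rewrite fd0; apply: eqon_sym; rewrite -(subrr (0 : E p.+1)).
    by apply: eqonB; [exact: cq|exact: tq].
  have S0 : S != finset.set0 by apply/eqP => S0; move: e; rewrite S0 cards0.
  have [||r r0 dr] := vanish S0 (s := fam_cone s S - t S) pN.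
  - rewrite fdB; apply: eqon_sub0; apply: eqon_sym; exact: dt.
  - rewrite -(subrr (0 : E p.+1)); apply: eqonB (tB S).
    apply: eqonS (cA S) => x [Ox nB]; split=> // -[[j Aj] h]; apply: nB; split.
      exact: (BBt (AB Aj)).
    by move=> j' /h; exact: AB.
  by exists r.
have [r rP] := choice ex.
exists (fam_bd r); split=> S.
- move=> i [Oi nB]; rewrite fam_bdE /bd big1 // => j _.
  have [rB _ _] := rP (j |: S); rewrite rB ?mulr0 //; split=> // -[Bx h].
  by apply: nB; split=> // j' j'S; apply: h; rewrite !inE j'S orbT.
- move=> Sq i Oi; rewrite fam_bdE /bd big1 // => j jS.
  have [_ rq _] := rP (j |: S); rewrite rq ?mulr0 //.
  by rewrite cardsU1 jS add1n eqSS.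
- rewrite fam_bd_d; apply: eqon_trans (bc S) => i Oi.
  rewrite -[RHS]subr0 -[X in _ = _ - X](bt S i Oi) !fam_bdE /bd -sumrB; apply: eq_bigr => j jS.
  have [_ _ dr] := rP (j |: S); rewrite (dr i Oi) -mulrBr; congr (_ * _).
- by move=> i Oi; rewrite fam_bdE -[RHS](bd_bd (fun S => r S i) S);
    apply: eq_bigr => j _; rewrite fam_bdE.
Qed.

Lemma nerve_support p (s : E p.+1) : (p + k <= N)%N ->
  eqon (d s) 0 O -> eqon s 0 (O `\` [set x | exists j, A j x]) ->
  exists2 t, eqon t 0 (O `\` Bt) & eqon (d t) s O.
Proof.
move=> pk ds s0.
have [||||||t [tB _ dt _]] := @nerve_vanish k 0 p
    (fun S => if S == finset.set0 then s else 0) => //.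
- move=> S; case: eqP => [->|_]; last exact: eqon_refl.
  apply: eqonS s0 => x [Ox nA]; split=> // h; apply: nA; split=> // j.
  by rewrite inE.
- by move=> S; rewrite cards_eq0 => /negbTE ->; exact: eqon_refl.
- by move=> S; case: eqP => _ //; rewrite fd0; exact: eqon_refl.
- move=> S i _; rewrite fam_bdE /bd big1 // => j _.
  have jS : j |: S != finset.set0.
    by apply/eqP => /setP/(_ j); rewrite !inE eqxx.
  rewrite (negbTE jS); exact: mulr0.
exists (t finset.set0); last by have := dt finset.set0; rewrite eqxx.
apply: eqonS (tB finset.set0) => x [Ox nB]; split=> // -[Bx _]; exact: nB.
Qed.

End Nerve.

(** * Colourings of compact sets with a finite-to-one map *)

Section FiniteCovers.
Variable R : realType.

Lemma floor_gap (A B K1 L z x y : R) : - A < x - y -> B <= K1 - (x - z) ->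
  B <= y - z - L -> K1 <= L -> A = B + B -> False.
Proof. by move=> h1 h2 h3 h4 h5; lra. Qed.

Lemma floor_close (K x y z : R) : K <= x - z -> x - z < K + 1 ->
  K <= y - z -> y - z < K + 1 -> `|x - y| < 1.
Proof. by move=> *; rewrite ltr_norml; apply/andP; split; lra. Qed.

Lemma seq_min_gt0 (A : eqType) (P : A -> R -> Prop) (s : seq A) :
  (forall a e e', P a e -> 0 < e' -> e' <= e -> P a e') ->
  (forall a, a \in s -> exists2 e, 0 < e & P a e) ->
  exists2 e, 0 < e & forall a, a \in s -> P a e.
Proof.
move=> Pm; elim: s => [|a s IH] h; first by exists 1.
have [e e0 Pe] := h a (mem_head _ _).
have [|e' e'0 Pe'] := IH; first by move=> b bs; apply: h; rewrite inE bs orbT.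
exists (Num.min e e'); first by rewrite lt_min e0.
move=> b; rewrite inE => /predU1P[->|/Pe' Pb].
  by apply: Pm Pe _ _; rewrite ?lt_min ?e0 // ge_min lexx.
by apply: Pm Pb _ _; rewrite ?lt_min ?e0 // ge_min lexx orbT.
Qed.

Section Metric.
Variable T : pseudoMetricType R.

Lemma ball_tri (x y z : T) (a b c : R) : ball x a y -> ball y b z -> a + b <= c -> ball x c z.
Proof. by move=> xy yz abc; apply: le_ball abc _ _; exact: ball_triangle yz. Qed.

Lemma compact_uniform (K : set T) (P : R -> T -> Prop) : compact K ->
  (forall x, K x -> exists2 e, 0 < e & forall y r, K y -> ball x e y ->
     0 < r -> r < e -> P r y) ->
  exists2 e, 0 < e & forall y, K y -> P e y.
Proof.
move=> cK h.
have A : \forall r \near (0:R)^'+, K `<=` P r.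
  apply: ((near_covering_withinP K).2 ((compact_near_coveringP K).1 cK)).
  move=> x /h[e e0 eP].
  exists (ball x e, [set r | 0 < r < e]) => /=.
    split; first exact: nbhsx_ballx.
    exists e => //= r /=; rewrite sub0r normrN => re r0.
    by rewrite r0 /= (le_lt_trans (ler_norm _) re).
  by move=> [y r] /= [xy /andP[r0 re]] Ky; exact: eP.
have B : \forall e \near (0:R)^'+, 0 < e by exact: nbhs_right_gt.
have [e [e0 eP]] := filter_ex (filterI B A).
by exists e.
Qed.

(** The closure keeps supports closed, so that their complements stay open. *)
Definition thicken (e : R) (A : set T) : set T :=
  closure [set y | exists2 a, A a & ball a e y].

Lemma thicken_closed e A : closed (thicken e A).
Proof. exact: closed_closure. Qed.

Lemma thicken_near e A x r : 0 < r -> thicken e A x ->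
  exists a y, [/\ A a, ball a e y & ball x r y].
Proof. by move=> r0 /(_ _ (nbhsx_ballx x r r0))[y [[a Aa ay] xy]]; exists a, y. Qed.

Lemma thickenS e e' A : e <= e' -> thicken e A `<=` thicken e' A.
Proof.
by move=> ee; apply: closureS => y [a Aa ay]; exists a => //; exact: le_ball ay.
Qed.

Lemma subset_thicken e A : 0 < e -> A `<=` thicken e A.
Proof.
by move=> e0 x Ax; apply: subset_closure; exists x => //; exact: ballxx.
Qed.

Lemma closed_ball_off (A : set T) x : closed A -> ~ A x ->
  exists2 e, 0 < e & forall a, A a -> ~ ball x e a.
Proof.
move=> cA Ax; have : nbhs x (~` A) by apply: open_nbhs_nbhs; split=> //; exact: closed_openC.
by move=> /nbhs_ballP[e /= e0 eA]; exists e => // a Aa /eA.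
Qed.

Lemma thicken_off (A : set T) x : closed A -> ~ A x ->
  exists2 e, 0 < e & forall r y, r < e -> ball x e y -> ~ thicken r A y.
Proof.
move=> cA /(closed_ball_off cA)[e e0 eA]; exists (e / 4); first by rewrite divr_gt0.
move=> r y re xy /(thicken_near (divr_gt0 e0 (ltr0n _ 4)))[a [z [Aa az yz]]].
apply: (eA a Aa); apply: (ball_tri (ball_tri xy yz (lexx _)) (ball_sym az)).
by lra.
Qed.

(* The fibers of [phi] partition [S] into relatively open pieces of radius less
   than [e]. *)
Definition splits (D : Type) (e : R) (S : set T) (phi : T -> D) : Prop :=
  (forall x, S x -> exists2 r, 0 < r & forall y, S y -> ball x r y -> phi y = phi x) /\
  (forall x y, S x -> S y -> phi x = phi y -> ball x e y).

Lemma splitsS D e S S' (phi : T -> D) : S' `<=` S -> splits e S phi -> splits e S' phi.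
Proof.
move=> SS [l s]; split=> [x /SS/l[r r0 rP]|x y /SS Sx /SS Sy]; last exact: s.
by exists r => // y /SS; exact: rP.
Qed.

End Metric.

Section FiniteToOne.
Variables (n m : nat).
Local Notation T := 'rV[R]_n.
Variables (Z : set T) (g : T -> 'rV[R]_m).
Hypothesis cZ : compact Z.
Hypothesis gc : forall z, Z z -> forall e, 0 < e ->
  exists2 r, 0 < r & forall z', Z z' -> ball z r z' -> ball (g z) e (g z').
Hypothesis gf : forall v, finite_set (Z `&` g @^-1` [set v]).

Lemma rV_apart k (x y : 'rV[R]_k) : x <> y -> exists2 e, 0 < e & ~ ball x e y.
Proof.
move=> xy; have [c xyc] : exists c, x ord0 c != y ord0 c.
  apply: contrapT => h; apply: xy; apply/rowP => c; apply/eqP; apply: contrapT.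
  by move=> /negP xyc; apply: h; exists c.
exists `|x ord0 c - y ord0 c|; first by rewrite normr_gt0 subr_eq0.
by move=> /ball_rV/(_ c); rewrite ltxx.
Qed.

(** Over a small ball about [v], compactness confines [Z] to small balls about the finitely many
    points of the fibre of [v]; [phi] names the centre of such a ball. *)
Lemma fiber_splits v e : 0 < e -> exists2 r, 0 < r &
  exists phi : T -> T, splits e (Z `&` g @^-1` (ball v r)) phi.
Proof.
move=> e0; have /finite_seqP[s sE] := gf v.
(* The factor 3 makes [phi] locally constant: two points less than [q <= r] apart have centres less
   than [3 * q] apart, hence equal. *)
have [||r r0 rP] := @seq_min_gt0 _ (fun z (r : R) => forall z', z' \in s -> z <> z' -> ~ ball z (3 * r) z') s.
- move=> a b c h c0 cb z' zs az ab; apply: (h z') => //.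
  by apply: le_ball ab; lra.
- move=> z zs.
  have [||r r0 rP] := @seq_min_gt0 _ (fun z' (r : R) => z <> z' -> ~ ball z (3 * r) z') s.
  + move=> a b c h c0 cb az ab; apply: h => //.
    by apply: le_ball ab; lra.
  + move=> z' _; have [->|zz] := eqVneq z z'; first by exists 1.
    have [|r r0 rP] := @rV_apart _ z z'; first exact/eqP.
    exists (r / 3); first by rewrite divr_gt0.
    by have -> : 3 * (r / 3) = r by field.
  by exists r => // z' z's; exact: rP.
pose q := Num.min r (e / 2).
have [q0 qr qe] : [/\ 0 < q, q <= r & 2 * q <= e].
  rewrite /q lt_min r0 divr_gt0 // ge_min lexx; split=> //.
  have : Num.min r (e / 2) <= e / 2 by rewrite ge_min lexx orbT.
  lra.
clearbody q.
have sZ z : z \in s -> Z z /\ g z = v.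
  by move=> zs; have : [set` s] z by []; rewrite -sE.
have sP z : Z z -> g z = v -> z \in s.
  by move=> Zz gz; have : (Z `&` g @^-1` [set v]) z by []; rewrite sE.
have [|w w0 wP] := @compact_uniform T Z
    (fun w z => ball v w (g z) -> exists2 z0, z0 \in s & ball z0 q z) cZ.
  move=> z Zz; have [gz|gz] := eqVneq (g z) v.
    exists q => // y w Zy zy _ _ _; exists z => //; exact: sP.
  have [|h h0 hP] := @rV_apart _ v (g z); first by move/esym; exact/eqP.
  have [h' h'0 h'P] := gc Zz (divr_gt0 h0 (ltr0n _ 2)).
  exists (Num.min h' (h / 2)); first by rewrite lt_min h'0 divr_gt0.
  move=> y w Zy zy w0; rewrite lt_min => /andP[_ wh] vy; exfalso; apply: hP.
  have zy' : ball z h' y by apply: le_ball zy; rewrite ge_min lexx.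
  by apply: (ball_tri vy (ball_sym (h'P y Zy zy'))); lra.
pose phi z := if pselect (exists2 z0, z0 \in s & ball z0 q z) is left h
  then sval (cid2 h) else z.
have phiP z : Z z -> ball v w (g z) -> phi z \in s /\ ball (phi z) q z.
  move=> Zz vz; rewrite /phi; case: pselect => [h|[]]; last exact: wP.
  by case: cid2.
exists w => //; exists phi; split.
- move=> x [Zx vx]; exists q => // y [Zy vy] xy.
  have [xs px] := phiP x Zx vx; have [ys py] := phiP y Zy vy.
  apply: contrapT => pxy; apply: (rP _ ys _ xs pxy).
  apply: (ball_tri (ball_tri py (ball_sym xy) (lexx _)) (ball_sym px)); lra.
- move=> x y [Zx vx] [Zy vy] pxy.
  have [xs px] := phiP x Zx vx; have [ys py] := phiP y Zy vy.
  rewrite pxy in px; apply: (ball_tri (ball_sym px) py); lra.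
Qed.

Lemma uniform_fiber_splits e : 0 < e -> exists2 r, 0 < r & forall z, Z z ->
  exists phi : T -> T, splits e (Z `&` g @^-1` (ball (g z) r)) phi.
Proof.
move=> e0; apply: compact_uniform => // z Zz.
have [r r0 [phi sphi]] := fiber_splits (g z) e0.
have [h h0 hP] := gc Zz (divr_gt0 r0 (ltr0n _ 2)).
exists (Num.min h (r / 2)); first by rewrite lt_min h0 divr_gt0.
move=> y w Zy zy w0; rewrite lt_min => /andP[_ wr]; exists phi.
apply: splitsS sphi => x [Zx yx]; split=> //.
have zy' : ball z h y by apply: le_ball zy; rewrite ge_min lexx.
by apply: (ball_tri (hP y Zy zy') yx); lra.
Qed.

(* Ostrand's colouring: the point [t] of the line is missed by the colour [c]
   if it is close to [c / (m + 1)] modulo 1; it is missed by at most one colour. *)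
Local Notation M := (m.+1%:R : R).

Definition missed (c : 'I_m.+1) (t : R) : Prop :=
  exists k : int, `|t - c%:R / M - k%:~R| < (2 * M)^-1.

Let M0 : 0 < M. Proof. by rewrite ltr0n. Qed.

Let Mhalf : M^-1 = (2 * M)^-1 + (2 * M)^-1.
Proof.
have h2 : (2:R)^-1 + 2^-1 = 1 by lra.
by rewrite invfM -mulrDl h2 mul1r.
Qed.

(** Otherwise [c / M] and [c' / M] would be less than [1 / M] apart modulo 1, while distinct colours
    are at least [1 / M] apart. *)
Lemma missed_inj c c' t : missed c t -> missed c' t -> c = c'.
Proof.
move=> [k kP] [k' kP'].
have : `|(c%:R - c'%:R) / M + (k - k')%:~R| < M^-1.
  have -> : (c%:R - c'%:R) / M + (k - k')%:~R =
    (t - c'%:R / M - k'%:~R) - (t - c%:R / M - k%:~R) by rewrite intrB; ring.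
  apply: le_lt_trans (ler_normB _ _) _.
  by rewrite [ltRHS]Mhalf; exact: ltrD.
rewrite -(ltr_pM2l M0) mulfV ?gt_eqF // -[X in X * _](gtr0_norm M0) -normrM.
have -> : M * ((c%:R - c'%:R) / M + (k - k')%:~R) =
    ((c%:Z - c'%:Z) + m.+1%:Z * (k - k'))%:~R.
  by rewrite mulrDr [M * (_ / M)]mulrC divfK ?gt_eqF // [RHS]intrD [in RHS]intrM [(_ - _%:Z)%:~R]intrB.
rewrite -intr_norm -[1]/(1%:~R) ltr_int => h.
apply/val_inj => /=.
have := ltn_ord c; have := ltn_ord c'; move: (val c) (val c') h => a a' h am a'm.
have : (a%:Z - a'%:Z) + m.+1%:Z * (k - k') = 0 by lia.
have [kk|kk|kk] := ltrgtP k k'; [|by nia|by rewrite kk; lia].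
by nia.
Qed.

(** Successive intervals of one colour are separated by a gap of width [1 / M], so [x] and [y]
    cannot lie in two different ones. *)
Lemma unmissed_floor c (x y : R) : ~ missed c x -> ~ missed c y ->
  `|x - y| < M^-1 -> Num.floor (x - c%:R / M) = Num.floor (y - c%:R / M).
Proof.
have key (x' y' : R) : ~ missed c x' -> ~ missed c y' -> `|x' - y'| < M^-1 ->
    ~ (Num.floor (x' - c%:R / M) < Num.floor (y' - c%:R / M)).
  move=> mx my xy kl.
  set k := Num.floor _ in kl; set l := Num.floor _ in kl.
  have kx : (k + 1)%:~R - (x' - c%:R / M) >= (2 * M)^-1.
    rewrite leNgt; apply/negP => h; apply: mx; exists (k + 1).
    by rewrite distrC gtr0_norm // subr_gt0 floorD1_gt.
  have ly : (y' - c%:R / M) - l%:~R >= (2 * M)^-1.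
    rewrite leNgt; apply/negP => h; apply: my; exists l.
    by rewrite ger0_norm // subr_ge0 floor_le.
  have kl' : (k + 1)%:~R <= (l%:~R : R) by rewrite ler_int lezD1.
  move: xy; rewrite ltr_norml => /andP[xy _].
  exact: (floor_gap xy kx ly kl' Mhalf).
move=> mx my xy; apply/eqP; rewrite eq_le !leNgt; apply/andP; split; apply/negP.
  by apply: key => //; rewrite distrC.
exact: key.
Qed.

(** Each of the [m] coordinates rules out at most one of the [m + 1] colours. *)
Lemma unmissed_color (v : 'I_m -> R) : exists c, forall i, ~ missed c (v i).
Proof.
apply: contrapT => h.
have {}h c : exists i, missed c (v i).
  apply: contrapT => hc; apply: h; exists c => i ci; apply: hc; by exists i.
have [f fP] := choice h.
have /leq_card : injective f.
  by move=> c c' cc; apply: (missed_inj (fP c)); rewrite cc; exact: fP.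
by rewrite !card_ord ltnn.
Qed.

Definition colored (w : R) (c : 'I_m.+1) : set T :=
  Z `&` [set z | forall i, ~ missed c (g z ord0 i / w)].

Lemma colored_cover w z : Z z -> exists c, colored w c z.
Proof. by move=> Zz; have [c cP] := unmissed_color (fun i => g z ord0 i / w); exists c. Qed.

Lemma colored_closed w c : 0 < w -> closed (colored w c).
Proof.
move=> w0 x xc.
have Zx : Z x.
  have cZ' : closed Z by apply: compact_closed => //; exact: norm_hausdorff.
  by apply: cZ'; apply: closureS xc => y [].
split=> // i [k]; set h := `|_| => hk.
have d0 : 0 < ((2 * M)^-1 - h) * w by rewrite mulr_gt0 // subr_gt0.
have [r r0 rP] := gc Zx d0.
have [y [[Zy yc] xy]] := xc _ (nbhsx_ballx x r r0).
apply: (yc i); exists k.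
have := ball_rV (rP y Zy xy) i; rewrite -(ltr_pM2r (_ : 0 < w^-1)) ?invr_gt0 // mulfK ?gt_eqF //.
have -> : `|g x ord0 i - g y ord0 i| * w^-1 = `|g x ord0 i / w - g y ord0 i / w|.
  by rewrite -mulrBl normrM (gtr0_norm (_ : 0 < w^-1)) // invr_gt0.
move=> h1.
have -> : g y ord0 i / w - c%:R / M - k%:~R =
  (g x ord0 i / w - c%:R / M - k%:~R) - (g x ord0 i / w - g y ord0 i / w) by ring.
by apply: le_lt_trans (ler_normB _ _) _; rewrite -/h addrC -ltrBrDr.
Qed.

(** A cell of one colour has sides less than [w], so it lies over a ball to which
    [uniform_fiber_splits] applies; the cells, labelled by the integer vector [kap], are kept apart
    by [unmissed_floor]. *)
Lemma colored_splits e : 0 < e -> exists2 w, 0 < w & forall c,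
  exists phi : T -> (('I_m -> int) * T)%type, splits e (colored w c) phi.
Proof.
move=> e0; have [w w0 wP] := uniform_fiber_splits e0.
exists w => // c.
pose kap z i := Num.floor (g z ord0 i / w - c%:R / M).
have psiP k : exists psi : T -> T, splits e (colored w c `&` [set z | kap z = k]) psi.
  have [[z0 [Zz0 z0c] kz0]|nz] := pselect (exists2 z0, colored w c z0 & kap z0 = k); last first.
    by exists id; split=> [x [xc xk]|x y [xc xk]]; case: nz; exists x.
  have [psi psiP] := wP z0 Zz0; exists psi; apply: splitsS psiP.
  move=> z [[Zz zc] kz]; split=> //; apply: rV_ball => // i.
  have := congr1 (fun f => f i) (etrans kz0 (esym kz)); rewrite /kap => fE.
  have := floor_le (g z0 ord0 i / w - c%:R / M); have := floorD1_gt (g z0 ord0 i / w - c%:R / M).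
  have := floor_le (g z ord0 i / w - c%:R / M); have := floorD1_gt (g z ord0 i / w - c%:R / M).
  rewrite fE; set K := Num.floor _; rewrite intrD => a1 a2 a3 a4.
  have := floor_close a4 a3 a2 a1.
  by rewrite -mulrBl normrM (gtr0_norm (_ : 0 < w^-1)) ?invr_gt0 // ltr_pdivrMr // mul1r.
have [psi {}psiP] := choice psiP.
exists (fun z => (kap z, psi (kap z) z)); split.
- move=> x xc; have [r r0 rP] := (psiP (kap x)).1 x (conj xc erefl).
  have [h h0 hP] := gc xc.1 (divr_gt0 w0 M0).
  exists (Num.min r h); first by rewrite lt_min r0.
  move=> y yc xy.
  have [xr xh] : ball x r y /\ ball x h y.
    by split; apply: le_ball xy; rewrite ge_min lexx ?orbT.
  have kE : kap y = kap x.
    apply: funext => i; apply: unmissed_floor; [exact: yc.2|exact: xc.2|].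
    have := ball_rV (hP y yc.1 xh) i; rewrite distrC -mulrBl normrM.
    by rewrite (gtr0_norm (_ : 0 < w^-1)) ?invr_gt0 // ltr_pdivrMr // [M^-1 * w]mulrC.
  by rewrite kE; congr pair; apply: rP.
- move=> x y xc yc [kE pE]; apply: ((psiP (kap x)).2 x y) => //.
  by rewrite pE kE.
Qed.

End FiniteToOne.
End FiniteCovers.

(** * Vanishing of local cohomology in Euclidean space *)

Section LocalVanishing.
Variables (R : realType) (n m : nat).
Local Notation T := 'rV[R]_n.

Record pieces (S : set T) (e : R) := Pieces {
  pc_num : nat;
  pc_set : 'I_pc_num -> set T;
  pc_pt : 'I_pc_num -> T;
  pc_closed : forall i, closed (pc_set i);
  pc_disjoint : forall i j y, i != j -> pc_set i y -> ~ pc_set j y;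
  pc_ball : forall i y, pc_set i y -> ball (pc_pt i) e y;
  pc_sub : forall i y, pc_set i y -> S y;
  pc_in : forall i, S (pc_pt i);
  pc_cover : forall y, S y -> exists i, pc_set i y }.

(** The fibres of [phi] are relatively open in the compact [S], so there are finitely many, and each
    is closed as well. *)
Lemma finite_pieces (D : Type) (S : set T) (e : R) (phi : T -> D) : compact S ->
  splits e S phi -> exists P : pieces S e, True.
Proof.
move=> cS [loc small].
pose U (x : T) := (ball x (if pselect (S x) is left h then sval (cid2 (loc x h)) else 1))°.
have UP x : S x -> U x x /\ forall y, U x y -> S y -> phi y = phi x.
  move=> Sx; rewrite /U; case: pselect => // h; case: cid2 => r r0 rP /=; split.
    exact: nbhsx_ballx.
  by move=> y /interior_subset xy Sy; exact: rP.
have [|y Sy|D' D'S cov] := (eq_ind _ (fun P => P S) cS _ (compact_cover T)) T S U.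
- by move=> x _; exact: open_interior.
- by exists y => //; exact: (UP y Sy).1.
pose s := finmap.enum_fset D'; pose x (i : 'I_(size s)) := nth (0 : T) s i.
have xs i : x i \in s by rewrite mem_nth.
have Sx i : S (x i) by have := D'S (x i) (xs i); rewrite inE.
(* Several chosen points may share a fibre of [phi]; it is attributed to the first of them and the
   pieces of the others are empty. *)
pose A (i : 'I_(size s)) := [set y | [/\ S y, phi y = phi (x i) &
  forall j : 'I_(size s), (j < i)%N -> phi (x j) <> phi (x i)]].
suff P : pieces S e by exists P.
apply: (@Pieces S e (size s) A x) => //.
- move=> i y yc.
  have Sy : S y.
    have cS' : closed S by apply: compact_closed => //; exact: norm_hausdorff.
    by apply: cS'; apply: closureS yc => z [].
  have [r r0 rP] := loc y Sy; have [z [[Sz pz h] yz]] := yc _ (nbhsx_ballx y r r0).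
  by split=> //; rewrite -pz; apply/esym/rP.
- have key (i j : 'I_(size s)) y : (i < j)%N -> A i y -> ~ A j y.
    by move=> ij [_ yi _] [_ yj h]; apply: (h i ij); rewrite -yi.
  move=> i j y; rewrite neq_ltn => /orP[]; first exact: key.
  by move=> ji Ai Aj; exact: key ji Aj Ai.
- by move=> i y [Sy yi _]; exact: small.
- by move=> i y [].
- move=> y Sy; have [z zD Uz] := cov y Sy.
  have zs : z \in s by [].
  have Sz : S z by have := D'S z zD; rewrite inE.
  pose P i := (i < size s)%N && `[< phi (nth 0 s i) = phi y >].
  have exP : exists i, P i.
    exists (index z s); rewrite /P index_mem zs nth_index //=.
    by apply/asboolP/esym; exact: (UP z Sz).2.
  have [i /andP[is_ /asboolP iy] imin] := ex_minnP exP.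
  exists (Ordinal is_); split=> //= j ji; rewrite /x /= iy => jy.
  by have := imin j; rewrite /P ltn_ord asboolT // leqNgt ji => /(_ isT).
Qed.

Variables (Z : set T) (g : T -> 'rV[R]_m).
Hypothesis cZ : compact Z.
Hypothesis gc : forall z, Z z -> forall e, 0 < e ->
  exists2 r, 0 < r & forall z', Z z' -> ball z r z' -> ball (g z) e (g z').
Hypothesis gf : forall v, finite_set (Z `&` g @^-1` [set v]).

Lemma closed_Z : closed Z.
Proof. by apply: compact_closed => //; exact: norm_hausdorff. Qed.

(** The pieces of one colour are disjoint, so a point lies in at most one for each of the [m.+1]
    colours. *)
Lemma finite_cover (e : R) : 0 < e -> exists (J : finType) (A : J -> set T) (x : J -> T),
  [/\ forall j, closed (A j), forall j y, A j y -> ball (x j) e y /\ Z y,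
      forall j, Z (x j), forall y, Z y -> exists j, A j y &
      forall (S : {set J}) y, (m.+1 < #|S|)%N -> ~ (forall j, j \in S -> A j y)].
Proof.
move=> e0; have [w w0 wP] := colored_splits cZ gc gf e0.
have ex c : exists P : pieces (colored Z g w c) e, True.
  have [phi phiP] := wP c; apply: finite_pieces phiP.
  apply: subclosed_compact cZ _; last by move=> y [].
  exact: (colored_closed cZ gc).
pose P c := sval (cid (ex c)).
exists {c : 'I_m.+1 & 'I_(pc_num (P c))}, (fun j => pc_set (tagged j)),
  (fun j => pc_pt (tagged j)); split.
- by move=> [c i]; exact: pc_closed.
- by move=> [c i] y /= Ay; split; [exact: pc_ball|have [] := pc_sub Ay].
- by move=> [c i] /=; have [] := pc_in (p := P c) i.
- move=> y /(colored_cover g w)[c yc].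
  by have [i Ai] := pc_cover (P c) yc; exists (existT _ c i).
- move=> S y Sm h.
  have : ~~ dinjectiveb (fun j : {c : 'I_m.+1 & 'I_(pc_num (P c))} => tag j) (mem S).
    apply/negP => /dinjectiveP inj; move: Sm; rewrite -(card_in_imset inj).
    by move=> /(leq_trans)/(_ (max_card _)); rewrite card_ord ltnn.
  move=> /dinjectivePn[[c i] jS [[c' i'] /andP[jj j'S] /= ecc]].
  rewrite /= in ecc; subst c'.
  have ii : i != i' by apply: contra jj => /eqP ->.
  exact: (pc_disjoint ii (h _ jS) (h _ j'S)).
Qed.

(** The closed pieces that miss a point stay at a distance from it, and compactness of [K] makes the
    distance uniform. *)
Lemma thickened_order (K : set T) (J : finType) (A : J -> set T) (e : R) :
  compact K -> 0 < e -> (forall j, closed (A j)) ->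
  (forall (S : {set J}) y, (m.+1 < #|S|)%N -> ~ (forall j, j \in S -> A j y)) ->
  exists2 r, 0 < r & r <= e /\ forall y, K y -> forall S : {set J}, (m.+1 < #|S|)%N ->
    ~ (forall j, j \in S -> thicken r (A j) y).
Proof.
move=> cK e0 cA ord.
have [|r r0 rP] := @compact_uniform R T K (fun r y => forall S : {set J},
    (m.+1 < #|S|)%N -> ~ (forall j, j \in S -> thicken r (A j) y)) cK.
  move=> y Ky.
  have off j : exists2 h, 0 < h & ~ A j y -> forall r z, r < h -> ball y h z ->
      ~ thicken r (A j) z.
    have [Aj|Aj] := pselect (A j y); first by exists 1.
    have [h h0 hP] := thicken_off (cA j) Aj; exists h => // _ r z; exact: hP.
  pose h j := sval (cid2 (off j)).
  have [j|q q0 qP] := @fin_min_gt0 R J h; first by rewrite /h; case: cid2.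
  exists q => // z r Kz yz r0 rq S Sm hS.
  apply: (ord S y Sm) => j jS; apply: contrapT => Aj.
  have rh : r < h j := lt_trans rq (qP j).
  have yk : ball y (h j) z by apply: le_ball yz; exact: ltW.
  move: rh yk; rewrite /h; case: cid2 => /= k k0 kP rk yk.
  exact: (kP Aj r z rk yk (hS j jS)).
exists (Num.min r e); first by rewrite lt_min r0.
split=> [|y Ky S Sm hS]; first by rewrite ge_min lexx orbT.
apply: (rP y Ky S Sm) => j /hS; apply: thickenS.
by rewrite ge_min lexx.
Qed.

Variable C : fcomplex T.
Local Notation E p := (fI C p -> rat).
Local Notation d := (@fd T C _).
Local Notation eqon := (eqon (@fpi T C)).
Variables l u : 'I_n -> R.
Hypothesis lu : forall c, l c < u c.
Local Notation O := (obox l u).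
Hypothesis ZK : Z `<=` cbox l u.

Lemma cbox_compact (a b : 'I_n -> R) : compact (cbox a b).
Proof.
have := @rV_compact R n (fun c => `[a c, b c]%classic) (fun c => @segment_compact _ _ _).
by congr compact; apply/seteqP; split=> x h c; have := h c; rewrite /= in_itv.
Qed.

Lemma small_boxes_bigI (J : finType) (B : J -> set T) (r : R) (S : {set J}) :
  S != finset.set0 -> (forall j, small_box r (B j)) ->
  small_box r [set x | forall j, j \in S -> B j x].
Proof.
move=> /set0Pn[j0 j0S] Bs.
have key (s : seq J) : small_box r (B j0 `&` [set x | forall j, j \in s -> B j x]).
  elim: s => [|j s IH].
    rewrite (_ : _ `&` _ = B j0) //.
    by apply/seteqP; split=> x; [move=> []|move=> Bx; split].
  rewrite (_ : _ `&` _ = B j `&` (B j0 `&` [set x | forall j, j \in s -> B j x])).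
    exact: small_boxI.
  apply/seteqP; split=> x.
    move=> [B0 h]; split; first by apply: h; rewrite mem_head.
    by split=> // k ks; apply: h; rewrite inE ks orbT.
  move=> [Bj [B0 h]]; split=> // k; rewrite inE => /predU1P[->//|]; exact: h.
have := key (enum S); congr small_box; apply/seteqP; split=> x.
  by move=> [_ h] j jS; apply: h; rewrite mem_enum.
by move=> h; split; [exact: h|move=> j; rewrite mem_enum; exact: h].
Qed.

Lemma thicken_bigcup (J : finType) (A : J -> set T) r : Z `<=` [set y | exists j, A j y] ->
  thicken r Z `<=` [set y | exists j, thicken r (A j) y].
Proof.
move=> ZA; have cl : closed (\bigcup_(j in [set: J]) thicken r (A j)).
  by apply: closed_bigcup => [|j _]; [exact: finite_finset|exact: thicken_closed].
move=> y yZ; have [|j _ jy] := cl y; last by exists j.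
apply: closureS yZ => z [a /ZA[j Aj] az]; exists j => //.
by apply: subset_closure; exists a.
Qed.

Lemma open_diff (U A : set T) : open U -> closed A -> open (U `\` A).
Proof. by move=> oU cA; rewrite setDE; apply: openI => //; exact: closed_openC. Qed.

(** The nerve argument is applied to the thickened pieces and to boxes around them. The boxes are
    larger than the pieces, which is why the support grows from radius [r] to radius [e]. *)
Lemma pro_vanish (e : R) : 0 < e -> exists2 r, 0 < r & r < e /\
  forall p (s : E p.+1), (p + m < n)%N -> eqon (d s) 0 O ->
    eqon s 0 (O `\` thicken r Z) ->
  exists2 t, eqon t 0 (O `\` thicken e Z) & eqon (d t) s O.
Proof.
move=> e0; have [c|w w0 wE] := @fin_min_gt0 R _ (fun c => u c - l c).
  by rewrite subr_gt0.
(* A thickened piece lies within [a + r + a <= 3 * a] of its point, so the boxes have sides [6 * a].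
   The bound by [e / 4] keeps them near [Z]; the bound by [w / 6] makes their sides shorter than
   those of [O], as [cbox_support] demands. *)
pose a := Num.min (e / 4) (w / 6).
have [a0 ae aw] : [/\ 0 < a, 4 * a <= e & 6 * a <= w].
  have h1 : a <= e / 4 by rewrite /a ge_min lexx.
  have h2 : a <= w / 6 by rewrite /a ge_min lexx orbT.
  by split; [rewrite /a lt_min !divr_gt0|lra|lra].
clearbody a.
have [J [A [x [cA Ax Zx ZA ord]]]] := finite_cover a0.
have [r r0 [ra rord]] := thickened_order (@cbox_compact l u) a0 cA ord.
have OK : O `<=` cbox l u.
  by move=> y yO c; have /andP[y1 y2] := yO c; rewrite !ltW.
pose B j := cbox (fun c => x j ord0 c - 3 * a) (fun c => x j ord0 c + 3 * a).
have AB j : thicken r (A j) `<=` B j.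
  move=> y /(thicken_near a0)[b [z [Ab bz yz]]] c.
  have /(_ c) := ball_rV (ball_tri (ball_tri (Ax j b Ab).1 bz (lexx _)) (ball_sym yz) (lexx _)).
  by rewrite ltr_norml => /andP[h1 h2]; apply/andP; split; lra.
have BZ j : B j `<=` thicken e Z.
  move=> y yB; apply: subset_closure; exists (x j) => //; apply: rV_ball => // c.
  by have /andP[h1 h2] := yB c; rewrite ltr_norml; apply/andP; split; lra.
exists r => //; split; first by lra.
move=> p s pn ds s0.
have clA S : closed (nerve_in (fun j => thicken r (A j)) S).
  rewrite /nerve_in (_ : [set _ | _] = (\bigcup_(j in [set: J]) thicken r (A j)) `&`
      \bigcap_(j in [set j | j \in S]) thicken r (A j)).
    apply: closedI.
      by apply: closed_bigcup => [|j _]; [exact: finite_finset|exact: thicken_closed].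
    by apply: closed_bigI => j _; exact: thicken_closed.
  apply/seteqP; split=> y.
    by move=> [[j Aj] h]; split=> [|k /= kS]; [exists j|exact: h].
  by move=> [[j _ Aj] h]; split=> [|k kS]; [exists j|exact: h].
have oO : open O by exact: obox_open.
apply: (@nerve_support T C J O (fun j => thicken r (A j)) B (thicken e Z) m.+1 n oO AB BZ).
- by move=> S; exact: open_diff.
- move=> S Sm; apply/seteqP; split=> // y [yO [_ h]].
  exact: (rord y (OK y yO) S Sm h).
- move=> S S0 q t qn dt t0.
  have SE : nerve_out B (thicken e Z) S = [set y | forall j, j \in S -> B j y].
    apply/seteqP; split=> y; first by case.
    move=> h; split=> //; have /set0Pn[j jS] := S0; exact: (BZ j _ (h j jS)).
  have [|b1 [b2 [bE b12]]] := @small_boxes_bigI J B (6 * a) S S0.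
    by move=> j; exists (fun c => x j ord0 c - 3 * a), (fun c => x j ord0 c + 3 * a);
      split=> // c; lra.
  rewrite SE bE in t0 *; apply: cbox_support => // c.
  by have := wE c; have := b12 c; lra.
- by rewrite addnS.
- exact: ds.
- apply: eqonS s0 => y [yO nA]; split=> // yZ; apply: nA.
  exact: (thicken_bigcup ZA).
Qed.

(* Milnor's trick: primitives with supports shrinking to [Z] are corrected to a
   primitive supported in [Z]. *)
Lemma local_vanishing p (s : E p.+1) : (p + m < n)%N -> eqon (d s) 0 O ->
  eqon s 0 (O `\` Z) -> exists2 t, eqon t 0 (O `\` Z) & eqon (d t) s O.
Proof.
have oO : open O by exact: obox_open.
(* Halving forces [del] to tend to 0. The value 1 is for nonpositive [e], which does not occur along
   [del]. *)
pose next (e : R) : R := if pselect (0 < e) is left h then sval (cid2 (pro_vanish h)) / 2 else 1.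
pose fix del k : R := if k is k'.+1 then next (del k') else 1.
have del0 k : 0 < del k.
  elim: k => //= k IH; rewrite /next; case: pselect => // h; case: cid2 => r r0 _ /=.
  by rewrite divr_gt0.
have delS k : del k.+1 < del k / 2 /\ forall q (t : E q.+1), (q + m < n)%N ->
    eqon (d t) 0 O -> eqon t 0 (O `\` thicken (del k.+1) Z) ->
    exists2 v, eqon v 0 (O `\` thicken (del k) Z) & eqon (d v) t O.
  rewrite /= /next; case: pselect => [h|[]//]; case: cid2 => r r0 [re rP] /=.
  split; first by rewrite ltr_pM2r ?invr_gt0.
  move=> q t qn dt t0; apply: rP => //; apply: eqonS t0 => y [yO nZ]; split=> // yZ.
  by apply: nZ; apply: thickenS yZ; rewrite ler_pdivrMr // ler_pMr // ler1n.
have del_small k : del k <= 1 * k.+1%:R^-1.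
  rewrite mul1r; elim: k => [|k IH]; first by rewrite invr1.
  have [h _] := delS k; apply: le_trans (ltW h) _; apply: le_trans (_ : k.+1%:R^-1 / 2 <= _).
    by rewrite ler_pM2r ?invr_gt0.
  rewrite -invfM lef_pV2 ?posrE ?mulr_gt0 ?ltr0n // -natrM ler_nat; lia.
have del_le i j : (i <= j)%N -> del j <= del i.
  elim: j => [|j IH]; first by rewrite leqn0 => /eqP ->.
  rewrite leq_eqVlt => /predU1P[->//|]; rewrite ltnS => /IH; apply: le_trans.
  by have [h _] := delS j; have := del0 j; lra.
pose W k := O `\` thicken (del k) Z.
have oW k : open (W k) by apply: open_diff => //; exact: thicken_closed.
have WS i j : (i <= j)%N -> W i `<=` W j.
  move=> ij y [yO nZ]; split=> // yZ; apply: nZ; apply: thickenS yZ; exact: del_le.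
have Wcov : O `\` Z `<=` \bigcup_k W k.
  move=> y [yO yZ]; have [h h0 hP] := thicken_off closed_Z yZ.
  have [k kh] := small_seq h0 (ltr01 : 0 < (1 : R)); exists k => //; split=> //.
  apply: hP; last exact: ballxx.
  exact: le_lt_trans (del_small k) kh.
have WZ k : W k `<=` O `\` Z.
  by move=> y [yO nZ]; split=> // yZ; apply: nZ; exact: subset_thicken.
move=> pn ds s0.
have ex k : exists t, eqon t 0 (W k) /\ eqon (d t) s O.
  have [_ h] := delS k; have [|t t0 dt] := h p s pn ds; last by exists t.
  exact: eqonS (WZ k.+1) s0.
(* In the lowest degree primitives are functions on an empty type, so any of them has the required
   support. *)
case: p s pn ds s0 ex => [|p] s pn ds s0 ex.
  have [t [_ dt]] := ex 0%N; exists t => // i _.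
  by case: (@fI0 T C).
have [t tP] := choice ex.
have ex2 k : exists v, eqon v 0 (W k) /\ eqon (d v) (t k.+2 - t k.+1) O.
  have [_ h] := delS k; have [|||v v0 dv] := h p (t k.+2 - t k.+1).
  - by apply: leq_ltn_trans pn; rewrite leq_add2r.
  - by rewrite fdB; apply: eqon_sub0; apply: eqon_trans (tP k.+2).2 (eqon_sym (tP k.+1).2).
  - rewrite -(subrr (0 : E p.+1)); apply: eqonB; last exact: (tP k.+1).1.
    by apply: eqonS (tP k.+2).1; exact: WS.
  by exists v.
have [v vP] := choice ex2.
(* On [W i] these sums no longer change from the index [i] on, so they glue to some [q]; over [W k],
   [t 1 + d q] equals [t k.+1], which vanishes there. *)
pose V k := \sum_(0 <= i < k) v i.
have VE i j : (i <= j)%N -> eqon (V j) (V i) (W i).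
  move=> /subnKC <-; elim: (j - i)%N => [|k IH]; first by rewrite addn0; exact: eqon_refl.
  have h : eqon (v (i + k)%N) 0 (W i).
    by apply: eqonS (vP (i + k)%N).1; apply: WS; exact: leq_addr.
  have -> : V (i + k.+1)%N = V (i + k)%N + v (i + k)%N.
    by rewrite addnS /V big_nat_recr.
  by have := eqonD IH h; rewrite addr0.
have dV k : eqon (d (V k)) (t k.+1 - t 1%N) O.
  elim: k => [|k IH]; first by rewrite /V big_geq // fd0 subrr; exact: eqon_refl.
  rewrite /V big_nat_recr //= fdD.
  have -> : t k.+2 - t 1%N = (t k.+1 - t 1%N) + (t k.+2 - t k.+1).
    by rewrite [RHS]addrC subrKA.
  by apply: eqonD IH (vP k).2.
have [i j|q qE] := @eqon_glue _ _ (@fpi T C) p nat W V.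
  have [ij|ji] := leqP i j.
    by apply: eqon_sym; apply: eqonS (VE _ _ ij); exact: subIsetl.
  by apply: eqonS (VE _ _ (ltnW ji)); exact: subIsetr.
exists (t 1%N + d q).
  move=> i /Wcov[k _ Wi].
  have dq : eqon (d q) (d (V k)) (W k) by apply: fd_loc => //; exact: qE.
  rewrite -[LHS]/(t 1%N i + d q i) (dq i Wi) (dV k i Wi.1) -[X in _ + X]/(t k.+1 i - t 1%N i).
  rewrite (tP k.+1).1; last exact: (WS k k.+1).
  by rewrite sub0r addrN.
by rewrite fdD fdd addr0; exact: (tP 1%N).2.
Qed.

End LocalVanishing.

(** * Local cohomology on the manifold *)

Section SheafResolution.
Variables (T : topologicalType) (F : sheaf T).

Record res_stage := ResStage {
  rst_prev : sheaf T;
  rst_idx : Type;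
  rst_pi : rst_idx -> T;
  rst_map : sheaf_map rst_prev (sky rst_pi) }.

Definition res_stage_of (A C : sheaf T) (f : sheaf_map A C) : res_stage :=
  let c1 := cid (sky_cokernel f) in let c2 := cid (svalP c1) in
  let c3 := cid (svalP c2) in @ResStage C (sval c1) (sval c2) (sval c3).

Fixpoint res_stages (j : nat) : res_stage :=
  match j with
  | 0 => res_stage_of (zero_map (zero_sheaf T) F)
  | j'.+1 => res_stage_of (@rst_map (res_stages j'))
  end.

Lemma res_stage_ofP (A C : sheaf T) (f : sheaf_map A C) :
  (forall U s, @rst_map (res_stage_of f) U (f U s) = 0) /\
  forall x, exact_at f (@rst_map (res_stage_of f)) x.
Proof. exact: (svalP (cid (svalP (cid (svalP (cid (sky_cokernel f))))))). Qed.

Record resolution := Resolution {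
  rl_idx : nat -> Type;
  rl_pi : forall j, rl_idx j -> T;
  rl_aug : sheaf_map F (sky (@rl_pi 0));
  rl_diff : forall j, sheaf_map (sky (@rl_pi j)) (sky (@rl_pi j.+1));
  rl_diff_aug : forall U s, rl_diff 0 U (rl_aug U s) = 0;
  rl_diff_diff : forall j U s, rl_diff j.+1 U (rl_diff j U s) = 0;
  rl_aug_inj : forall U s, rl_aug U s = 0 -> s = 0;
  rl_exact0 : forall x, exact_at rl_aug (rl_diff 0) x;
  rl_exact : forall j x, exact_at (rl_diff j) (rl_diff j.+1) x }.

Lemma resolutionP : exists P : resolution, True.
Proof.
suff P : resolution by exists P.
pose D j : sheaf_map (sky (@rst_pi (res_stages j))) (sky (@rst_pi (res_stages j.+1))) :=
  @rst_map (res_stages j.+1).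
apply: (@Resolution (fun j => rst_idx (res_stages j)) (fun j => @rst_pi (res_stages j))
  (@rst_map (res_stages 0)) D).
- by move=> U s; exact: (res_stage_ofP (@rst_map (res_stages 0))).1.
- by move=> j U s; exact: (res_stage_ofP (@rst_map (res_stages j.+1))).1.
- move=> U s s0; apply: sec_locally_eq0 => x Ux.
  have [V [h [t [Vx e]]]] := (res_stage_ofP (zero_map (zero_sheaf T) F)).2 x U s Ux s0.
  by exists V, h.
- by move=> x; exact: (res_stage_ofP (@rst_map (res_stages 0))).2.
- by move=> j x; exact: (res_stage_ofP (@rst_map (res_stages j.+1))).2.
Qed.

End SheafResolution.

(* The resolution with a zero term added in degree 0, so that degree [p] below is
   degree [p - 1] of the resolution. *)
Section Augmented.
Variables (T : topologicalType) (F : sheaf T) (P : resolution F).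

Definition aug_idx (p : nat) : Type := if p is j.+1 then rl_idx P j else False.

Definition aug_pi (p : nat) : aug_idx p -> T :=
  match p with 0 => fun i => match i with end | j.+1 => @rl_pi _ _ P j end.

Definition aug_diff (p : nat) : sheaf_map (sky (@aug_pi p)) (sky (@aug_pi p.+1)) :=
  match p with 0 => zero_map _ _ | j.+1 => rl_diff P j end.

Lemma aug_diff_diff p U s : aug_diff p.+1 U (aug_diff p U s) = 0.
Proof. by case: p s => [|p] s; [exact: smap0|exact: rl_diff_diff]. Qed.

Lemma aug_sky0 U (s : sky (@aug_pi 0) U) : s = 0.
Proof. by apply: sky_eq => -[]. Qed.

End Augmented.

Section ConstantSections.
Variable T : topologicalType.

Lemma const_locally_constant (U : opens T) (c : rat) :
  @locally_constant T U ((fun=> c) : set_type U -> rat^o).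
Proof. by move=> x; exact: filterE. Qed.

Definition const_sec (U : opens T) (c : rat) : constant_sheaf T U :=
  submod_mk (lc_submod (locally_constant_local T) U) (@const_locally_constant U c).

Definition point_in (U : opens T) x (Ux : oset U x) : set_type U := exist _ x (mem_set Ux).

Definition csec_val (U : opens T) (s : constant_sheaf T U) : set_type U -> rat := submod_val s.

Lemma csec_eq (U : opens T) (s t : constant_sheaf T U) :
  (forall x (Ux : oset U x), csec_val s (point_in Ux) = csec_val t (point_in Ux)) -> s = t.
Proof.
move=> st; apply: submod_val_inj; apply: funext => -[x xU].
have := st x (set_mem xU).
by rewrite /point_in (_ : mem_set (set_mem xU) = xU) //; exact: Prop_irrelevance.
Qed.

Lemma csec_res (U V : opens T) (h : V `<=` U) (s : constant_sheaf T U) x (Vx : oset V x) :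
  csec_val (res h s) (point_in Vx) = csec_val s (point_in (h x Vx)).
Proof. by rewrite /csec_val /= /fun_res /=; congr (submod_val s _); exact: val_inj. Qed.

Lemma csec_local (U : opens T) (s : constant_sheaf T U) x (Ux : oset U x) :
  exists (V : opens T) (h : V `<=` U), oset V x /\
    forall y (Vy : oset V y), csec_val s (point_in (h y Vy)) = csec_val s (point_in Ux).
Proof.
have := submod_valP s (point_in Ux); rewrite /prop_near1 nbhsE => -[_ [[O oO <-] Ox] sO].
exists (opensI (Opens oO) U), opensIr; split=> // y Vy.
have := sO (point_in Vy.2) Vy.1; rewrite /csec_val => <-.
by congr (submod_val s _); exact: val_inj.
Qed.

Lemma csec_local_const (U : opens T) (s : constant_sheaf T U) x : oset U x ->
  exists (V : opens T) (h : V `<=` U) c, oset V x /\ res h s = const_sec V c.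
Proof.
move=> Ux; have [V [h [Vx sV]]] := csec_local s Ux.
exists V, h, (csec_val s (point_in Ux)); split=> //; apply: csec_eq => y Vy.
by rewrite csec_res sV.
Qed.

End ConstantSections.

(** * Transport of the resolution to a chart *)

Section Chart.
Variables (R : realType) (n : nat) (X : topologicalType) (N : opens X).
Variables (h : set_type N -> 'rV[R]_n) (g : 'rV[R]_n -> set_type N).
Hypotheses (hc : continuous h) (gc : continuous g).
Hypotheses (hK : cancel h g) (gK : cancel g h).
Local Notation T := 'rV[R]_n.

Definition chart_set (U : set T) : set X := [set x | exists m : oset N x, U (h (point_in m))].

Lemma chart_set_open U : open U -> open (chart_set U).
Proof.
move=> oU; have [O oO OE] : open (h @^-1` U) by move/continuousP: hc; apply.
have -> : chart_set U = O `&` N.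
  apply/seteqP; split=> x.
    move=> [m Um]; split=> //.
    by have : (set_val @^-1` O) (point_in m) by rewrite OE.
  by move=> [Ox m]; exists m; have : (h @^-1` U) (point_in m) by rewrite -OE.
by apply: openI => //; exact: oset_open.
Qed.

Definition chart_open U (oU : open U) : opens X := Opens (chart_set_open oU).

Lemma chart_open_sub U (oU : open U) : chart_open oU `<=` N.
Proof. by move=> x []. Qed.

Lemma chart_image_open (V : opens X) : open [set y | oset V (set_val (g y))].
Proof.
have /continuousP : continuous (set_val \o g).
  by move=> y; apply: continuous_comp; [exact: gc|exact: initial_continuous].
by apply; exact: oset_open.
Qed.

Lemma point_inK x (m : oset N x) (k : oset N x) : point_in m = point_in k.
Proof. exact: val_inj. Qed.

Lemma chart_valK y : oset N (set_val (g y)).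
Proof. exact: (set_mem (valP (g y))). Qed.

Lemma chart_hgE y (m : oset N (set_val (g y))) : h (point_in m) = y.
Proof. by rewrite (_ : point_in m = g y) ?gK //; exact: val_inj. Qed.

Lemma chart_ghE x (m : oset N x) : set_val (g (h (point_in m))) = x.
Proof. by rewrite hK. Qed.

Variable P : resolution (constant_sheaf X).
Local Notation I := (aug_idx P).
Local Notation pi := (@aug_pi _ _ P _).
Local Notation D := (aug_diff P).

(** Functions on the indices over the chart are the sections over [N]; moving their points to
    Euclidean space turns the resolution over [N] into an [fcomplex]. *)
Definition chart_idx p : Type := {i : I p | oset N (pi i)}.
Definition chart_pi p (i : chart_idx p) : T := h (point_in (svalP i)).

Definition chart_sec p (s : chart_idx p -> rat) : sky (@aug_pi _ _ P p) N :=
  sky_mk pi N (fun i => if pselect (oset N (pi i)) is left m then s (exist _ i m) else 0).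
Definition chart_fun p (s : sky (@aug_pi _ _ P p) N) : chart_idx p -> rat :=
  fun i => sky_val s (sval i).

Lemma chart_secE p (s : chart_idx p -> rat) (i : chart_idx p) :
  sky_val (chart_sec s) (sval i) = s i.
Proof.
rewrite sky_mkE; last exact: (svalP i).
case: pselect => [m|[]]; last exact: (svalP i).
by congr s; case: i m => i k m; congr exist; exact: Prop_irrelevance.
Qed.

Lemma chart_funK p (s : sky (@aug_pi _ _ P p) N) : chart_sec (chart_fun s) = s.
Proof.
by apply: sky_eq => i m; rewrite -[i]/(sval (exist (fun i => oset N (pi i)) i m)) chart_secE.
Qed.

Definition chart_diff p (s : chart_idx p -> rat) : chart_idx p.+1 -> rat :=
  chart_fun (D p N (chart_sec s)).

Lemma eqon_res p (s t : chart_idx p -> rat) U (oU : open U) :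
  eqon (@chart_pi) s t U <->
  res (@chart_open_sub U oU) (chart_sec s) = res (@chart_open_sub U oU) (chart_sec t).
Proof.
split=> [st|st i Ui].
  apply: sky_eq => i Ui; rewrite !sky_valE //; move: Ui => [m Um].
  rewrite -[i]/(sval (exist (fun i => oset N (pi i)) i m)) !chart_secE.
  apply: (st (exist (fun i => oset N (pi i)) i m)).
  by rewrite /chart_pi (point_inK _ m).
have ciU : oset (chart_open oU) (pi (sval i)) by exists (svalP i).
have := congr1 (fun s => sky_val s (sval i)) st.
by rewrite !sky_valE // !chart_secE.
Qed.

Lemma chart_secB p (s t : chart_idx p -> rat) : chart_sec (s - t) = chart_sec s - chart_sec t.
Proof.
apply: sky_eq => i m; rewrite -[i]/(sval (exist (fun i => oset N (pi i)) i m)).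
rewrite chart_secE -[RHS]/(sky_val (chart_sec s) _ - sky_val (chart_sec t) _).
by rewrite !chart_secE.
Qed.

Lemma chart_funB p (s t : sky (@aug_pi _ _ P p) N) :
  chart_fun (s - t) = chart_fun s - chart_fun t.
Proof. by []. Qed.

Lemma chart_diffB p (s t : chart_idx p -> rat) :
  chart_diff (s - t) = chart_diff s - chart_diff t.
Proof. by rewrite /chart_diff chart_secB smapB chart_funB. Qed.

Lemma chart_sec_diff p (s : chart_idx p -> rat) :
  chart_sec (chart_diff s) = D p N (chart_sec s).
Proof. exact: chart_funK. Qed.

Lemma chart_diff_loc p (s t : chart_idx p -> rat) U : open U ->
  eqon (@chart_pi) s t U -> eqon (@chart_pi) (chart_diff s) (chart_diff t) U.
Proof.
move=> oU /(eqon_res _ _ oU) st; apply/(eqon_res _ _ oU).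
by rewrite !chart_sec_diff -!smap_res st.
Qed.

Lemma chart_sec0 p : chart_sec (0 : chart_idx p -> rat) = 0.
Proof. by rewrite -(subrr (0 : chart_idx p -> rat)) chart_secB subrr. Qed.

Lemma chart_diff_diff p (s : chart_idx p -> rat) : chart_diff (chart_diff s) = 0.
Proof. by rewrite /chart_diff chart_funK aug_diff_diff. Qed.

Definition chart_iota (c : rat) : chart_idx 1 -> rat := @chart_fun 1 (rl_aug P N (const_sec N c)).

Lemma chart_iotaB a b : chart_iota (a - b) = chart_iota a - chart_iota b.
Proof.
rewrite /chart_iota -chart_funB -smapB; congr (@chart_fun 1 (rl_aug P N _)).
exact: csec_eq.
Qed.

Lemma chart_diff_iota c : chart_diff (chart_iota c) = 0.
Proof. by rewrite /chart_diff chart_funK [X in chart_fun X]rl_diff_aug. Qed.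

Lemma chart_iota_inj c U : open U -> U !=set0 -> eqon (@chart_pi) (chart_iota c) 0 U -> c = 0.
Proof.
move=> oU [y Uy] /(eqon_res _ _ oU).
rewrite chart_funK chart_sec0 res0 -smap_res => /rl_aug_inj e.
have Ugy : oset (chart_open oU) (set_val (g y)).
  by exists (chart_valK y); rewrite chart_hgE.
by have := congr1 (fun s => csec_val s (point_in Ugy)) e.
Qed.

Lemma chart_loc x p (s : chart_idx p.+1 -> rat) U : open U -> U x ->
  eqon (@chart_pi) (chart_diff s) 0 U -> exists V, [/\ open V, V x &
    exists2 e, boundary chart_diff chart_iota e & eqon (@chart_pi) s e V].
Proof.
move=> oU Ux /(eqon_res _ _ oU); rewrite chart_sec_diff chart_sec0 res0 -smap_res => ds.
have Ugx : oset (chart_open oU) (set_val (g x)).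
  by exists (chart_valK x); rewrite chart_hgE.
have Nsub (V : opens X) (hV : V `<=` chart_open oU) : V `<=` N.
  exact: subset_trans hV (@chart_open_sub U oU).
have key q (e s' : chart_idx q -> rat) (V : opens X) (VN : V `<=` N) :
    res VN (chart_sec s') = res VN (chart_sec e) ->
    eqon (@chart_pi) s' e [set y | oset V (set_val (g y))].
  move=> se; apply/(eqon_res _ _ (@chart_image_open V)); apply: sky_eq => i Ui.
  have Vi : oset V (aug_pi i) by move: Ui => [m]; rewrite /= chart_ghE.
  by have := congr1 (fun s => sky_val s i) se; rewrite !sky_valE.
case: p s ds => [|p] s ds.
  have [V [hV [t [Vx tE]]]] := rl_exact0 Ugx ds.
  have [W [WV [c [Wx tc]]]] := csec_local_const t Vx.
  exists [set y | oset W (set_val (g y))]; split=> //; first exact: chart_image_open.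
  exists (chart_iota c); first by exists c.
  apply: (key _ _ _ W (Nsub W (subset_trans WV hV))).
  rewrite chart_funK -smap_res -(res_comp (@chart_open_sub U oU) (subset_trans WV hV)).
  rewrite -(res_comp hV WV) tE -smap_res tc; congr (rl_aug P W _).
  exact: csec_eq.
have [V [hV [t [Vx tE]]]] := rl_exact Ugx ds.
(* [chart_diff] acts on sections over all of [N], so the local primitive is first extended there. *)
have [t' t'E] := sky_flabby (Nsub V hV) t.
exists [set y | oset V (set_val (g y))]; split=> //; first exact: chart_image_open.
exists (chart_diff (@chart_fun p.+1 t')); first by exists (@chart_fun p.+1 t').
apply: (key _ _ _ V (Nsub V hV)).
rewrite chart_sec_diff chart_funK -smap_res t'E -[RHS]tE res_res.
exact: res_irr.
Qed.

Definition chart_fcomplex : fcomplex T :=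
  @FComplex T chart_idx chart_pi chart_diff chart_diffB chart_diff_loc chart_diff_diff
    (fun i => match sval i with end) chart_iota chart_iotaB chart_diff_iota
    chart_iota_inj chart_loc.

End Chart.

Section VanExactLocal.
Variables (R : realType) (n : nat) (X : topologicalType).
Variable P : resolution (constant_sheaf X).
Local Notation D := (aug_diff P).

Lemma van_exact_in (O : opens X) k x : oset O x -> van_exact D O k x.
Proof.
move=> Ox j jk U s Ux ds; exists (opensI U O), opensIl, 0; split=> //.
by rewrite smap0; apply: van_eq; exact: (submod_valP s).
Qed.

(** In a chart the support, cut by a small closed box, is a compact set on which [f] is continuous
    and finite-to-one, so [local_vanishing] applies. *)
Lemma van_exact_local (x : X) (O : opens X) (m k : nat) (W : opens X) (f : X -> 'rV[R]_m) :
  locally_euclidean_at R n x -> oset W x -> (k + m <= n)%N ->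
  (forall z, oset W z -> ~ oset O z -> forall e, 0 < e -> exists V : opens X,
     oset V z /\ forall z', oset V z' -> oset W z' -> ~ oset O z' -> ball (f z) e (f z')) ->
  (forall v, finite_set [set z | [/\ oset W z, ~ oset O z & f z = v]]) ->
  van_exact D O k x.
Proof.
move=> [N0 [oN N0x] [h [hc [g [gc hK gK]]]]] Wx kmn fc ff j jk U s Ux ds.
pose N := Opens oN; have Nx : oset N x := N0x.
pose Q := opensI (opensI U N) W.
have Qx : oset Q x by split.
pose C := @chart_fcomplex R n X N h g hc gc hK gK P.
pose hx := h (point_in Nx : set_type N).
have Qhx : oset Q (set_val (g hx)) by rewrite hK.
have [e e0 eQ] := open_obox (@chart_image_open R n X N g gc Q) Qhx.
(* Half the radius, so that the closed box also lies in [Q] and the support inside it is compact. *)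
pose l c := hx ord0 c - e / 2; pose u c := hx ord0 c + e / 2.
have lu c : l c < u c by rewrite /l /u; lra.
have boxQ y : cbox l u y -> oset Q (set_val (g y)).
  move=> yb; apply: eQ => c; have /andP[] := yb c; rewrite /l /u.
  by move=> *; apply/andP; split; lra.
have obox_cbox y : obox l u y -> cbox l u y.
  by move=> yb c; have /andP[? ?] := yb c; rewrite !ltW.
pose Z : set 'rV[R]_n := [set y | cbox l u y /\ ~ oset O (set_val (g y))].
have cZ : compact Z.
  apply: subclosed_compact (@cbox_compact R n l u) _; last by move=> y [].
  rewrite (_ : Z = cbox l u `&` ~` [set y | oset O (set_val (g y))]) //.
  apply: closedI; first by apply: compact_closed; [exact: norm_hausdorff|exact: cbox_compact].
  by apply: open_closedC; exact: (@chart_image_open R n X N g gc O).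
pose f1 y := f (set_val (g y)).
have f1c z : Z z -> forall r, 0 < r ->
    exists2 q, 0 < q & forall z', Z z' -> ball z q z' -> ball (f1 z) r (f1 z').
  move=> [zb Oz] r r0; have [V [Vz VP]] := fc _ (boxQ _ zb).2 Oz r r0.
  have : nbhs z [set y | oset V (set_val (g y))].
    apply: open_nbhs_nbhs; split=> //; exact: (@chart_image_open R n X N g gc V).
  move=> /nbhs_ballP[q /= q0 qV]; exists q => // z' [zb' Oz'] zz'.
  by apply: VP => //; [exact: qV|exact: (boxQ _ zb').2].
have f1f v : finite_set (Z `&` f1 @^-1` [set v]).
  have gi : injective (set_val \o g).
    move=> y y' /= e'; rewrite -[y]gK -[y']gK; congr h; exact: val_inj.
  apply: (@sub_finite_set _ _ ((set_val \o g) @^-1` [set z | [/\ oset W z, ~ oset O z & f z = v]])).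
    by move=> y [[yb Oy] fy]; split=> //; exact: (boxQ _ yb).2.
  by apply: finite_preimage (ff v) => y y' _ _; exact: gi.
pose UN := opensI U N.
have [t1 t1E] := sky_flabby (@opensIr _ U N) (res (@opensIl _ U N) (van_val s)).
pose S : fI C j.+1 -> rat := @chart_fun _ N P j.+1 t1.
have oO : open (obox l u) by exact: obox_open.
pose V := @chart_open R n X N h hc (obox l u) oO.
have VQ : V `<=` Q.
  by move=> y [m0 yb]; have := boxQ _ (obox_cbox _ yb); rewrite hK.
have VUN : V `<=` UN by move=> y /VQ[].
have VN : V `<=` N by move=> y /VUN[].
have VU : V `<=` U by move=> y /VUN[].
have t1V : res VN t1 = res VU (van_val s).
  rewrite -(res_comp (@opensIr _ U N) VUN) t1E res_res; exact: res_irr.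
have dS : eqon (@fpi _ C) (fd S) 0 (obox l u).
  apply/(@eqon_res R n X N h hc P _ _ _ _ oO).
  rewrite chart_sec_diff chart_sec0 chart_funK res0 -smap_res.
  have -> : res (@chart_open_sub R n X N h hc (obox l u) oO) t1 = res VU (van_val s).
    by rewrite -t1V; exact: res_irr.
  by rewrite smap_res (congr1 (@van_val _ O _ _) ds : D j.+1 U (van_val s) = 0) res0.
have S0 : eqon (@fpi _ C) S 0 (obox l u `\` Z).
  move=> i [ib iZ].
  have iV : oset V (aug_pi (sval i)) by exists (svalP i).
  have iO : oset O (aug_pi (sval i)).
    apply: contrapT => Oi; apply: iZ; split; first exact: obox_cbox.
    by rewrite /= /chart_pi hK.
  have := congr1 (fun s => sky_val s (sval i)) t1V; rewrite sky_valE // => e1.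
  apply: etrans e1 _; rewrite sky_valE //.
  have := congr1 (fun s => sky_val s (sval i)) (submod_valP s).
  rewrite sky_valE //; split=> //; exact: (VU).
have [|||t t0 dt] := @local_vanishing R n m Z f1 cZ f1c f1f C l u lu j S.
- by apply: leq_trans kmn; rewrite ltn_add2r.
- exact: dS.
- exact: S0.
have w0 : van_cond O (res VN (chart_sec t)).
  rewrite /van_cond; apply: sky_eq => i [iV iO].
  rewrite !sky_valE //; have iN := VN _ iV.
  rewrite -[i]/(sval (exist (fun i => oset N (aug_pi i)) i iN)) chart_secE.
  apply: t0; rewrite /= /chart_pi; split.
    by move: iV => [m0 im]; rewrite (point_inK _ m0).
  by move=> [_]; rewrite hK.
exists V, VU, (van_mk w0); split.
  exists Nx; rewrite -/hx => c; rewrite /l /u; apply/andP; split; lra.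
apply: van_eq; rewrite -[LHS]/(res VU (van_val s)) -t1V.
rewrite -[RHS]/(D j V (res VN (chart_sec t))) smap_res.
have := (@eqon_res R n X N h hc P _ _ _ _ oO).1 dt.
rewrite chart_sec_diff chart_funK => e1.
by rewrite (res_irr _ (@chart_open_sub R n X N h hc _ oO)) -e1; exact: res_irr.
Qed.

End VanExactLocal.

(** A weak form of chart, a continuous injection into [R^l] near [y]: it passes to subsets, and
    composed with the branched covering it is finite-to-one. *)
Definition parametrized (R : realType) (T : topologicalType) (l : nat) (A : set T) (y : T) : Prop :=
  exists (W : opens T) (g : T -> 'rV[R]_l),
  [/\ oset W y,
      forall z, oset W z -> A z -> forall e, 0 < e -> exists V : opens T,
        oset V z /\ forall z', oset V z' -> oset W z' -> A z' -> ball (g z) e (g z') &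
      forall z z', oset W z -> A z -> oset W z' -> A z' -> g z = g z' -> z = z'].

Lemma opens_subspace (T : topologicalType) (B : set T) (W : opens (set_type B)) :
  exists O : opens T, forall b, oset W b <-> oset O (set_val b).
Proof. by case: W => W [O oO OW]; exists (Opens oO) => b /=; rewrite -OW. Qed.

(** * Dimension of strata *)

Section Strata.
Variable R : realType.

Lemma parametrizedS (T : topologicalType) l (A A' : set T) y : A' `<=` A ->
  parametrized R l A y -> parametrized R l A' y.
Proof.
move=> AA' [W [g [Wy gc gi]]]; exists W, g; split=> //.
- move=> z Wz Az e e0; have [V [Vz Vg]] := gc z Wz (AA' _ Az) e e0.
  by exists V; split=> // z' Vz' Wz' /AA'; exact: Vg.
- by move=> z z' Wz /AA' Az Wz' /AA' Az'; exact: gi.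
Qed.

Lemma parametrized_val (T : topologicalType) (B : set T) l (A : set (set_type B)) b :
  parametrized R l A b -> parametrized R l (set_val @` A) (set_val b).
Proof.
move=> [W [g [Wb gc gi]]]; have [O OW] := opens_subspace W.
pose g' y := if pselect (B y) is left By then g (exist _ y (mem_set By)) else 0.
have g'E b' : g' (set_val b') = g b'.
  rewrite /g'; case: pselect => [By|[]]; last exact: set_valP.
  by congr g; exact: val_inj.
exists O, g'; split; first exact/OW.
- move=> z0 /= Wz [z Az zE] e e0; subst z0; have [V [Vz Vg]] := gc z ((OW z).2 Wz) Az e e0.
  have [O' OV] := opens_subspace V.
  exists O'; split=> [|z1 O'z' Oz' [z' Az' zE]]; first exact/OV.
  by subst z1; rewrite !g'E; apply: Vg => //; [exact/OV|exact/OW].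
- move=> z1 z2 Wz [z Az zE] Wz' [z' Az' zE']; subst z1 z2; rewrite !g'E => e.
  by congr set_val; apply: gi => //; exact/OW.
Qed.

Lemma parametrized_chart (T : topologicalType) (S : topologicalType) l (A N : set T)
    (phi : set_type N -> S) (h : S -> 'rV[R]_l) y :
  nbhs y N -> continuous phi -> continuous h ->
  (forall z z', A (set_val z) -> A (set_val z') -> h (phi z) = h (phi z') -> z = z') ->
  parametrized R l A y.
Proof.
rewrite nbhsE => -[O [oO Oy] ON] cphi ch hi.
pose g z := if pselect (N z) is left Nz then h (phi (exist _ z (mem_set Nz))) else 0.
have gE z : g (set_val z) = h (phi z).
  rewrite /g; case: pselect => [Nz|[]]; last exact: set_valP.
  by congr (h (phi _)); exact: val_inj.
have lift z : N z -> exists z' : set_type N, set_val z' = z.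
  by move=> Nz; exists (exist _ z (mem_set Nz)).
exists (Opens oO), g; split=> // [z Oz Az e e0|z z' Oz Az Oz' Az'].
- have [w wE] := lift z (ON _ Oz); rewrite -wE gE.
  have chp : continuous (h \o phi) by move=> u; apply: continuous_comp; [exact: cphi|exact: ch].
  have : nbhs w ((h \o phi) @^-1` ball (h (phi w)) e) by apply: chp; exact: nbhsx_ballx.
  rewrite nbhsE => -[_ [[O' oO' <-] O'z] O'h].
  exists (Opens oO'); split=> [|z' O'z' Oz' _]; first by move: O'z; rewrite -?wE.
  have [u uE] := lift z' (ON _ Oz').
  by rewrite -uE gE; apply: O'h; rewrite /= uE.
- have [u uE] := lift z (ON _ Oz); have [u' uE'] := lift z' (ON _ Oz').
  by rewrite -uE -uE' !gE => e; congr set_val; apply: hi; rewrite ?uE ?uE'.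
Qed.

(** In a distinguished neighbourhood the skeleton of index [j] is [R^j] times the cone vertex, so
    the projection to [R^j] is injective on it. *)
Lemma stratificationP (m : nat) (Z : topologicalType) (F : nat -> set Z) :
  stratification R m F ->
  [/\ forall i, closed (F i), forall i, F i `<=` F i.+1, forall i, (m <= i)%N -> F i = setT &
      forall j x, strata F j x -> (j <= m)%N /\ parametrized R j (F j) x].
Proof.
case=> {m Z F} [Z F _ oZ FT|m Z F _ _ cF FS FT loc].
- split=> [i|i|i _|j x] //; first by rewrite FT; exact: closedT.
    by rewrite !FT.
  case: j => [|j] [_]; last by rewrite /= FT => -[].
  move=> _; split=> //; exists (Opens (oZ [set x])), (fun=> 0); split=> //.
    by move=> z _ _ e e0; exists (Opens (oZ [set z])); split=> [|z' _ _ _] //; exact: ballxx.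
  by move=> z z' -> _ ->.
split=> // j x xj; have jm : (j <= m.+1)%N.
  rewrite leqNgt; apply/negP => jm; case: xj => _; case: j jm => // j jm /=.
  by move=> nF; apply: nF; rewrite FT.
split=> //; have [N [Nx [[jE [phi [cphi [psi [cpsi phiK psiK]]]]]|]]] := loc j x xj.
  subst j; apply: (@parametrized_chart _ _ m.+1 (F m.+1) N phi id x Nx cphi) => //.
    by move=> y.
  by move=> z z' _ _; exact: (can_inj phiK).
move=> [_ [L [FL [_ _ [phi [[cphi [psi [cpsi phiK psiK]]] _ phiF]]]]]].
apply: (@parametrized_chart _ _ j (F j) N phi fst x Nx cphi); first by move=> -[u v]; exact: cvg_fst.
have vert z : F j (set_val z) -> (phi z).2 = None.
  move=> Fz; have : (phi @` (set_val @^-1` F j)) (phi z) by exists z.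
  by rewrite phiF => -[_]; case: (phi z).2 => //.
move=> z z' /vert Fz /vert Fz' e; apply: (can_inj phiK).
by apply: injective_projections => //; rewrite Fz Fz'.
Qed.

End Strata.

Section Codimension.
Variables (R : realType) (n : nat) (X Y : topologicalType) (f : X -> Y).
Hypotheses (cf : continuous f) (ff : finite_fibers f).
Hypothesis Xeucl : forall x : X, locally_euclidean_at R n x.
Variable P : resolution (constant_sheaf X).
Local Notation D := (aug_diff P).

Definition preim_compl (A : set Y) (cA : closed A) : opens X :=
  opreim cf (Opens (closed_openC cA)).

(** Over the part of [A'] outside [A], [f] followed by an injection into [R^l] is finite-to-one, and
    [l + k <= n] gives the vanishing there; [van_exact_filtration] joins it to that for [A]. *)
Lemma van_exact_strata (k : nat) (A A' : set Y) (cA : closed A) (cA' : closed A') :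
  A `<=` A' ->
  (forall y, A' y -> ~ A y -> exists2 l, (l + k <= n)%N & parametrized R l (A' `\` A) y) ->
  (forall x, van_exact D (preim_compl cA) k x) ->
  forall x, van_exact D (preim_compl cA') k x.
Proof.
move=> AA' par ex.
apply: (@van_exact_filtration _ _ D (@aug_diff_diff _ _ P)
  (fun j => @sky_flabby _ _ _) (@aug_sky0 _ _ P) _ (preim_compl cA)) => //.
  by move=> x /= A'x /AA'.
move=> x /= Ax; have [A'x|A'x] := pselect (A' (f x)); last first.
  exact: (@van_exact_in X P (preim_compl cA')).
have [l lk [W [g [Wx gc gi]]]] := par _ A'x Ax.
apply: (@van_exact_local R n X P x _ l k
  (opreim cf (opensI W (Opens (closed_openC cA)))) (g \o f) (Xeucl x)) => //.
- by rewrite addnC.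
- move=> z [Wz Az] /contrapT A'z e e0; have [V [Vz Vg]] := gc _ Wz (conj A'z Az) e e0.
  by exists (opreim cf V); split=> // z' Vz' [Wz' Az'] /contrapT A'z'; exact: Vg.
- move=> v; have [[z0 [[/= Wz0 Az0] /contrapT A'z0 gz0]]|no] :=
    pselect (exists z, [/\ oset (opreim cf (opensI W (Opens (closed_openC cA)))) z,
     ~ oset (preim_compl cA') z & (g \o f) z = v]).
    apply: (@sub_finite_set _ _ (f @^-1` [set f z0])); last exact: ff.
    move=> z [/= [Wz Az] /contrapT A'z gz]; apply: gi => //.
    by rewrite gz0.
  apply: (@sub_finite_set _ _ set0) => // z Hz; case: no; by exists z.
Qed.

Variables (B : set Y) (cB : closed B).
Variables (FY : nat -> set Y) (m : nat) (FB : nat -> set (set_type B)).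
Hypotheses (sY : stratification R n FY) (sB : stratification R m FB).

(** With both indices equal to [n - k + 1] this becomes the refined skeleton of codimension [k],
    since a minimum is at most [n - k] when one of its terms is. Moving [i] and [j] separately adds
    the strata of one dimension, of [Y] or of [B], at a time. *)
Definition skeleton_union (i : nat) (j : nat) : set Y :=
  (B `&` skeleton_below FY i) `|` (set_val @` skeleton_below FB j).

Lemma closed_val (A : set (set_type B)) : closed A -> closed (set_val @` A).
Proof.
move=> /closed_openC [O oO OE].
rewrite (_ : _ @` _ = B `&` ~` O); first by apply: closedI => //; exact: open_closedC.
apply/seteqP; split=> [_ [b Ab <-]|y [By Oy]].
  split; first exact: set_valP.
  by move=> Ob; have : (set_val @^-1` O) b by []; rewrite OE.
exists (exist _ y (mem_set By)) => //; apply: contrapT => Ab.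
by apply: Oy; move: (Ab); rewrite -[~ _]/((~` A) _) -OE.
Qed.

Lemma closed_below (T : topologicalType) (F : nat -> set T) i :
  (forall i, closed (F i)) -> closed (skeleton_below F i).
Proof. by case: i => [|i] cF //=; exact: closed0. Qed.

Lemma skeleton_union_closed i j : closed (skeleton_union i j).
Proof.
have [cY _ _ _] := stratificationP sY; have [cB' _ _ _] := stratificationP sB.
apply: closedU; first by apply: closedI => //; exact: closed_below.
by apply: closed_val; exact: closed_below.
Qed.

Lemma below_sub (T : topologicalType) (F : nat -> set T) i :
  (forall i, F i `<=` F i.+1) -> skeleton_below F i `<=` F i.
Proof. by case: i => [|i] FS //= ; exact: FS. Qed.

Lemma skeleton_union_van_exact k i j : (i + k <= n.+1)%N -> (j + k <= n.+1)%N ->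
  forall x, van_exact D (preim_compl (@skeleton_union_closed i j)) k x.
Proof.
have [_ mY _ pY] := stratificationP sY; have [_ mB _ pB] := stratificationP sB.
elim: j => [|j IHj] ik jk.
  elim: i ik => [|i IHi] ik.
    move=> x; apply: van_exact_in => /=.
    by case=> [[]|[]].
  apply: (@van_exact_strata k _ _ (@skeleton_union_closed i 0)) (IHi _).
  - move=> y [[By Fy]|[]//]; left; split=> //; exact: below_sub Fy.
  - move=> y [[By Fy]|[]//] nF; exists i; first by rewrite -ltnS -addSn.
    apply: parametrizedS (pY i y _).2.
      by move=> z [[[_ //]|[]//]].
    by split=> // Fy'; apply: nF; left.
  - by apply: leq_trans ik; rewrite leq_add2r.
apply: (@van_exact_strata k _ _ (@skeleton_union_closed i j)) (IHj _ _) => //.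
- move=> y [|[b Fb <-]]; [by left|right]; exists b => //; exact: below_sub Fb.
- move=> y A'y nA; have [b Fb by_] : (set_val @` FB j) y.
    by case: A'y => // A'y; case: nA; left.
  exists j; first by rewrite -ltnS -addSn.
  rewrite -by_; apply: parametrizedS (parametrized_val (pB j b _).2).
    by move=> z [[zA|//] nz]; case: nz; left.
  by split=> // Fb'; apply: nA; right; exists b.
- by apply: leq_trans jk; rewrite leq_add2r.
Qed.

End Codimension.

Lemma finite_open_bigcap (T : topologicalType) (I : choiceType) (A : set I) (F : I -> set T) :
  finite_set A -> (forall i, A i -> open (F i)) -> open (\bigcap_(i in A) F i).
Proof.
move=> fA oF; rewrite -[X in open X]setCK; apply: closed_openC; rewrite setC_bigcap.
by apply: closed_bigcup => // i Ai; apply: open_closedC; exact: oF.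
Qed.

Lemma finite_separation (T : topologicalType) (A : set T) : hausdorff_space T -> finite_set A ->
  exists W : T -> opens T, (forall x, A x -> oset (W x) x) /\
    forall x x' z, A x -> A x' -> oset (W x) z -> oset (W x') z -> x = x'.
Proof.
move=> hT fA.
have sep (p : T * T) : exists O : opens T * opens T, p.1 <> p.2 ->
    [/\ oset O.1 p.1, oset O.2 p.2 & forall z, oset O.1 z -> ~ oset O.2 z].
  have [e|e] := pselect (p.1 = p.2); first by exists (opensT T, opensT T).
  move: hT; rewrite open_hausdorff => /(_ p.1 p.2 (introN eqP e)).
  case=> -[O1 O2] /= [/set_mem i1 /set_mem i2] [o1 o2 /eqP/seteqP[dis _]].
  by exists (Opens o1, Opens o2) => _; split=> // z z1 z2; exact: (dis z).
have [O OP] := choice sep.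
have oW x : open (\bigcap_(x' in A `\ x) ((O (x, x')).1 `&` (O (x', x)).2)).
  apply: finite_open_bigcap; first exact: finite_setD.
  by move=> x' _; apply: openI; exact: oset_open.
exists (fun x => Opens (oW x)); split=> [x Ax x' [Ax' /= xx']|x x' z Ax Ax' Wz W'z].
  by split; [have [] := OP (x, x') (nesym xx')|have [] := OP (x', x) xx'].
apply: contrapT => xx'.
have [z1 _] := Wz x' (conj Ax' (nesym xx')).
have [_ z2] := W'z x (conj Ax xx').
by have [_ _ /(_ z z1)] := OP (x, x') xx'.
Qed.

(** * Exactness of the direct image under a finite closed map *)

Section FiniteMap.
Variables (X Y : topologicalType) (f : X -> Y).
Hypotheses (cf : continuous f) (ff : finite_fibers f) (hX : hausdorff_space X).
Hypothesis fcl : forall C, closed C -> closed (f @` C).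

Lemma fiber_tube y (O : opens X) : (forall x, f x = y -> oset O x) ->
  exists2 V : opens Y, oset V y & forall x, oset V (f x) -> oset O x.
Proof.
move=> Oy; have cC : closed (f @` (~` O)).
  by apply: fcl; apply: open_closedC; exact: oset_open.
exists (Opens (closed_openC cC)).
  by move=> [x Ox /Oy].
by move=> x fx; apply: contrapT => Ox; apply: fx; exists x.
Qed.

Lemma fiber_nbhd y (V : X -> opens X) : (forall x, f x = y -> oset (V x) x) ->
  exists (W : X -> opens X) (N : opens Y),
  [/\ oset N y, forall x, f x = y -> oset (W x) x, forall x, W x `<=` V x,
      forall x x' z, f x = y -> f x' = y -> oset (W x) z -> oset (W x') z -> x = x' &
      forall z, oset N (f z) -> exists2 x, f x = y & oset (W x) z].
Proof.
move=> Vy; have [W [Wy dis]] := finite_separation hX (ff y).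
have oO : open (\bigcup_(x in f @^-1` [set y]) (W x `&` V x)).
  by apply: bigcup_open => x _; apply: openI; exact: oset_open.
have [|N Ny NO] := @fiber_tube y (Opens oO).
  by move=> x xy; exists x => //; split; [exact: Wy|exact: Vy].
exists (fun x => opensI (W x) (V x)), N; split=> //.
- by move=> x xy; split; [exact: Wy|exact: Vy].
- by move=> x; exact: opensIr.
- by move=> x x' z xy xy' [zx _] [zx' _]; exact: dis zx zx'.
Qed.

(** Near [y] the preimage falls into disjoint neighbourhoods of the points of the fibre, so local
    solutions at these points glue without any condition. *)
Lemma push_exact (A B C : sheaf X) (u : sheaf_map A B) (v : sheaf_map B C) :
  (forall x, exact_at u v x) -> forall y, exact_at (pushs_map cf u) (pushs_map cf v) y.
Proof.
move=> ex y U s Uy vs.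
have ex' x : exists V : opens X, f x = y ->
    exists (h : V `<=` opreim cf U) (t : A V), oset V x /\ res h (s : B (opreim cf U)) = u V t.
  have [xy|xy] := pselect (f x = y); last by exists (opensT X).
  have [|V [h [t [Vx e]]]] := ex x (opreim cf U) s _ vs; first by rewrite /= xy.
  by exists V => _; exists h, t.
have [V VP] := choice ex'.
have [|W [N [Ny Wx WV dis cov]]] := @fiber_nbhd y V; first by move=> x /VP[h [t []]].
pose M := opensI N U; pose I := {x | f x = y}.
have Iy (i : I) : f (sval i) = y := proj2_sig i.
pose O (i : I) := opensI (W (sval i)) (opreim cf M).
have h (i : I) : V (sval i) `<=` opreim cf U by have [] := VP (sval i) (Iy i).
have tP (i : I) : exists t : A (V (sval i)), res (h i) (s : B (opreim cf U)) = u _ t.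
  have [h' [t [_ e]]] := VP (sval i) (Iy i).
  by exists t; rewrite -e; exact: res_irr.
pose t (i : I) := sval (cid (tP i)); have tE i := svalP (cid (tP i)).
have OV (i : I) : O i `<=` V (sval i) by move=> z [/WV].
have OM (i : I) : O i `<=` opreim cf M by move=> z [].
have [||r rE] := @sheaf_glue X A (opreim cf M) I O OM (fun i => res (OV i) (t i)).
- by move=> z Mz; have [x xy Wz] := cov z Mz.1; exists (exist _ x xy).
- move=> i j; apply: sec_locally_eq => z [Oi Oj]; have [zi _] := Oi; have [zj _] := Oj.
  have ij : i = j.
    have e := dis (sval i) (sval j) z (Iy i) (Iy j) zi zj.
    case: i j e {zi zj Oi Oj} => [x xy] [x' xy'] /= e; subst x'.
    by congr exist; exact: Prop_irrelevance.
  subst j; exists (opensI (O i) (O i)), (@subset_refl _ _).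
  split; [by split|congr (res _ _); exact: res_irr].
exists M, (@opensIr _ N U), (r : pushs cf A M); split; first by split.
apply: (@sec_locally_eq X B (opreim cf M)) => z Mz; have [x xy Wz] := cov z Mz.1.
pose i : I := exist _ x xy; exists (O i), (OM i); split=> //.
rewrite -[RHS](smap_res u) rE smap_res -tE.
by rewrite [LHS](@res_res X B) [RHS](@res_res X B); exact: res_irr.
Qed.

End FiniteMap.

(** * Restriction of sheaves to open subspaces *)

Section OpenRestriction.
Variables (T : topologicalType) (A : set T) (oA : open A).

Lemma ext_open_subproof (V : opens (set_type A)) : open (set_val @` V).
Proof.
have [O OV] := opens_subspace V.
rewrite (_ : _ @` _ = A `&` O); first by apply: openI => //; exact: oset_open.
apply/seteqP; split=> [_ [z Vz <-]|z [Az Oz]].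
  by split; [exact: set_valP|exact/OV].
by exists (exist _ z (mem_set Az)) => //; exact/OV.
Qed.

Definition ext_open (V : opens (set_type A)) : opens T := Opens (@ext_open_subproof V).

Lemma ext_sub (U V : opens (set_type A)) : V `<=` U -> ext_open V `<=` ext_open U.
Proof. by move=> VU _ [z Vz <-]; exists z => //; exact: VU. Qed.

Lemma in_ext (V : opens (set_type A)) z : oset (ext_open V) (set_val z) <-> oset V z.
Proof. by split=> [[z' Vz' /val_inj <-]|Vz] //; exists z. Qed.

Definition rests_presheaf (F : presheaf T) : presheaf (set_type A).
Proof.
refine (@Presheaf _ (fun U => F (ext_open U))
  (fun U V h => @res T F (ext_open U) (ext_open V) (ext_sub h)) _ _ _).
- by move=> U V h; exact: res_linear.
- by move=> U h s; exact: res_id.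
- by move=> U V W h k l s; exact: res_comp.
Defined.

Lemma rests_sheafP (F : sheaf T) : sheaf_axiom (rests_presheaf F).
Proof.
move=> U I V VU cov s scompat.
apply: (@sheafP T F (ext_open U) I (fun i => ext_open (V i)) (fun i => ext_sub (VU i))).
  by move=> _ [x /cov[i _ Vx] <-]; exists i => //; exists x.
move=> i j W h k.
have WV : W `<=` ext_open (opensI (V i) (V j)).
  move=> x Wx; have [z Vz zx] := h x Wx; exists z => //; split=> //.
  by have [z' Vz' z'x] := k x Wx; rewrite (_ : z = z') //; exact: (val_inj (etrans zx (esym z'x))).
have := scompat i j (opensI (V i) (V j)) opensIl opensIr.
move=> /(congr1 (res WV)); rewrite [LHS](@res_res T F) [RHS](@res_res T F) => e.
by apply: etrans (etrans e _); exact: res_irr.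
Qed.

Definition rests (F : sheaf T) : sheaf (set_type A) := Sheaf (@rests_sheafP F).

Definition rests_map (F G : sheaf T) (phi : sheaf_map F G) :
  sheaf_map (rests F) (rests G).
Proof.
refine (@SheafMap _ (rests F) (rests G) (fun U => phi (ext_open U)) _ _).
- by move=> U; exact: (@smap_linear T F G phi (ext_open U)).
- by move=> U V h s; exact: (@smap_res T F G phi (ext_open U) (ext_open V)).
Defined.

Definition trace_open (V : opens T) : opens (set_type A) := opreim (@set_val_continuous T A) V.

Lemma ext_trace (V : opens T) : ext_open (trace_open V) `<=` V.
Proof. by move=> _ [z Vz <-]. Qed.

Lemma rests_exact (F G H : sheaf T) (u : sheaf_map F G) (v : sheaf_map G H) x :
  exact_at u v (set_val x) -> exact_at (rests_map u) (rests_map v) x.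
Proof.
move=> ex U s Ux vs.
have [V [h [t [Vx e]]]] := ex (ext_open U) s ((in_ext U x).2 Ux) vs.
have k : trace_open V `<=` U by move=> z /h /in_ext.
exists (trace_open V), k, (res (@ext_trace V) t); split=> //.
rewrite [RHS](smap_res u) -e [RHS](@res_res T G); exact: (@res_irr T G).
Qed.

Lemma rests_flabby (F : sheaf T) : flabby F -> flabby (rests F).
Proof. by move=> Ff U V h s; have [t tE] := Ff _ _ (ext_sub h) s; exists t. Qed.

End OpenRestriction.

Lemma pushs_flabby (S T : topologicalType) (f : S -> T) (cf : continuous f) (F : sheaf S) :
  flabby F -> flabby (pushs cf F).
Proof.
move=> Ff U V h s.
by have [t tE] := Ff (opreim cf U) (opreim cf V) (fun x Vx => h _ Vx) s; exists t.
Qed.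

(** * The refined skeleton as a union of skeletons *)

Section RefinedSkeleton.
Variables (R : realType) (n : nat) (Y : topologicalType) (B : set Y).
Variables (FY : nat -> set Y) (FB : nat -> set (set_type B)).
Hypotheses (sY : stratification R n FY) (sB : stratification R (n - 2) FB).

Lemma skeleton_mono (T : Type) (F : nat -> set T) i j :
  (forall i, F i `<=` F i.+1) -> (i <= j)%N -> F i `<=` F j.
Proof.
move=> FS; elim: j => [|j IHj]; first by rewrite leqn0 => /eqP->.
by rewrite leq_eqVlt => /predU1P[->//|/IHj ij x /ij]; exact: FS.
Qed.

Lemma strata_ex (T : Type) (F : nat -> set T) N x : F N x -> exists2 i, (i <= N)%N & strata F i x.
Proof.
elim: N => [|N IHN] FN; first by exists 0; last split.
have [/IHN[i iN xi]|nF] := pselect (F N x); first by exists i => //; exact: leqW.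
by exists N.+1.
Qed.

Lemma refined_skeletonE k : (2 <= k)%N -> (k <= n)%N ->
  refined_skeleton n FY FB k = skeleton_union FY FB (n - k).+1 (n - k).+1.
Proof.
have [_ mY TY _] := stratificationP sY; have [_ mB TB _] := stratificationP sB.
move=> k2 kn; rewrite /refined_skeleton /skeleton_union; case: leqP => k3.
  have {k2 k3}-> : k = 2 by apply/eqP; rewrite eqn_leq k2 k3.
  apply/seteqP; split=> [y By|y [[]//|[b _ <-]]]; last exact: set_valP.
  by right; exists (exist _ y (mem_set By)) => //=; rewrite TB.
apply/seteqP; split=> [y [b [i [j [by_ Si Sj ijk]]]]|y].
  have [ij|ij] := leqP i j.
    left; split; first by rewrite -by_; exact: set_valP.
    apply: (skeleton_mono mY _ Si.1); rewrite leq_subRL //.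
    by move: ijk; rewrite (minn_idPl ij) addnC.
  right; exists b => //=; apply: (skeleton_mono mB _ Sj.1); rewrite leq_subRL //.
  by move: ijk; rewrite (minn_idPr (ltnW ij)) addnC.
have stY z : exists i, strata FY i z.
  by have [|i _ iz] := @strata_ex _ FY n z; [rewrite TY|exists i].
have stB b : exists i, strata FB i b.
  by have [|i _ ib] := @strata_ex _ FB (n - 2) b; [rewrite TB|exists i].
case=> [[By /= Fy]|[b /= Fb <-]].
  have [i ik iy] := strata_ex Fy; have [j jb] := stB (exist _ y (mem_set By)).
  exists (exist _ y (mem_set By)), i, j; split=> //.
  lia.
have [j jk jb] := strata_ex Fb; have [i iy] := stY (set_val b).
exists b, i, j; split=> //; lia.
Qed.

Lemma refined_skeleton_top k : (2 < k)%N -> (n < k)%N -> refined_skeleton n FY FB k = set0.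
Proof.
move=> k2 nk; rewrite /refined_skeleton leqNgt k2 /=.
by apply/seteqP; split=> // y [b [i [j [_ _ _]]]]; lia.
Qed.

End RefinedSkeleton.

(** * Complexes concentrated in one degree *)

Section ImageExtension.
Variables (T : topologicalType) (A B J : sheaf T) (u : sheaf_map A B) (v : sheaf_map A J).
Hypothesis uv : forall U s, u U s = 0 -> v U s = 0.

Definition image_cond (U : opens T) (t : B U) : Prop :=
  forall x, oset U x -> exists (V : opens T) (h : V `<=` U) (s : A V),
    oset V x /\ res h t = u V s.

Lemma image_local : local_condition image_cond.
Proof.
constructor.
- move=> U; split=> [x Ux|c t t' ut ut' x Ux].
    by exists U, (@subset_refl _ U), 0; rewrite smap0 res0.
  have [V [h [s [Vx e]]]] := ut x Ux; have [V' [h' [s' [Vx' e']]]] := ut' x Ux.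
  pose W := opensI V V'; have WU : W `<=` U by move=> z [/h].
  exists W, WU, (c *: res (@opensIl _ V V') s + res (@opensIr _ V V') s').
  split=> //; rewrite resD resZ smapD smapZ !smap_res -e -e' !res_res.
  by congr (_ *: _ + _); exact: res_irr.
- move=> U V h t ut x Vx; have [W [k [s [Wx e]]]] := ut x (h x Vx).
  exists (opensI V W), opensIl, (res opensIr s); split=> //.
  by rewrite smap_res -e !res_res; exact: res_irr.
- move=> U I V VU t cov ut x Ux; have [i _ Vx] := cov x Ux.
  have [W [k [s [Wx e]]]] := ut i x Vx; exists W, (subset_trans k (VU i)), s.
  by split=> //; rewrite -e res_res.
Qed.

Definition image_graph (U : opens T) (t : B U) (r : J U) : Prop :=
  forall (V : opens T) (h : V `<=` U) (s : A V), res h t = u V s -> res h r = v V s.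

Lemma image_ker (U : opens T) (s s' : A U) : u U s = u U s' -> v U s = v U s'.
Proof.
move=> e; apply/eqP; rewrite -subr_eq0 -smapB; apply/eqP/uv.
by rewrite smapB e subrr.
Qed.

Lemma image_graph_ex (U : opens T) (t : B U) : image_cond t -> exists r, image_graph t r.
Proof.
move=> ut; pose I := {i : {V : opens T & A V} | exists h : projT1 i `<=` U, res h t = u _ (projT2 i)}.
pose V (i : I) := projT1 (sval i).
have VU i : V i `<=` U by have [] := svalP i.
have VE i : res (VU i) t = u _ (projT2 (sval i)).
  by have [h <-] := svalP i; exact: res_irr.
have [||r rE] := @sheaf_glue T J U I V VU (fun i => v _ (projT2 (sval i))).
- move=> x Ux; have [W [h [s [Wx e]]]] := ut x Ux.
  by exists (exist _ (existT _ W s) (ex_intro _ h e)).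
- move=> i j; rewrite -!smap_res; apply: image_ker; rewrite !smap_res -!VE !res_res.
  exact: res_irr.
exists r => W h s e.
have := rE (exist _ (existT _ W s) (ex_intro _ h e)); rewrite /V /= => <-.
exact: res_irr.
Qed.

Lemma image_graph_uniq (U : opens T) (t : B U) r r' : image_cond t ->
  image_graph t r -> image_graph t r' -> r = r'.
Proof.
move=> ut rt rt'; apply: sec_locally_eq => x Ux; have [V [h [s [Vx e]]]] := ut x Ux.
by exists V, h; rewrite (rt _ _ _ e) (rt' _ _ _ e).
Qed.

(** Injectivity extends maps along monomorphisms, so [u] is replaced by the inclusion of its image
    sheaf, to which [v] descends because it kills the kernel of [u]. *)
Lemma injective_extend : injective_sheaf J ->
  exists w : sheaf_map B J, forall U s, w U (u U s) = v U s.
Proof.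
move=> Jinj; pose M := subsheaf image_local.
have ut U (t : M U) : image_cond (submod_val t) by exact: submod_valP.
pose w U (t : M U) := sval (cid (image_graph_ex (ut U t))).
have wP U (t : M U) : image_graph (submod_val t) (w U t) := svalP (cid (image_graph_ex (ut U t))).
have wL U : linear (w U).
  move=> c t t'; apply: (image_graph_uniq (ut U _) (wP _ _)) => V h s e.
  apply: sec_locally_eq => x Vx.
  have [V1 [h1 [s1 [V1x e1]]]] := ut _ t x (h x Vx).
  have [V2 [h2 [s2 [V2x e2]]]] := ut _ t' x (h x Vx).
  pose W := opensI V (opensI V1 V2).
  have WV : W `<=` V by move=> z [].
  have W1 : W `<=` V1 by move=> z [_ []].
  have W2 : W `<=` V2 by move=> z [_ []].
  exists W, WV; split; first by split=> //; split.
  rewrite res_res resD resZ (res_irr _ (subset_trans W1 h1)) -(res_res h1 W1) (wP _ _ _ _ _ e1).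
  rewrite (res_irr (subset_trans WV h) (subset_trans W2 h2)) -(res_res h2 W2) (wP _ _ _ _ _ e2).
  rewrite -!smap_res -smapZ -smapD; apply: image_ker.
  rewrite smapD smapZ !smap_res -e -e1 -e2 !res_res resD resZ.
  by congr (_ *: _ + _); exact: res_irr.
have wR (U V : opens T) (h : V `<=` U) (t : M U) : w V (res h t) = res h (w U t).
  apply: (image_graph_uniq (ut V _) (wP _ _)) => W k s e.
  by rewrite res_res; apply: wP; rewrite -e res_res.
pose wm := @SheafMap T M J w wL wR.
have iR (U V : opens T) (h : V `<=` U) (t : M U) : submod_val (res h t) = res h (submod_val t) by [].
pose im := @SheafMap T M B (fun U t => submod_val t) (fun U c t t' => erefl) iR.
have [g gE] := Jinj M B im wm (fun U => @submod_val_inj _ _ _).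
exists g => U s.
have us : image_cond (u U s).
  by move=> x Ux; exists U, (@subset_refl _ U), s; rewrite res_id.
rewrite -[u U s]/(im U (submod_mk (lc_submod image_local U) us)) gE.
have E : res (@subset_refl _ U) (submod_val (submod_mk (lc_submod image_local U) us)) = u U s.
  by rewrite res_id.
by rewrite -(wP U _ U (@subset_refl _ U) s E) res_id.
Qed.

End ImageExtension.

(** * Comparison of a flabby resolution with an injective complex *)

Section NatCompare.
Variables (T : topologicalType) (F : sheaf T).
Variables (P : nat -> sheaf T) (dP : forall j, sheaf_map (P j) (P j.+1)) (aug : sheaf_map F (P 0)).
Hypothesis dPdP : forall j U s, dP j.+1 U (dP j U s) = 0.
Hypothesis dPaug : forall U s, dP 0 U (aug U s) = 0.
Hypothesis aug_inj : forall U s, aug U s = 0 -> s = 0.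
Hypothesis P_exact0 : forall x, exact_at aug (dP 0) x.
Hypothesis P_exact : forall j x, exact_at (dP j) (dP j.+1) x.
Hypothesis P_flabby : forall j, flabby (P j).
Variables (K : nat -> sheaf T) (D : forall j, sheaf_map (K j) (K j.+1)).
Hypothesis DD : forall j U s, D j.+1 U (D j U s) = 0.
Hypothesis K_injective : forall j, injective_sheaf (K j).
Hypothesis K00 : forall U (s : K 0 U), s = 0.
Variables (e : nat) (a : sheaf_map F (K e.+1)).
Hypothesis Da : forall U s, D e.+1 U (a U s) = 0.
Hypothesis a_inj : forall (U : opens T) s (t : K e U), a U s = D e U t -> s = 0.
Hypothesis a_surj : forall x (U : opens T) (t : K e.+1 U), oset U x -> D e.+1 U t = 0 ->
  exists (V : opens T) (h : V `<=` U) s (r : K e V), oset V x /\ res h t = a V s + D e V r.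
Hypothesis K_exact : forall j x, j <> e -> exact_at (D j) (D j.+1) x.

Local Notation lift_spec j beta :=
  (forall U s, dP j U s = 0 -> D (j + e).+1 U (beta U s) = 0).

Lemma lift0 : exists beta : sheaf_map (P 0) (K (0 + e).+1),
  lift_spec 0 beta /\ forall U s, beta U (aug U s) = a U s.
Proof.
have [|beta bE] := @injective_extend T F (P 0) (K e.+1) aug a _ (@K_injective _).
  by move=> U s /aug_inj ->; rewrite smap0.
exists beta; split=> // U s ds; apply: sec_locally_eq0 => x Ux.
have [V [h [t [Vx E]]]] := P_exact0 Ux ds; exists V, h; split=> //.
by rewrite -!smap_res E bE; exact: Da.
Qed.

(** [lift_spec] says that [D] after [beta] vanishes on the kernel of [dP j], so that it extends
    along [dP j]; local exactness of [P] renews the condition one degree higher. *)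
Lemma liftS j (beta : sheaf_map (P j) (K (j + e).+1)) : lift_spec j beta ->
  exists beta' : sheaf_map (P j.+1) (K (j.+1 + e).+1),
  lift_spec j.+1 beta' /\ forall U s, beta' U (dP j U s) = D (j + e).+1 U (beta U s).
Proof.
move=> bP; have [|beta' bE] := @injective_extend T (P j) (P j.+1) (K (j + e).+2) (dP j)
    (comp_map (D (j + e).+1) beta) _ (@K_injective _).
  by move=> U s; exact: bP.
exists beta'; split=> // U s ds; apply: sec_locally_eq0 => x Ux.
have [V [h [t [Vx E]]]] := P_exact Ux ds; exists V, h; split=> //.
by rewrite -!smap_res E bE; exact: DD.
Qed.

Definition lift_stage j := {beta : sheaf_map (P j) (K (j + e).+1) | lift_spec j beta}.

Fixpoint lifts j : lift_stage j :=
  match j return lift_stage j with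
  | 0 => exist _ (sval (cid lift0)) (svalP (cid lift0)).1
  | j'.+1 => let c := cid (liftS (svalP (lifts j'))) in exist _ (sval c) (svalP c).1
  end.

Definition rlift j : sheaf_map (P j) (K (j + e).+1) := sval (lifts j).

Lemma lift_aug U s : rlift 0 U (aug U s) = a U s.
Proof. exact: (svalP (cid lift0)).2. Qed.

Lemma lift_diff j U s : rlift j.+1 U (dP j U s) = D (j + e).+1 U (rlift j U s).
Proof. exact: (svalP (cid (liftS (svalP (lifts j))))).2. Qed.

Lemma nat_below_exact i (U : opens T) (t : K i.+1 U) : (i < e)%N -> D i.+1 U t = 0 ->
  exists r : K i U, D i U r = t.
Proof.
move=> ie dt.
apply: (@flabby_exact T K D DD (fun j => injective_flabby (@K_injective j)) i U).
- by move=> V h s _; exists 0; rewrite smap0 res0; split=> //; rewrite [RHS]K00.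
- by move=> j x ji Ux; apply: K_exact; lia.
- move=> x Ux; have [|V [h [r [Vx E]]]] := @K_exact i x _ U t Ux dt; first by lia.
  by exists V, h, r.
Qed.

Lemma ker_extend i (U V : opens T) (h : V `<=` U) (r : K i V) : (i <= e)%N -> D i V r = 0 ->
  exists r' : K i U, D i U r' = 0 /\ res h r' = r.
Proof.
case: i r => [|i] r ie dr; first by exists 0; rewrite smap0 res0; split=> //; rewrite [RHS]K00.
have [q <-] := nat_below_exact ie dr.
have [q' <-] := injective_flabby (@K_injective i) h q.
by exists (D i U q'); rewrite DD smap_res.
Qed.

Definition cone_sheaf j := dsums (P j) (K (j + e)).

Definition cone_diff j : sheaf_map (cone_sheaf j) (cone_sheaf j.+1).
Proof.
refine (@SheafMap T (cone_sheaf j) (cone_sheaf j.+1)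
  (fun U z => (dP j U z.1, rlift j U z.1 - D (j + e) U z.2)) _ _).
- move=> U c z z'; rewrite !smap_linear; congr pair => /=.
  by rewrite opprD addrACA scalerBr.
- by move=> U V h z; rewrite /= !smap_res -resB.
Defined.

Lemma cone_diff_diff j U z : cone_diff j.+1 U (cone_diff j U z) = 0.
Proof.
congr pair; first exact: dPdP.
by rewrite /= smapB lift_diff (@DD (j + e)) subr0 subrr.
Qed.

Lemma cone_flabby j : flabby (cone_sheaf j).
Proof.
move=> U V h [p t]; have [p' pE] := P_flabby h p.
have [t' tE] := injective_flabby (@K_injective (j + e)) h t.
by exists (p', t'); congr pair.
Qed.

Lemma lift_surj j (V : opens T) (q : K (j + e).+1 V) x : oset V x -> D (j + e).+1 V q = 0 ->
  exists (W : opens T) (k : W `<=` V) (c : P j W) (r : K (j + e) W),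
    [/\ oset W x, dP j W c = 0 & res k q = rlift j W c + D (j + e) W r].
Proof.
case: j q => [|j] q Vx dq.
  have [W [k [s [r [Wx qE]]]]] := a_surj Vx dq.
  by exists W, k, (aug W s), r; rewrite lift_aug.
have [|W [k [r [Wx qE]]]] := @K_exact (j.+1 + e) x _ V q Vx dq; first by lia.
by exists W, k, 0, r; rewrite !smap0 add0r.
Qed.

Lemma cone_exact j x : exact_at (cone_diff j) (cone_diff j.+1) x.
Proof.
move=> U [p t] Ux E; have dp : dP j.+1 U p = 0 := congr1 fst E.
have dt : rlift j.+1 U p = D (j.+1 + e) U t.
  by apply/eqP; rewrite -subr_eq0; apply/eqP; exact: (congr1 snd E).
have [V [h [p' [Vx pE]]]] := P_exact Ux dp.
pose q := rlift j V p' - res h t.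
have dq : D (j + e).+1 V q = 0.
  by rewrite smapB -lift_diff -pE !smap_res -dt subrr.
have [W [k [c [r [Wx dc qE]]]]] := lift_surj Vx dq.
exists W, (subset_trans k h), (res k p' - c, r); split=> //; congr pair.
  by rewrite /= smapB dc subr0 smap_res -pE res_res.
rewrite /= smapB smap_res -(res_res h k).
have -> : res h t = rlift j V p' - q by rewrite /q subKr.
by rewrite resB qE opprD addrA.
Qed.

(** The mapping cone of [rlift] is flabby and exact, hence exact on sections over every open set;
    this makes a cocycle of [K] come, up to a coboundary, from a cocycle of [P]. *)
Lemma compare j (U : opens T) (t : K (j + e).+1 U) : D (j + e).+1 U t = 0 ->
  exists (p : P j U) (r : K (j + e) U), dP j U p = 0 /\ t = rlift j U p - D (j + e) U r.
Proof.
move=> dt.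
have [|||z zE] := @flabby_exact T cone_sheaf cone_diff cone_diff_diff cone_flabby j U _ _ (0, t).
(* In the lowest degree the kernel of the cone reduces to the cocycles of [K e], which extend
   because [K] is exact on sections below [e]. *)
- move=> V h [p r] E; have dp : dP 0 V p = 0 := congr1 fst E.
  have dr : rlift 0 V p = D e V r.
    by apply/eqP; rewrite -subr_eq0; apply/eqP; exact: (congr1 snd E).
  have p0 : p = 0.
    apply: sec_locally_eq0 => x Vx; have [W [k [s [Wx sE]]]] := P_exact0 Vx dp.
    exists W, k; split=> //; rewrite sE (@a_inj W s (res k r)) ?smap0 //.
    by rewrite -lift_aug -sE !smap_res dr.
  subst p; move/esym: dr; rewrite smap0 => dr.
  have [r' [dr' rE]] := ker_extend h (leqnn e) dr.
  exists (0, r'); split; first by congr pair; rewrite /= ?smap0 // dr' subrr.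
  by congr pair; rewrite /= ?res0.
- by move=> i x _ Ux; exact: cone_exact.
- move=> x Ux; have [|V [h [z [Vx zE]]]] := @cone_exact j x U (0, t) Ux.
    by congr pair; rewrite /= ?smap0 // dt subrr.
  by exists V, h, z.
by exists z.1, z.2; split; [exact: (congr1 fst zE)|exact: esym (congr1 snd zE)].
Qed.

End NatCompare.

(* The cohomology of [K] is concentrated in degree [m], where [a] identifies it with [F]. *)
Record concentrated (T : topologicalType) (m : int) (F : sheaf T) (K : complex T)
    (a : sheaf_map F (K m)) : Prop := Concentrated {
  cc_cocycle : forall U s, cocycle (a U s);
  cc_inj : forall x (U : opens T) s, oset U x -> coboundary_at (a U s) x ->
    exists (V : opens T) (h : V `<=` U), oset V x /\ res h s = 0;
  cc_surj : forall x (U : opens T) (t : K m U), oset U x -> cocycle t ->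
    exists (V : opens T) (h : V `<=` U) s, oset V x /\ coboundary_at (res h t - a V s) x;
  cc_exact : forall i x (U : opens T) (t : K i U), i <> m -> oset U x -> cocycle t ->
    coboundary_at t x }.

Section Coboundaries.
Variables (T : topologicalType) (K : complex T).

Lemma coboundary_atP i j (U : opens T) (s : K j U) x : i = j - 1 ->
  coboundary_at s x <-> exists (V : opens T) (h : V `<=` U) (t : K i V),
    oset V x /\ res h s = cdiff K i j V t.
Proof. by move=> ->. Qed.

Lemma coboundary_at_res i (U V : opens T) (h : V `<=` U) (s : K i U) x : oset V x ->
  coboundary_at s x -> coboundary_at (res h s) x.
Proof.
move=> Vx [W [k [t [Wx e]]]]; exists (opensI V W), opensIl, (res opensIr t); split=> //.
by rewrite smap_res -e !res_res; exact: res_irr.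
Qed.

Lemma coboundary_at_res_inv i (U V : opens T) (h : V `<=` U) (s : K i U) x :
  coboundary_at (res h s) x -> coboundary_at s x.
Proof.
move=> [W [k [t [Wx e]]]]; exists W, (subset_trans k h), t; split=> //.
by rewrite -e res_res.
Qed.

Lemma coboundary_atD i (U : opens T) (s t : K i U) x :
  coboundary_at s x -> coboundary_at t x -> coboundary_at (s + t) x.
Proof.
move=> [V [h [r [Vx e]]]] [V' [h' [r' [Vx' e']]]].
have k : opensI V V' `<=` U by move=> z [/h].
exists (opensI V V'), k, (res opensIl r + res opensIr r'); split=> //.
rewrite resD smapD !smap_res -e -e' !res_res; congr (_ + _); exact: res_irr.
Qed.

Lemma coboundary_diff i j (U : opens T) (t : K i U) x : oset U x -> i = j - 1 ->
  coboundary_at (cdiff K i j U t) x.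
Proof. by move=> Ux e; subst i; exists U, (@subset_refl _ U), t; rewrite res_id. Qed.

Lemma diff_shift (N : int) (j : nat) : N + j.+1%:Z = N + j%:Z + 1.
Proof. by rewrite -addrA; congr (_ + _); rewrite -PoszD addn1. Qed.

Lemma cocycle_shift (N : int) (j : nat) (U : opens T) (s : K (N + j%:Z) U) :
  cdiff K (N + j%:Z) (N + j.+1%:Z) U s = 0 <-> cocycle s.
Proof. by rewrite /cocycle -diff_shift. Qed.

Lemma diff_recast i j k (U : opens T) (t : K i U) : i = j ->
  exists t' : K j U, cdiff K j k U t' = cdiff K i k U t.
Proof. by move=> <-; exists t. Qed.

End Coboundaries.

Lemma coboundary_map (T : topologicalType) (K L : complex T) (phi : cochain_map K L) i
    (U : opens T) (s : K i U) x : coboundary_at s x -> coboundary_at (phi i U s) x.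
Proof.
move=> [V [h [t [Vx e]]]]; exists V, h, (phi _ V t); split=> //.
by rewrite -smap_res e cmap_diff.
Qed.

Lemma cocycle_map (T : topologicalType) (K L : complex T) (phi : cochain_map K L) i
    (U : opens T) (s : K i U) : cocycle s -> cocycle (phi i U s).
Proof. by rewrite /cocycle -cmap_diff => ->; rewrite smap0. Qed.

Lemma concentrated_comp (T : topologicalType) m (F : sheaf T) (K L : complex T)
    (a : sheaf_map F (K m)) (phi : cochain_map K L) :
  concentrated a -> quasi_iso phi -> @concentrated T m F L (comp_map (phi m) a).
Proof.
move=> [ac ai as_ ae] qi; split.
- by move=> U s; exact: cocycle_map (ac U s).
- move=> x U s Ux0 /= b; apply: (ai x U s Ux0); exact: (qi m x U Ux0).1 (ac U s) b.
- move=> x U t Ux dt; have [V [h [s [Vx ds b]]]] := (qi m x U Ux).2 t dt.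
  have [W [k [r [Wx b']]]] := as_ x V s Vx ds.
  exists W, (subset_trans k h), r; split=> //.
  have -> : res (subset_trans k h) t - (comp_map (phi m) a) W r =
      res k (res h t - phi m V s) + phi m W (res k s - a W r).
    by rewrite resB smapB smap_res res_res /= addrA subrK.
  apply: coboundary_atD; first exact: coboundary_at_res.
  exact: coboundary_map.
- move=> i x U t im Ux dt; have [V [h [s [Vx ds b]]]] := (qi i x U Ux).2 t dt.
  apply: (@coboundary_at_res_inv _ _ _ _ _ h); rewrite -(subrK (phi i V s) (res h t)).
  apply: coboundary_atD => //; apply: coboundary_map; exact: ae.
Qed.

Section ConcentratedInjective.
Variables (T : topologicalType) (m : int) (F : sheaf T) (J : complex T) (a : sheaf_map F (J m)).
Hypothesis ca : concentrated a.
Hypothesis Jinj : forall i, injective_sheaf (J i).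
Variable N0 : int.
Hypothesis JN0 : forall i, i < N0 -> forall U (s : J i U), s = 0.

Lemma shift_pred (N : int) (j : nat) : N + j%:Z = N + j.+1%:Z - 1.
Proof. by rewrite diff_shift addrK. Qed.

(** [J] is to be reindexed from [N], chosen so that its first term is zero and [F] sits in a
    positive degree. *)
Lemma concentrated_start : exists (N : int) (e : nat), m = N + e.+1%:Z /\ N < N0.
Proof.
exists (Num.min N0 m - 1), `|m - Num.min N0 m|%N; split.
  by have : Num.min N0 m <= m; [rewrite ge_min lexx orbT|lia].
by have : Num.min N0 m <= N0; [rewrite ge_min lexx|lia].
Qed.

Lemma concentrated_below i (U : opens T) (t : J i U) : i < m -> cocycle t ->
  exists r : J (i - 1) U, cdiff J (i - 1) i U r = t.
Proof.
have [N [e [mE NN0]]] := concentrated_start.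
move=> im dt; have [iN|Ni] := leP i N.
  by exists 0; rewrite smap0; apply/esym/JN0; exact: le_lt_trans iN NN0.
have [k kE] : exists k : nat, i = N + k.+1%:Z.
  by exists (absz (i - N - 1)%R); lia.
have exJ j x : j <> e -> exact_at (cdiff J (N + j%:Z) (N + j.+1%:Z))
    (cdiff J (N + j.+1%:Z) (N + j.+2%:Z)) x.
  move=> je W s Wx /cocycle_shift ds.
  have := @cc_exact _ _ _ _ _ ca (N + j.+1%:Z) x W s _ Wx ds.
  move=> -[|V [h]]; first by rewrite mE; lia.
  by rewrite -shift_pred => -[r [Vx E]]; exists V, h, r.
subst i; have dt' : cdiff J (N + k.+1%:Z) (N + k.+2%:Z) U t = 0 by exact: (cocycle_shift _).2 dt.
have ke : (k < e)%N by move: im; rewrite mE; lia.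
have [|r rE] := @nat_below_exact T (fun j => J (N + j%:Z))
  (fun j => cdiff J (N + j%:Z) (N + j.+1%:Z)) (fun j => @diff_diff T J _ _ _)
  (fun j => @Jinj _) _ e exJ k U t ke dt'.
  by move=> W s; apply: JN0; rewrite addr0.
by rewrite -rE; apply: diff_recast; exact: shift_pred.
Qed.

Lemma concentrated_inj (U : opens T) s (t : J (m - 1) U) : a U s = cdiff J (m - 1) m U t -> s = 0.
Proof.
move=> E; apply: sec_locally_eq0 => x Ux; apply: (cc_inj ca Ux).
by rewrite E; exact: coboundary_diff.
Qed.

Variables (P : nat -> sheaf T) (dP : forall j, sheaf_map (P j) (P j.+1)) (aug : sheaf_map F (P 0)).
Hypothesis dPaug : forall U s, dP 0 U (aug U s) = 0.
Hypothesis dPdP : forall j U s, dP j.+1 U (dP j U s) = 0.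
Hypothesis aug_inj : forall U s, aug U s = 0 -> s = 0.
Hypothesis P_exact0 : forall x, exact_at aug (dP 0) x.
Hypothesis P_exact : forall j x, exact_at (dP j) (dP j.+1) x.
Hypothesis P_flabby : forall j, flabby (P j).

(** The comparison of [compare] in integer degrees. The equations between degrees are arguments of
    [beta], which spares casts wherever it is used. *)
Lemma concentrated_compare :
  exists beta : forall (j : nat) (i : int), i = m + j%:Z -> sheaf_map (P j) (J i),
  [/\ forall (E : m = m + 0%N%:Z) U s, beta 0 m E U (aug U s) = a U s,
      forall j i i' (E : i = m + j%:Z) (E' : i' = m + j.+1%:Z) U s,
        beta j.+1 i' E' U (dP j U s) = cdiff J i i' U (beta j i E U s) &
      forall j i (E : i = m + j%:Z) (U : opens T) (t : J i U), cocycle t ->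
        exists (p : P j U) (r : J (i - 1) U),
          dP j U p = 0 /\ t = beta j i E U p - cdiff J (i - 1) i U r].
Proof.
have [N [e [mE NN0]]] := concentrated_start.
move: (a) ca; rewrite mE => b cb.
pose K (j : nat) := J (N + j%:Z).
pose D j : sheaf_map (K j) (K j.+1) := cdiff J (N + j%:Z) (N + j.+1%:Z).
have DD j U s : D j.+1 U (D j U s) = 0 by exact: diff_diff.
have K00 U (s : K 0 U) : s = 0 by apply: JN0; rewrite addr0.
have Da U s : D e.+1 U (b U s) = 0 by exact: (cocycle_shift _).2 (cc_cocycle cb s).
have a_inj (U : opens T) s (t : K e U) : b U s = D e U t -> s = 0.
  move=> E; apply: sec_locally_eq0 => x Ux; apply: (cc_inj cb Ux).
  by rewrite E; apply: coboundary_diff => //; exact: shift_pred.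
have a_surj x (U : opens T) (t : K e.+1 U) : oset U x -> D e.+1 U t = 0 ->
    exists (V : opens T) (h : V `<=` U) s (r : K e V), oset V x /\ res h t = b V s + D e V r.
  move=> Ux /cocycle_shift dt; have [V [h [s [Vx]]]] := cc_surj cb Ux dt.
  move/(coboundary_atP _ _ (shift_pred _ _)) => [W [k [r [Wx E]]]].
  exists W, (subset_trans k h), (res k s), r; split=> //.
  by rewrite -[D e W r]E resB res_res smap_res addrC subrK.
have K_exact j x : j <> e -> exact_at (D j) (D j.+1) x.
  move=> je W s Wx /cocycle_shift ds.
  have [|V [h]] := @cc_exact _ _ _ _ _ cb (N + j.+1%:Z) x W s _ Wx ds; first by lia.
  by rewrite -shift_pred => -[r [Vx E]]; exists V, h, r.
pose L := @rlift T F P dP aug aug_inj P_exact0 P_exact K D DD (fun j => @Jinj _) e b Da.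
have castE j i : i = N + e.+1%:Z + j%:Z -> N + (j + e).+1%:Z = i by lia.
pose beta j i (E : i = N + e.+1%:Z + j%:Z) := comp_map (cast_map J (castE j i E)) (L j).
have betaE j (E : N + (j + e).+1%:Z = N + e.+1%:Z + j%:Z) : beta j _ E = comp_map (id_map _) (L j).
  by rewrite /beta (eq_axiomK (castE _ _ E)).
exists beta; split.
- move=> E U s; rewrite -[beta 0 _ E]/(beta 0 (N + (0 + e).+1%:Z) E) betaE.
  exact: (@lift_aug T F P dP aug aug_inj P_exact0 P_exact K D DD (fun j => @Jinj _) e b Da).
- move=> j i i' E E' U s; have iE : i = N + (j + e).+1%:Z by lia.
  have iE' : i' = N + (j + e).+2%:Z by lia.
  move: E E'; rewrite iE iE' => E E'; rewrite (betaE j E) -[beta j.+1 _ E']/(beta j.+1 (N + (j.+1 + e).+1%:Z) E') betaE.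
  exact: (@lift_diff T F P dP aug aug_inj P_exact0 P_exact K D DD (fun j => @Jinj _) e b Da).
- move=> j i E; have iE : i = N + (j + e).+1%:Z by lia.
  move: E; rewrite iE => E U t dt; rewrite betaE.
  have dt' : D (j + e).+1 U t = 0 := (cocycle_shift _).2 dt.
  have [p [r [dp tE]]] := @compare T F P dP aug dPdP dPaug aug_inj P_exact0 P_exact
    P_flabby K D DD (fun j => @Jinj _) K00 e b Da a_inj a_surj K_exact j U t dt'.
  have [r' r'E] := @diff_recast _ J _ _ (N + (j + e).+1%:Z) U r (shift_pred N (j + e)).
  by exists p, r'; split=> //; rewrite r'E.
Qed.

End ConcentratedInjective.

Section Truncation.
Variables (T : topologicalType) (K : complex T) (q : int).

Lemma trunc_cond_below i (U : opens T) (s : K i U) : i < q -> trunc_cond q s.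
Proof. by rewrite /trunc_cond => ->. Qed.

Lemma trunc_cond_cocycle i (U : opens T) (s : K i U) : i <= q -> cocycle s -> trunc_cond q s.
Proof. by move=> iq ds; rewrite /trunc_cond; case: (ltgtP i q) iq. Qed.

Lemma trunc_coboundary i (U : opens T) (t : trunc q K i U) x : i <= q ->
  coboundary_at (submod_val t : K i U) x -> coboundary_at t x.
Proof.
move=> iq [V [h [r [Vx E]]]].
have r0 : trunc_cond q r by apply: trunc_cond_below; rewrite ltrBlDr ltzD1.
exists V, h, (submod_mk (lc_submod (trunc_cond_local K q (i - 1)) V) r0); split=> //.
by apply: submod_val_inj; exact: E.
Qed.

Lemma trunc_out i (U : opens T) (t : trunc q K i U) : q < i -> t = 0.
Proof.
move=> qi; apply: submod_val_inj.
suff out (u : K i U) : trunc_cond q u -> u = 0 by apply: out; exact: submod_valP.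
by rewrite /trunc_cond ltNge (ltW qi) /= gt_eqF.
Qed.

End Truncation.

(** * One truncated direct image *)

Section PushStep.
Variables (S T : topologicalType) (g : S -> T) (cg : continuous g).
Variables (F : sheaf S) (P : nat -> sheaf S) (dP : forall j, sheaf_map (P j) (P j.+1)).
Variable aug : sheaf_map F (P 0).
Hypothesis dPaug : forall U s, dP 0 U (aug U s) = 0.
Hypothesis dPdP : forall j U s, dP j.+1 U (dP j U s) = 0.
Hypothesis aug_inj : forall U s, aug U s = 0 -> s = 0.
Hypothesis P_exact0 : forall x, exact_at aug (dP 0) x.
Hypothesis P_exact : forall j x, exact_at (dP j) (dP j.+1) x.
Hypothesis P_flabby : forall j, flabby (P j).
Variables (F' : sheaf T) (P' : nat -> sheaf T) (dP' : forall j, sheaf_map (P' j) (P' j.+1)).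
Variable aug' : sheaf_map F' (P' 0).
Hypothesis P'_exact0 : forall x, exact_at aug' (dP' 0) x.
Hypothesis P'_exact : forall j x, exact_at (dP' j) (dP' j.+1) x.
Variables (rF : sheaf_map F' (pushs cg F)) (rP : forall j, sheaf_map (P' j) (pushs cg (P j))).
Hypothesis r_diff : forall j V s,
  rP j.+1 V (dP' j V s) = dP j (opreim cg V) (rP j V s : P j (opreim cg V)).
Hypothesis r_aug : forall V s, rP 0 V (aug' V s) = aug (opreim cg V) (rF V s : F (opreim cg V)).
Hypothesis rF_inj : forall V s, rF V s = 0 -> s = 0.
Variables (k : nat) (m q : int).
Hypothesis k2 : (2 <= k)%N.
Hypothesis r_ext : forall j (V : opens T) (p : P j (opreim cg V)), (j.+2 <= k)%N ->
  dP j _ p = 0 -> exists p' : P' j V, dP' j V p' = 0 /\ rP j V p' = p.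
Hypotheses (mq : m <= q) (qk : q <= m + (k - 2)%N%:Z).
Variables (J : complex S) (a : sheaf_map F (J m)) (N0 : int).
Hypothesis ca : concentrated a.
Hypothesis Jinj : forall i, injective_sheaf (J i).
Hypothesis JN0 : forall i, i < N0 -> forall U (s : J i U), s = 0.

Lemma step_aug_cond (V : opens T) (s : F' V) :
  trunc_cond (K := push cg J) q (a (opreim cg V) (rF V s) : push cg J m V).
Proof. by apply: trunc_cond_cocycle => //; exact: (cc_cocycle ca (rF V s : F (opreim cg V))). Qed.

Definition step_aug : sheaf_map F' (trunc q (push cg J) m).
Proof.
refine (@SheafMap T F' (trunc q (push cg J) m)
  (fun V s => submod_mk (lc_submod (trunc_cond_local (push cg J) q m) V) (step_aug_cond s)) _ _).
- move=> U c s t; apply: submod_val_inj.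
  exact: etrans (congr1 (a (opreim cg U)) (smap_linear rF c s t)) (smap_linear a _ _ _).
- move=> U V h s; apply: submod_val_inj.
  exact: etrans (congr1 (a (opreim cg V)) (smap_res rF h s)) (smap_res a _ _).
Defined.

(** Up to a coboundary the cocycle comes from one of [P], which extends by [r_ext] to a cocycle of
    [P'] and is then locally a coboundary; [q <= m + (k - 2)] keeps the degree in the range of
    [r_ext]. *)
Lemma step_exact i (V : opens T) (t : J i (opreim cg V)) x : m < i -> i <= q -> oset V x ->
  cocycle t -> coboundary_at (t : push cg J i V) x.
Proof.
move=> mi iq Vx dt; have [j iE] : exists j : nat, i = m + j.+1%:Z.
  by exists (absz (i - m - 1)%R); lia.
have [beta [_ bd bs]] := concentrated_compare ca Jinj JN0 dPaug dPdP aug_inj P_exact0 P_exact P_flabby.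
have [p [r [dp tE]]] := bs j.+1 i iE (opreim cg V) t dt.
have [|p' [dp' pE]] := @r_ext j.+1 V p _ dp; first by lia.
have [W [h [u [Wx uE]]]] := P'_exact Vx dp'.
have iE' : i - 1 = m + j%:Z by lia.
pose h' : opreim cg W `<=` opreim cg V := fun x Wx => h _ Wx.
exists W, h, (beta j _ iE' (opreim cg W) (rP j W u) - res h' r : J (i - 1) (opreim cg W)); split=> //.
change (@res _ (J i) _ _ h' t =
  cdiff J (i - 1) i (opreim cg W) (beta j _ iE' (opreim cg W) (rP j W u) - res h' r)).
have pE' : dP j (opreim cg W) (rP j W u) = res h' p.
  by rewrite -r_diff -uE -pE; exact: (smap_res (rP j.+1)).
by rewrite smapB -(bd j (i - 1) i iE' iE) pE' tE resB !smap_res.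
Qed.

(** Above [q] truncation leaves nothing, between [m] and [q] [step_exact] applies, and below [m] the
    injective complex is exact on sections. In degree [m] a cocycle of [P] extends to one of [P'],
    which is locally a section of [F']. *)
Lemma step_concentrated : concentrated step_aug.
Proof.
split.
- by move=> V s; apply: submod_val_inj; exact: (cc_cocycle ca (rF V s : F (opreim cg V))).
- move=> x V s Vx [W [h [t [Wx tE]]]]; exists W, h; split=> //.
  apply: rF_inj; apply: (@concentrated_inj _ _ _ _ _ ca (opreim cg W) _ (submod_val t)).
  by rewrite (smap_res rF) (smap_res a); exact: (congr1 (@submod_val _ _ _) tE).
- move=> x V t Vx dt.
  have dt0 : cocycle (submod_val t : J m (opreim cg V)) := congr1 (@submod_val _ _ _) dt.
  have [beta [ba bd bs]] := concentrated_compare ca Jinj JN0 dPaug dPdP aug_inj P_exact0 P_exact P_flabby.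
  have mE : m = m + 0%N%:Z by rewrite addr0.
  have [p [r [dp tE]]] := bs 0%N m mE (opreim cg V) (submod_val t) dt0.
  have [|p' [dp' pE]] := @r_ext 0 V p _ dp; first by lia.
  have [W [h [u [Wx uE]]]] := P'_exact0 Vx dp'.
  exists W, h, u; split=> //; apply: trunc_coboundary => //.
  pose h' : opreim cg W `<=` opreim cg V := fun x Wx => h _ Wx.
  exists W, (@subset_refl _ W), (- res h' r : J (m - 1) (opreim cg W)); split=> //.
  rewrite res_id; change (@res _ (J m) _ _ h' (submod_val t) - a (opreim cg W) (rF W u) =
    cdiff J (m - 1) m (opreim cg W) (- res h' r)).
  have pE' : aug (opreim cg W) (rF W u) = res h' p.
    by rewrite -r_aug -uE -pE; exact: (smap_res (rP 0)).
  by rewrite -(ba mE) pE' tE resB !smap_res smapN addrAC subrr add0r smap_res.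
- move=> i x V t im Vx dt.
  have dt0 : cocycle (submod_val t : J i (opreim cg V)) := congr1 (@submod_val _ _ _) dt.
  have [qi|iq] := ltP q i.
    rewrite (trunc_out t qi); exists V, (@subset_refl _ V), 0; split=> //.
    by rewrite res0 smap0.
  apply: trunc_coboundary => //.
  have [mi|mi] := ltP m i; first exact: step_exact.
  have [|r rE] := @concentrated_below _ _ _ _ _ ca Jinj _ JN0 i (opreim cg V) _ _ dt0.
    by rewrite lt_neqAle mi andbT; apply/eqP.
  exists V, (@subset_refl _ V), r; split=> //.
  by rewrite res_id; exact: esym rE.
Qed.

End PushStep.

(** * Deligne's construction *)

Section InclusionRestriction.
Variables (T : topologicalType) (A A' : set T) (oA : open A) (oA' : open A') (AA' : A `<=` A').

Lemma incl_ext_sub (V : opens (set_type A')) :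
  ext_open oA (opreim (@set_incl_continuous _ _ _ AA') V) `<=` ext_open oA' V.
Proof. by move=> _ [z Vz <-]; exists (set_incl AA' z). Qed.

Definition incl_map (F : sheaf T) :
  sheaf_map (rests oA' F) (pushs (@set_incl_continuous _ _ _ AA') (rests oA F)).
Proof.
refine (@SheafMap _ (rests oA' F) (pushs (@set_incl_continuous _ _ _ AA') (rests oA F))
  (fun V s => res (@incl_ext_sub V) s) _ _).
- by move=> V; exact: (@res_linear T F _ _ (@incl_ext_sub V)).
- by move=> U V h s; rewrite [LHS](@res_res T F) [RHS](@res_res T F); exact: (@res_irr T F).
Defined.

Lemma incl_map_rests (F G : sheaf T) (u : sheaf_map F G) V s :
  incl_map G V (rests_map oA' u V s) =
  rests_map oA u (opreim (@set_incl_continuous _ _ _ AA') V) (incl_map F V s).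
Proof. by rewrite [RHS](smap_res u). Qed.

End InclusionRestriction.

(** * Extension of cocycles across the refined strata *)

Section Branched.
Variables (R : realType) (n : nat) (X Y : topologicalType) (f : X -> Y).
Hypotheses (cf : continuous f) (ff : finite_fibers f).
Hypothesis Xeucl : forall x : X, locally_euclidean_at R n x.
Hypothesis hX : hausdorff_space X.
Hypothesis fcl : forall C, closed C -> closed (f @` C).
Variables (B : set Y) (cB : closed B).
Variables (FY : nat -> set Y) (FB : nat -> set (set_type B)).
Hypotheses (sY : stratification R n FY) (sB : stratification R (n - 2) FB).
Variable P : resolution (constant_sheaf X).

Local Notation Uk := (refined_open n FY FB).

Lemma refined_skeleton_closed k : closed (refined_skeleton n FY FB k).
Proof.
have [k2|k2] := leqP k 2; first by rewrite /refined_skeleton k2.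
have [kn|nk] := leqP k n; last by rewrite refined_skeleton_top //; exact: closed0.
by rewrite (refined_skeletonE sY sB) ?(ltnW k2) //; exact: (skeleton_union_closed cB sY sB).
Qed.

Lemma refined_open_open k : open (Uk k).
Proof. by apply: closed_openC; exact: refined_skeleton_closed. Qed.

Lemma refined_van_exact k x : (2 <= k)%N -> (k <= n)%N ->
  van_exact (aug_diff P) (preim_compl cf (@refined_skeleton_closed k)) k x.
Proof.
move=> k2 kn.
have ex := @skeleton_union_van_exact R n X Y f cf ff Xeucl P B cB FY (n - 2) FB sY sB k
  (n - k).+1 (n - k).+1 _ _ x.
have -> : preim_compl cf (@refined_skeleton_closed k) =
    preim_compl cf (@skeleton_union_closed R n Y B cB FY (n - 2) FB sY sB (n - k).+1 (n - k).+1).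
  by apply: opens_eq; rewrite /= (refined_skeletonE sY sB).
by apply: ex; lia.
Qed.

(** Degree [j] of the resolution is degree [j.+1] of [aug_diff], so the bound of [van_exact_extend]
    reads [j.+2 <= k]. *)
Lemma cocycle_extend k j (W W0 : opens X) (h : W0 `<=` W) (s : sky (@rl_pi _ _ P j) W0) :
  (k <= n)%N -> (j.+2 <= k)%N -> (forall x, oset W0 x <-> oset W x /\ Uk k (f x)) ->
  rl_diff P j W0 s = 0 -> exists t, rl_diff P j W t = 0 /\ res h t = s.
Proof.
move=> kn jk W0E ds; pose O := preim_compl cf (@refined_skeleton_closed k).
have h1 : opensI W O `<=` W0 by move=> x Ox; exact/W0E.
have h2 : W0 `<=` opensI W O by move=> x /W0E.
have k2 : (2 <= k)%N by exact: leq_trans jk.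
have [|t [dt tE]] := @van_exact_extend X _ (aug_diff P)
    (@aug_diff_diff _ _ P) (fun p => @sky_flabby _ _ _) (@aug_sky0 _ _ P) O k W (fun x _ => @refined_van_exact k x k2 kn)
    j (res h1 s : sky (@aug_pi _ _ P j.+1) (opensI W O)) jk.
  by rewrite (smap_res (rl_diff P j)) ds res0.
exists t; split=> //.
have e1 := congr1 (res h2) tE; rewrite !res_res in e1.
apply: etrans (etrans e1 _); first exact: (@res_irr X (sky (@rl_pi _ _ P j))).
exact: (@res_id X (sky (@rl_pi _ _ P j)) W0 (subset_trans h2 h1)).
Qed.

(** A section that vanishes off the preimage of the skeleton is a class of degree 0 with support in
    it, and such classes are zero below degree [k]. *)
Lemma constant_restrict_inj k (W W0 : opens X) (h : W0 `<=` W) (s : constant_sheaf X W) :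
  (2 <= k)%N -> (k <= n)%N -> (forall x, oset W0 x <-> oset W x /\ Uk k (f x)) ->
  res h s = 0 -> s = 0.
Proof.
move=> k2 kn W0E s0; pose O := preim_compl cf (@refined_skeleton_closed k).
have h1 : opensI W O `<=` W0 by move=> x Ox; exact/W0E.
apply: (rl_aug_inj (r := P)).
have [|||t [_ tE]] := @van_exact_sec X _ (aug_diff P) (@aug_diff_diff _ _ P)
    (fun p => @sky_flabby _ _ _) (@aug_sky0 _ _ P) O k W (fun x _ => @refined_van_exact k x k2 kn)
    0 (rl_aug P W s).
- exact: leq_trans k2.
- rewrite /van_cond -smap_res (res_irr _ (subset_trans h1 h)) -(res_res h h1) s0.
  by rewrite res0 smap0.
- exact: rl_diff_aug.
by rewrite -tE.
Qed.

Definition push_const : sheaf Y := pushs cf (constant_sheaf X).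
Definition push_res j : sheaf Y := pushs cf (sky (@rl_pi _ _ P j)).
Definition push_diff j : sheaf_map (push_res j) (push_res j.+1) := pushs_map cf (rl_diff P j).
Definition push_aug : sheaf_map push_const (push_res 0) := pushs_map cf (rl_aug P).

Lemma branched_step k (q m : int) (J : complex (set_type (Uk k))) N0
    (a : sheaf_map (rests (@refined_open_open k) push_const) (J m)) :
  (2 <= k)%N -> (k <= n)%N -> m <= q -> q <= m + (k - 2)%N%:Z ->
  concentrated a -> (forall i, injective_sheaf (J i)) ->
  (forall i, i < N0 -> forall U (s : J i U), s = 0) ->
  exists a' : sheaf_map (rests (@refined_open_open k.+1) push_const)
    (trunc q (push (@set_incl_continuous _ _ _ (@refined_open_sub Y n FY B FB k)) J) m),
  concentrated a'.
Proof.
move=> k2 kn mq qk ca Jinj JN0.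
pose oUk := @refined_open_open k; pose oUk1 := @refined_open_open k.+1.
pose UU := @refined_open_sub Y n FY B FB k.
have WE (V : opens (set_type (Uk k.+1))) :
    forall x, oset (opreim cf (ext_open oUk (opreim (@set_incl_continuous _ _ _ UU) V))) x <->
      oset (opreim cf (ext_open oUk1 V)) x /\ Uk k (f x).
  move=> x; split=> [[z Vz zx]|[[z Vz zx] fx]].
    by split; [exists (set_incl UU z)|rewrite -zx; exact: set_valP].
  exists (exist _ (f x) (mem_set fx)) => //=.
  rewrite (_ : set_incl _ _ = z) //; exact: val_inj.
have ex0 y : exact_at push_aug (push_diff 0) y.
  by apply: push_exact => // x; exact: rl_exact0.
have ex j y : exact_at (push_diff j) (push_diff j.+1) y.
  by apply: push_exact => // x; exact: rl_exact.
unshelve refine (ex_intro _ _ (@step_concentrated _ _ _ (@set_incl_continuous _ _ _ UU)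
  (rests oUk push_const) (fun j => rests oUk (push_res j)) (fun j => rests_map oUk (push_diff j))
  (rests_map oUk push_aug) _ _ _ _ _ _ (rests oUk1 push_const) (fun j => rests oUk1 (push_res j))
  (fun j => rests_map oUk1 (push_diff j)) (rests_map oUk1 push_aug) _ _
  (incl_map oUk oUk1 UU push_const) (fun j => incl_map oUk oUk1 UU (push_res j)) _ _ _ k m q k2 _
  mq qk J a N0 ca Jinj JN0)).
- by move=> U s; exact: rl_diff_aug.
- by move=> j U s; exact: rl_diff_diff.
- by move=> U s; exact: rl_aug_inj.
- by move=> x; apply: rests_exact; exact: ex0.
- by move=> j x; apply: rests_exact; exact: ex.
- by move=> j; apply: rests_flabby; apply: pushs_flabby; exact: sky_flabby.
- by move=> x; apply: rests_exact; exact: ex0.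
- by move=> j x; apply: rests_exact; exact: ex.
- by move=> j V s; exact: incl_map_rests.
- by move=> V s; exact: incl_map_rests.
- by move=> V s; apply: (@constant_restrict_inj k _ _ _ s k2 kn (WE V)).
- by move=> j V p jk dp; exact: (@cocycle_extend k j _ _ _ p kn jk (WE V) dp).
Qed.

End Branched.

Definition zero_below (T : topologicalType) (N : int) (K : complex T) : Prop :=
  forall i, i < N -> forall U (s : K i U), s = 0.

(** * Injective models and direct sums *)

Section Models.
Variables (T : topologicalType).

(** Complexes bounded below have a resolution by products of skyscrapers, so the default value of
    [injective_model] is not reached. *)
Lemma injective_modelP (K : complex T) N : zero_below N K ->
  injective_resolution K (injective_model K).
Proof.
move=> KN; rewrite /injective_model; case: pselect => [h|[]]; first exact: svalP (cid h).
have [S _] := @sky_resolutionP T K N.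
by exists (sky_complex S); exact: (sky_complex_resolution KN S).
Qed.

Lemma dsums_injective (I J : sheaf T) : injective_sheaf I -> injective_sheaf J ->
  injective_sheaf (dsums I J).
Proof.
move=> injI injJ A B m g mi.
have [g1 g1E] := injI A B m (comp_map (fst_map I J) g) mi.
have [g2 g2E] := injJ A B m (comp_map (snd_map I J) g) mi.
exists (pair_map g1 g2) => U s; rewrite /= g1E g2E /=.
by case: (g U s).
Qed.

Lemma iso_quasi_iso (K L : complex T) (phi : cochain_map K L) :
  (forall i U, injective (phi i U)) -> (forall i U t, exists s, phi i U s = t) -> quasi_iso phi.
Proof.
move=> pinj psurj i x U Ux; split=> [s ds [V [h [t [Vx E]]]]|t dt].
  have [r rE] := psurj (i - 1) V t; exists V, h, r; split=> //.
  by apply: (pinj i V); rewrite smap_res E -rE cmap_diff.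
have [s sE] := psurj i U t; exists U, (@subset_refl _ U), s; split=> //.
  by apply: (pinj (i + 1) U); rewrite cmap_diff sE smap0; exact: dt.
exists U, (@subset_refl _ U), 0; split=> //.
by rewrite !res_id sE subrr smap0.
Qed.

Definition dsum_map (K K' L L' : complex T) (phi : cochain_map K K') (psi : cochain_map L L') :
  cochain_map (dsum K L) (dsum K' L').
Proof.
refine (@CochainMap T (dsum K L) (dsum K' L') (fun i => dsums_map (phi i) (psi i)) _).
by move=> i j U s; congr pair; rewrite /= cmap_diff.
Defined.

Lemma dsum_quasi_iso (K K' L L' : complex T) (phi : cochain_map K K') (psi : cochain_map L L') :
  quasi_iso phi -> quasi_iso psi -> quasi_iso (dsum_map phi psi).
Proof.
move=> qp qs i x U Ux; split=> [[s1 s2] ds [V [h [[t1 t2] [Vx E]]]]|[t1 t2] dt].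
  have [V1 [h1 [r1 [V1x E1]]]] : coboundary_at s1 x.
    apply: (qp i x U Ux).1; first exact: (congr1 fst ds).
    by exists V, h, t1; split=> //; exact: (congr1 fst E).
  have [V2 [h2 [r2 [V2x E2]]]] : coboundary_at s2 x.
    apply: (qs i x U Ux).1; first exact: (congr1 snd ds).
    by exists V, h, t2; split=> //; exact: (congr1 snd E).
  have k : opensI V1 V2 `<=` U by move=> z [/h1].
  exists (opensI V1 V2), k, (res opensIl r1, res opensIr r2); split=> //.
  by congr pair; rewrite /= smap_res -?E1 -?E2 res_res; exact: res_irr.
have [V1 [h1 [r1 [V1x d1 [W1 [k1 [u1 [W1x E1]]]]]]]] := (qp i x U Ux).2 t1 (congr1 fst dt).
have [V2 [h2 [r2 [V2x d2 [W2 [k2 [u2 [W2x E2]]]]]]]] := (qs i x U Ux).2 t2 (congr1 snd dt).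
have k : opensI V1 V2 `<=` U by move=> z [/h1].
exists (opensI V1 V2), k, (res opensIl r1, res opensIr r2); split=> //.
  by congr pair; rewrite /= smap_res ?d1 ?d2 res0.
pose W := opensI W1 W2.
have WV : W `<=` opensI V1 V2 by move=> z [/k1 ? /k2].
exists W, WV, (res opensIl u1, res opensIr u2); split=> //.
have sub (A A' : complex T) (chi : cochain_map A A') (t : A' i U) (V V' W' : opens T)
    (h : V `<=` U) (r : A i V) (l : W' `<=` V) (u : A' (i - 1) W')
    (k' : V' `<=` U) (o : V' `<=` V) (WV' : W `<=` V') (o' : W `<=` W') :
    res l (res h t - chi i V r) = cdiff A' (i - 1) i W' u ->
    res WV' (res k' t - chi i V' (res o r)) = cdiff A' (i - 1) i W (res o' u).
  move=> E; rewrite [RHS]smap_res -E !resB -!smap_res !res_res.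
  by congr (_ - chi i _ _); exact: res_irr.
by congr pair; [apply: (sub _ _ phi) E1|apply: (sub _ _ psi) E2].
Qed.

End Models.

Section PushSum.
Variables (S T : topologicalType) (g : S -> T) (cg : continuous g) (K L : complex S).

Definition push_dsum_map i :
  sheaf_map (push cg (dsum K L) i) (dsum (push cg K) (push cg L) i).
Proof.
by refine (@SheafMap T (push cg (dsum K L) i) (dsum (push cg K) (push cg L) i)
  (fun U s => s) _ _).
Defined.

Definition push_dsum : cochain_map (push cg (dsum K L)) (dsum (push cg K) (push cg L)).
Proof.
by refine (@CochainMap T (push cg (dsum K L)) (dsum (push cg K) (push cg L)) push_dsum_map _).
Defined.

Lemma push_dsum_quasi_iso : quasi_iso push_dsum.
Proof. by apply: iso_quasi_iso => [i U s t|i U t] //; exists t. Qed.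

Variable q : int.

Lemma trunc_dsum_cond i (U : opens T) (s : push cg (dsum K L) i U) : trunc_cond q s <->
  trunc_cond (K := push cg K) q (s.1 : push cg K i U) /\
  trunc_cond (K := push cg L) q (s.2 : push cg L i U).
Proof.
rewrite /trunc_cond; case: ifP => // _; case: ifP => _.
  split=> [e|[e1 e2]]; last by congr pair.
  by split; [exact: (congr1 fst e)|exact: (congr1 snd e)].
case: s => s1 s2 /=; split=> [e|[-> ->]] //.
by split; [exact: (congr1 fst e)|exact: (congr1 snd e)].
Qed.

Definition trunc_dsum_map i : sheaf_map (trunc q (push cg (dsum K L)) i)
  (dsum (trunc q (push cg K)) (trunc q (push cg L)) i).
Proof.
refine (@SheafMap T (trunc q (push cg (dsum K L)) i)
  (dsum (trunc q (push cg K)) (trunc q (push cg L)) i)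
  (fun U s => (submod_mk (lc_submod (trunc_cond_local (push cg K) q i) U)
                 ((trunc_dsum_cond (submod_val s)).1 (submod_valP s)).1,
               submod_mk (lc_submod (trunc_cond_local (push cg L) q i) U)
                 ((trunc_dsum_cond (submod_val s)).1 (submod_valP s)).2)) _ _).
- by move=> U c s t; congr pair; exact: submod_val_inj.
- by move=> U V h s; congr pair; exact: submod_val_inj.
Defined.

Definition trunc_dsum : cochain_map (trunc q (push cg (dsum K L)))
  (dsum (trunc q (push cg K)) (trunc q (push cg L))).
Proof.
refine (@CochainMap T (trunc q (push cg (dsum K L)))
  (dsum (trunc q (push cg K)) (trunc q (push cg L))) trunc_dsum_map _).
by move=> i j U s; congr pair; exact: submod_val_inj.
Defined.

Lemma trunc_dsum_quasi_iso : quasi_iso trunc_dsum.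
Proof.
apply: iso_quasi_iso => [i U s t E|i U [t1 t2]].
  apply: submod_val_inj; apply: injective_projections.
    exact: (congr1 (fun p => submod_val p.1) E).
  exact: (congr1 (fun p => submod_val p.2) E).
pose t : push cg (dsum K L) i U := (submod_val t1, submod_val t2).
have t0 : trunc_cond q t.
  by apply/trunc_dsum_cond; split; exact: submod_valP.
exists (submod_mk (lc_submod (trunc_cond_local (push cg (dsum K L)) q i) U) t0).
by congr pair; exact: submod_val_inj.
Qed.

End PushSum.

Section Shifted.
Variables (T : topologicalType) (F : sheaf T).

Definition conc_incl i (e : i = 0 :> int) : sheaf_map F (conc F i) :=
  @eq_rect_r int 0 (fun i => sheaf_map F (conc F i)) (id_map F) i e.

Definition conc_proj i (e : i = 0 :> int) : sheaf_map (conc F i) F :=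
  @eq_rect_r int 0 (fun i => sheaf_map (conc F i) F) (id_map F) i e.

Lemma conc_inclK i (e : i = 0 :> int) U s : conc_proj e U (conc_incl e U s) = s.
Proof. by move: (e); rewrite e => e0; rewrite (eq_axiomK e0). Qed.

Lemma conc_projK i (e : i = 0 :> int) U s : conc_incl e U (conc_proj e U s) = s.
Proof. by move: (e) s; rewrite e => e0 s; rewrite (eq_axiomK e0). Qed.

Lemma conc_out i U (s : conc F i U) : i <> 0 -> s = 0.
Proof. by move: s; rewrite /conc /=; case: eqP => // _ s _; exact: zero_sheaf_eq0. Qed.

Lemma shift_diff0 (n : int) i j U (s : cshift (conc F) n i U) :
  cdiff (cshift (conc F) n) i j U s = 0.
Proof. by rewrite /= scaler0. Qed.

Lemma shift_zero_below n : zero_below (- n) (cshift (conc F) n).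
Proof. by move=> i im U s; apply: conc_out; move: im; lia. Qed.

Variables (m n : int) (mn : m + n = 0) (K : complex T) (a : sheaf_map F (K m)).
Hypothesis ca : concentrated a.

Definition conc_cmap i : sheaf_map (conc F (i + n)) (K i) :=
  match m =P i with
  | ReflectT e => eq_rect m (fun i => sheaf_map (conc F (i + n)) (K i))
                    (comp_map a (conc_proj mn)) i e
  | ReflectF _ => zero_map _ _
  end.

Lemma conc_cmapE : conc_cmap m = comp_map a (conc_proj mn).
Proof. by rewrite /conc_cmap; case: eqP => // e; rewrite (eq_axiomK e). Qed.

Lemma conc_cmap_out i U s : i <> m -> conc_cmap i U s = 0.
Proof. by rewrite /conc_cmap; case: eqP => // e im; case: im. Qed.

Definition concentrated_map : cochain_map (cshift (conc F) n) K.
Proof.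
refine (@CochainMap T (cshift (conc F) n) K conc_cmap _).
move=> i j U s; rewrite shift_diff0 smap0.
have [im|im] := pselect (i = m); last by rewrite conc_cmap_out // smap0.
move: s; rewrite im => s.
have [->|jm] := eqVneq j (m + 1); last by rewrite diff_off.
rewrite conc_cmapE; exact: esym (cc_cocycle ca _).
Defined.

(** Through this map, two complexes concentrated at the same sheaf in the same degree become
    isomorphic in the derived category. *)
Lemma concentrated_quasi_iso : quasi_iso concentrated_map.
Proof.
move=> i x U Ux; have [->|im] := pselect (i = m); last first.
  have s0 V (s : cshift (conc F) n i V) : s = 0 by apply: conc_out; lia.
  split=> [s _ _|t dt].
    by rewrite (s0 U s); exists U, (@subset_refl _ U), 0; split; rewrite // res0 smap0.
  exists U, (@subset_refl _ U), 0; split=> //; first by rewrite /cocycle smap0.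
  by rewrite smap0 subr0; apply: coboundary_at_res => //; exact: (cc_exact ca).
rewrite /concentrated_map /= conc_cmapE; split=> [s _ b|t dt].
  have [V [h [Vx E]]] := cc_inj ca Ux b.
  exists V, h, 0; split=> //.
  by rewrite smap0 -[LHS](conc_projK mn) smap_res E smap0.
have [V [h [s [Vx b]]]] := cc_surj ca Ux dt.
exists V, h, (conc_incl mn V s); split=> //; first exact: shift_diff0.
by rewrite /= conc_inclK.
Qed.

End Shifted.

Section ConcentratedSum.
Variables (T : topologicalType) (F G H : sheaf T) (m n : int) (mn : m + n = 0).
Variable a : sheaf_map F (dsums G H).
Hypothesis a_inj : forall U s, a U s = 0 -> s = 0.
Hypothesis a_surj : forall U t, exists s, a U s = t.

Definition conc_sum_aug :
  sheaf_map F (dsum (cshift (conc G) n) (cshift (conc H) n) m) :=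
  comp_map (dsums_map (conc_incl G mn) (conc_incl H mn)) a.

Lemma conc_sum_concentrated : concentrated conc_sum_aug.
Proof.
have d0 i j U (s : dsum (cshift (conc G) n) (cshift (conc H) n) i U) :
    cdiff (dsum (cshift (conc G) n) (cshift (conc H) n)) i j U s = 0.
  by congr pair; exact: shift_diff0.
have out i U (s : dsum (cshift (conc G) n) (cshift (conc H) n) i U) : i <> m -> s = 0.
  by case: s => s1 s2 im; congr pair; apply: conc_out; lia.
split.
- by move=> U s; exact: d0.
- move=> x U s Ux [V [h [t [Vx]]]]; rewrite d0 => E; exists V, h; split=> //.
  apply: a_inj; rewrite smap_res; apply: injective_projections => /=.
    have := congr1 fst E; rewrite /= -smap_res => /(congr1 (conc_proj G mn V)).
    by rewrite conc_inclK smap0.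
  have := congr1 snd E; rewrite /= -smap_res => /(congr1 (conc_proj H mn V)).
  by rewrite conc_inclK smap0.
- move=> x U t Ux _; have [s sE] := a_surj (conc_proj G mn U t.1, conc_proj H mn U t.2).
  exists U, (@subset_refl _ U), s; split=> //.
  have -> : conc_sum_aug U s = t.
    by rewrite /conc_sum_aug /= sE /= !conc_projK; case: (t).
  exists U, (@subset_refl _ U), 0; split=> //.
  by rewrite !res_id subrr smap0.
- move=> i x U t im Ux _; rewrite (out _ _ t im).
  by exists U, (@subset_refl _ U), 0; rewrite res0 smap0.
Qed.

End ConcentratedSum.

Lemma concentrated_shift (T : topologicalType) (F : sheaf T) (m n : int) (mn : m + n = 0) :
  @concentrated T m F (cshift (conc F) n) (conc_incl F mn).
Proof.
have out i U (s : cshift (conc F) n i U) : i <> m -> s = 0.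
  by move=> im; apply: conc_out; lia.
split.
- by move=> U s; exact: shift_diff0.
- move=> x U s Ux [V [h [t [Vx]]]]; rewrite shift_diff0 => E; exists V, h; split=> //.
  by rewrite -[LHS](conc_inclK mn) smap_res E smap0.
- move=> x U t Ux _; exists U, (@subset_refl _ U), (conc_proj F mn U t); split=> //.
  by exists U, (@subset_refl _ U), 0; rewrite conc_projK !res_id subrr smap0.
- move=> i x U t im Ux _; rewrite (out _ _ t im).
  by exists U, (@subset_refl _ U), 0; rewrite res0 smap0.
Qed.

(** * Direct image under the finite map *)

Section FinitePush.
Variables (X Y : topologicalType) (f : X -> Y).
Hypotheses (cf : continuous f) (ff : finite_fibers f) (hX : hausdorff_space X).
Hypothesis fcl : forall C, closed C -> closed (f @` C).
Variables (F : sheaf X) (m : int) (K : complex X) (a : sheaf_map F (K m)).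
Hypothesis ca : concentrated a.

(** Encodes the surjectivity of [F] onto the cohomology in degree [m] as exactness at [K m], the
    form that [push_exact] transports. *)
Definition aug_boundary : sheaf_map (dsums F (K (m - 1))) (K m).
Proof.
refine (@SheafMap X (dsums F (K (m - 1))) (K m)
  (fun U s => a U s.1 + cdiff K (m - 1) m U s.2) _ _).
- by move=> U c s t; rewrite /= !smap_linear scalerDr addrACA.
- by move=> U V h s; rewrite /= !smap_res resD.
Defined.

Lemma push_concentrated : @concentrated Y m (pushs cf F) (push cf K) (pushs_map cf a).
Proof.
split.
- by move=> U s; exact: (cc_cocycle ca (s : F (opreim cf U))).
- move=> y U s Uy [V [h [t [Vy E]]]]; exists V, h; split=> //.
  apply: (@concentrated_inj _ _ _ _ _ ca (opreim cf V) _ t).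
  by rewrite -[RHS]E; exact: (@smap_res _ _ _ a).
- move=> y U t Uy dt.
  have ex x : exact_at aug_boundary (cdiff K m (m + 1)) x.
    move=> W s Wx ds; have [V [h [r [Vx [V' [k [u [V'x E]]]]]]]] := cc_surj ca Wx ds.
    exists V', (subset_trans k h), (res k r, u); split=> //=.
    by rewrite -E resB res_res smap_res addrC subrK.
  have [V [h [[s r] [Vy E]]]] := @push_exact _ _ f cf ff hX fcl _ _ _ _ _ ex y U t Uy dt.
  exists V, h, s; split=> //; exists V, (@subset_refl _ V), r; split=> //.
  by rewrite res_id E /= addrC addKr.
- move=> i y U t im Uy dt.
  have ex x : exact_at (cdiff K (i - 1) i) (cdiff K i (i + 1)) x.
    by move=> W s Wx ds; exact: (cc_exact ca im Wx ds).
  exact: (@push_exact _ _ f cf ff hX fcl _ _ _ _ _ ex y U t Uy dt).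
Qed.

End FinitePush.

Lemma derived_iso_zigzag (T : topologicalType) (A K L : complex T)
    (phi : cochain_map A K) (psi : cochain_map A L) :
  quasi_iso phi -> quasi_iso psi -> derived_iso K L.
Proof.
have cancel (B C D : complex T) (u : cochain_map B C) (v : cochain_map B D)
    (qu : quasi_iso u) (qv : quasi_iso v) :
    deq (Dcomp (Dcomp (Dmap u) (Dinv qv)) (Dcomp (Dmap v) (Dinv qu))) (Dmap (id_cmap C)).
  apply: Deq_trans (Deq_assoc _ _ _) _.
  apply: Deq_trans (Deq_comp (Deq_sym (Deq_assoc _ _ _)) (Deq_refl _)) _.
  apply: Deq_trans (Deq_comp (Deq_comp (Deq_refl _) (Deq_invl _)) (Deq_refl _)) _.
  apply: Deq_trans (Deq_comp (Deq_idr _) (Deq_refl _)) _.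
  exact: Deq_invr.
move=> qp qs.
by exists (Dcomp (Dmap psi) (Dinv qp)), (Dcomp (Dmap phi) (Dinv qs)).
Qed.

Section FullSubspace.
Variables (T : topologicalType) (A : set T) (oA : open A) (AT : forall y, A y).
Variables (F : sheaf T) (m : int) (K : complex (set_type A)) (a : sheaf_map (rests oA F) (K m)).
Hypothesis ca : concentrated a.

Definition full_aug : sheaf_map F (push (@set_val_continuous T A) K m).
Proof.
refine (@SheafMap T F (push (@set_val_continuous T A) K m)
  (fun V s => a (trace_open A V) (res (@ext_trace _ _ oA V) s : rests oA F (trace_open A V))) _ _).
- by move=> V c s t; rewrite res_linear; exact: (smap_linear a).
- move=> U V h s; apply: etrans (smap_res a _ _); congr (a _ _).
  by rewrite [RHS](@res_res _ F) [LHS](@res_res _ F); exact: (@res_irr _ F).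
Defined.

Lemma full_sub (V : opens T) (W : opens (set_type A)) : W `<=` trace_open A V -> ext_open oA W `<=` V.
Proof. by move=> WV _ [z /WV Vz <-]. Qed.

Lemma trace_ext_sub (W : opens (set_type A)) : trace_open A (ext_open oA W) `<=` W.
Proof. by move=> z Wz; exact/(in_ext oA W z). Qed.

Lemma full_coboundary i (U : opens T) (s : push (@set_val_continuous T A) K i U) (z : set_type A) :
  coboundary_at (s : K i (trace_open A U)) z ->
  coboundary_at s (set_val z).
Proof.
move=> [V [h [t [Vz E]]]].
exists (ext_open oA V), (full_sub h), (res (@trace_ext_sub V) t : K (i - 1) (trace_open A (ext_open oA V))).
split; first exact/in_ext.
apply: etrans (etrans (congr1 (res (@trace_ext_sub V)) E) _); last exact: esym (smap_res _ _ _).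
by rewrite [RHS](@res_res _ (K i)); exact: (@res_irr _ (K i)).
Qed.

Lemma full_coboundary_inv i (U : opens T) (s : push (@set_val_continuous T A) K i U) z :
  coboundary_at s (set_val z) -> coboundary_at (s : K i (trace_open A U)) z.
Proof.
move=> [V [h [t [Vz E]]]].
by exists (trace_open A V), (fun x Vx => h _ Vx), t.
Qed.

Lemma full_concentrated : concentrated full_aug.
Proof.
have lift y : exists z : set_type A, set_val z = y.
  by exists (exist _ y (mem_set (AT y))).
have extI (V : opens T) : V `<=` ext_open oA (trace_open A V).
  by move=> y Vy; have [z zy] := lift y; exists z => //; rewrite /= zy.
split.
- by move=> U s; exact: (cc_cocycle ca).
- move=> x U s Ux b; have [z zx] := lift x.
  subst x; have [W [k [Wz E]]] := cc_inj ca (Ux : oset (trace_open A U) z) (full_coboundary_inv b).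
  exists (ext_open oA W), (full_sub k); split; first exact/in_ext.
  by move: E; rewrite [X in X = _ -> _](@res_res _ F) => <-; exact: (@res_irr _ F).
- move=> x U t Ux dt; have [z zx] := lift x; subst x.
  have [V [h [s [Vz b]]]] := cc_surj ca (Ux : oset (trace_open A U) z) dt.
  pose W := ext_open oA V; exists W, (full_sub h), s; split; first exact/in_ext.
  apply: full_coboundary.
  have VW : trace_open A W `<=` V by exact: trace_ext_sub.
  have Wz : oset (trace_open A W) z by exact/(in_ext oA V z).
  have := @coboundary_at_res _ K m _ _ VW _ z Wz b.
  congr (coboundary_at _ z); rewrite resB; congr (_ - _).
    by rewrite res_res; exact: (@res_irr _ (K m)).
  by rewrite -smap_res; congr (a _ _); exact: (@res_irr _ F).
- move=> i x U t im Ux dt; have [z zx] := lift x; subst x.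
  by apply: full_coboundary; exact: (cc_exact ca im (Ux : oset (trace_open A U) z) dt).
Qed.

End FullSubspace.

(** * The sum of the two Deligne complexes *)

Section DeligneSum.
Variables (R : realType) (n : nat) (X Y : topologicalType) (f : X -> Y).
Hypotheses (cf : continuous f) (ff : finite_fibers f).
Hypothesis Xeucl : forall x : X, locally_euclidean_at R n x.
Hypothesis hX : hausdorff_space X.
Hypothesis fcl : forall C, closed C -> closed (f @` C).
Variables (B : set Y) (cB : closed B).
Variables (FY : nat -> set Y) (FB : nat -> set (set_type B)).
Hypotheses (sY : stratification R n FY) (sB : stratification R (n - 2) FB).
Hypothesis n2 : (2 <= n)%N.
Variable p : nat -> nat.
Hypothesis pk : forall k, (2 <= k)%N -> (p k <= k - 2)%N.

Local Notation Uk := (refined_open n FY FB).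
Local Notation UU := (@refined_open_sub Y n FY B FB).
Local Notation oU := (@refined_open_open R n Y B cB FY FB sY sB).
Local Notation step M j := (@deligne_step Y n p Uk UU (cshift (conc M) n%:Z) j).

Lemma deligne_zero_below (M : sheaf (set_type (Uk 2))) j : exists N, zero_below N (step M j).
Proof.
elim: j => [|j [N KN]]; first by exists (- n%:Z); exact: shift_zero_below.
have [_ [N' JN] _] := injective_modelP KN; exists N' => i iN V s.
by apply: submod_val_inj; exact: JN.
Qed.

Variables (M1 M2 : sheaf (set_type (Uk 2))).
Variable a0 : sheaf_map (rests (oU 2) (push_const cf)) (dsums M1 M2).
Hypothesis a0_inj : forall U s, a0 U s = 0 -> s = 0.
Hypothesis a0_surj : forall U t, exists s, a0 U s = t.

(** The summands are carried together because only their sum is compared with the direct image of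
    the constant sheaf. The sum of the injective models serves as an injective complex for the sum,
    and truncated direct images commute with sums. *)
Lemma deligne_concentrated j : (j <= n.-1)%N ->
  exists a : sheaf_map (rests (oU j.+2) (push_const cf)) (dsum (step M1 j) (step M2 j) (- n%:Z)),
  concentrated a.
Proof.
elim: j => [|j IHj] jn.
  have mn : - n%:Z + n%:Z = 0 by rewrite addNr.
  by exists (conc_sum_aug mn a0); exact: conc_sum_concentrated.
have [a ca] := IHj (ltnW jn).
have [N1 K1] := deligne_zero_below M1 j; have [N2 K2] := deligne_zero_below M2 j.
have [I1 [N1' J1] [phi1 q1]] := injective_modelP K1.
have [I2 [N2' J2] [phi2 q2]] := injective_modelP K2.
have cJ := concentrated_comp ca (dsum_quasi_iso q1 q2).
have [P _] := resolutionP (constant_sheaf X).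
have [||||i|i iN V [s1 s2]|a' ca'] := @branched_step R n X Y f cf ff Xeucl hX fcl B cB FY FB sY sB P
  j.+2 ((p j.+2)%:Z - n%:Z) (- n%:Z) (dsum (injective_model (step M1 j)) (injective_model (step M2 j)))
  (Num.min N1' N2') _ _ _ _ _ cJ.
- by [].
- by move: jn; lia.
- by lia.
- have := pk (isT : 2 <= j.+2)%N; lia.
- by apply: dsums_injective; [exact: I1|exact: I2].
- by move: iN; rewrite lt_min => /andP[i1 i2]; congr pair; [exact: J1|exact: J2].
exists (comp_map (trunc_dsum (@set_incl_continuous _ _ _ (@refined_open_sub Y n FY B FB j.+2)) (injective_model (step M1 j))
  (injective_model (step M2 j)) ((p j.+2)%:Z - n%:Z) (- n%:Z)) a').
exact: (concentrated_comp ca' (trunc_dsum_quasi_iso _ _ _ _)).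
Qed.

Lemma IC_concentrated :
  exists a : sheaf_map (push_const cf) (dsum (IC n FY FB p M1) (IC n FY FB p M2) (- n%:Z)),
  concentrated a.
Proof.
have [a ca] := deligne_concentrated (leqnn n.-1).
have full y : Uk n.-1.+2 y.
  by rewrite /refined_open (refined_skeleton_top FY FB) //; move: n2; lia.
have cT := full_concentrated full ca.
exists (comp_map (push_dsum (@set_val_continuous _ _) (step M1 n.-1) (step M2 n.-1) (- n%:Z))
  (full_aug a)).
exact: (concentrated_comp cT (push_dsum_quasi_iso _ _ _)).
Qed.

End DeligneSum.

(** * The covering away from the branch locus *)

Section ConstantValues.
Variable T : topologicalType.
Implicit Types U V : opens T.

Lemma constant_val_in U (s : constant_sheaf T U) x (Ux : oset U x) :
  constant_val s x = csec_val s (point_in Ux).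
Proof.
rewrite /constant_val; case: pselect => // Ux'.
by congr (submod_val s _); exact: val_inj.
Qed.

Lemma constant_val_res U V (h : V `<=` U) (s : constant_sheaf T U) x : oset V x ->
  constant_val (res h s) x = constant_val s x.
Proof.
move=> Vx; rewrite (constant_val_in _ Vx) csec_res -constant_val_in; congr constant_val.
Qed.

Lemma constant_val_eq U (s t : constant_sheaf T U) :
  (forall x, oset U x -> constant_val s x = constant_val t x) -> s = t.
Proof. by move=> st; apply: csec_eq => x Ux; rewrite -!constant_val_in st. Qed.

Lemma constant_valL U a (s t : constant_sheaf T U) x :
  constant_val (a *: s + t) x = a * constant_val s x + constant_val t x.
Proof. by rewrite /constant_val; case: pselect => // _; rewrite mulr0 addr0. Qed.

Lemma constant_val0 U x : constant_val (0 : constant_sheaf T U) x = 0.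
Proof. by rewrite /constant_val; case: pselect. Qed.

Lemma constant_val_local U (s : constant_sheaf T U) x : oset U x ->
  exists V : opens T, [/\ V `<=` U, oset V x &
    forall y, oset V y -> constant_val s y = constant_val s x].
Proof.
move=> Ux; have [V [h [Vx sV]]] := csec_local s Ux; exists V; split=> // y Vy.
by rewrite (constant_val_in _ (h y Vy)) sV -constant_val_in.
Qed.

Definition local_on U (phi : T -> rat) : Prop := forall x, oset U x ->
  exists2 V : opens T, oset V x & forall y, oset V y -> oset U y -> phi y = phi x.

Lemma constant_sec_subproof U phi : local_on U phi ->
  @locally_constant T U ((fun z => phi (set_val z)) : set_type U -> rat^o).
Proof.
move=> lphi z; have [V Vz phiV] := lphi _ (set_mem (valP z)).
have oV : open (set_val @^-1` V : set (set_type U)) by exists V => //; exact: oset_open.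
have Nz : nbhs z (set_val @^-1` V) by exact: open_nbhs_nbhs.
apply: filterS Nz => y Vy; apply: phiV => //; exact: (set_mem (valP y)).
Qed.

Definition constant_sec U phi (lphi : local_on U phi) : constant_sheaf T U :=
  submod_mk (lc_submod (locally_constant_local T) U) (constant_sec_subproof lphi).

Lemma constant_secE U phi (lphi : local_on U phi) x : oset U x ->
  constant_val (constant_sec lphi) x = phi x.
Proof. by move=> Ux; rewrite constant_val_in. Qed.

End ConstantValues.

Definition extend0 (T : Type) (A : set T) (phi : set_type A -> rat) (x : T) : rat :=
  if pselect (A x) is left Ax then phi (exist _ x (mem_set Ax)) else 0.

Lemma extend0E (T : Type) (A : set T) (phi : set_type A -> rat) z : extend0 phi (set_val z) = phi z.
Proof.
rewrite /extend0; case: pselect => [Az|[]]; last exact: set_valP.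
by congr phi; exact: val_inj.
Qed.

Lemma sheaf_map_inverse (T : topologicalType) (F G : sheaf T) (b : sheaf_map F G) :
  (forall U s, b U s = 0 -> s = 0) -> (forall U t, exists s, b U s = t) ->
  exists a : sheaf_map G F, (forall U s, a U (b U s) = s) /\ forall U t, b U (a U t) = t.
Proof.
move=> binj bsurj; pose a U t := sval (cid (bsurj U t)).
have bK U t : b U (a U t) = t by exact: svalP (cid (bsurj U t)).
have bI U s s' : b U s = b U s' -> s = s'.
  by move=> e; apply/eqP; rewrite -subr_eq0; apply/eqP/binj; rewrite smapB e subrr.
have aL U : linear (a U) by move=> c t t'; apply: bI; rewrite smap_linear !bK.
have aR (U V : opens T) (h : V `<=` U) s : a V (res h s) = res h (a U s).
  by apply: bI; rewrite smap_res !bK.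
exists (SheafMap aL aR); split=> [U s|U t]; last exact: bK.
by apply: bI; exact: bK.
Qed.

Section FiberSums.
Variables (X Y : topologicalType) (f : X -> Y).
Hypothesis ff : finite_fibers f.

(** Each point of the fibre over [y0] carries a local section of [f] along its sheet; on a common
    neighbourhood these sections match every fibre with that of [y0], and [g] keeps its values along
    them. *)
Lemma fiber_sum_local (g : X -> rat) y0 : evenly_covered f y0 ->
  (forall x, f x = y0 -> exists2 W : opens X, oset W x & forall x', oset W x' -> g x' = g x) ->
  exists2 N : opens Y, oset N y0 & forall y, oset N y ->
    \sum_(x \in f @^-1` [set y]) g x = \sum_(x \in f @^-1` [set y0]) g x.
Proof.
move=> [V [oV Vy0] [I [W [oW dis cov sheet]]]] gloc.
have winj i x x' : W i x -> W i x' -> f x = f x' -> x = x'.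
  move=> Wx Wx' e; have [h [_ [k [_ hK _]]] hE] := sheet i.
  have hI : injective h := can_inj hK.
  have E : h (exist _ x (mem_set Wx)) = h (exist _ x' (mem_set Wx')).
    apply: val_inj; change (set_val (h (exist _ x (mem_set Wx))) =
      set_val (h (exist _ x' (mem_set Wx')))).
    by rewrite !hE.
  exact: (congr1 set_val (hI _ _ E)).
have sec i y : V y -> exists2 x, W i x & f x = y.
  move=> Vy; have [h [_ [k [_ _ kK]]] hE] := sheet i.
  exists (set_val (k (exist _ y (mem_set Vy)))); first exact: (set_mem (valP _)).
  by rewrite -hE kK.
(* A local section of [f] through [x], made total, and a neighbourhood where it works; both are
   arbitrary when [x] is not in the fibre. *)
have ex x : exists (kN : (Y -> X) * opens Y), f x = y0 ->
    oset kN.2 y0 /\ forall y, oset kN.2 y ->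
      [/\ f (kN.1 y) = y, g (kN.1 y) = g x & exists i, W i x /\ W i (kN.1 y)].
  have [xy|xy] := pselect (f x = y0); last by exists (fun=> x, opensT Y).
  have [i _ Wx] : (\bigcup_i W i) x by rewrite -cov /= xy.
  have [D Dx gD] := gloc x xy; have [h [_ [k [ck hK kK]]] hE] := sheet i.
  have oD : open [set v : set_type V | oset D (set_val (k v))].
    have /continuousP : continuous (set_val \o k).
      by move=> v; apply: continuous_comp; [exact: ck|exact: initial_continuous].
    by apply; exact: oset_open.
  have [O OD] := opens_subspace (Opens oD).
  pose k' y := if pselect (V y) is left Vy then set_val (k (exist _ y (mem_set Vy))) else x.
  have k'E v : k' (set_val v) = set_val (k v).
    rewrite /k'; case: pselect => [Vv|[]]; last exact: set_valP.
    by congr (set_val (k _)); exact: val_inj.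
  exists (k', opensI (Opens oV) O) => _; split=> [|y [/= Vy Oy]].
    split=> //; pose v : set_type V := exist _ y0 (mem_set Vy0).
    apply/(OD v) => /=; rewrite (winj i (set_val (k v)) x) //.
      exact: (set_mem (valP (k v))).
    by rewrite -hE kK xy.
  pose v : set_type V := exist _ y (mem_set Vy); rewrite -[y]/(set_val v) k'E.
  split; first by rewrite -hE kK.
    by apply: gD; exact/(OD v).
  by exists i; split=> //; exact: (set_mem (valP (k v))).
have [kN kNP] := choice ex.
have oN : open (V `&` \bigcap_(x in f @^-1` [set y0]) (kN x).2).
  by apply: openI => //; apply: finite_open_bigcap => // x _; exact: oset_open.
exists (Opens oN) => [|y [Vy Ny]].
  by split=> // x /kNP[].
rewrite (reindex_fsbig (fun x => (kN x).1 y) (f @^-1` [set y0])).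
  by apply: eq_fsbigr => x /set_mem xy; have [_ /(_ y (Ny x xy))[]] := kNP x xy.
split=> [x xy|x x' /set_mem xy /set_mem xy' e|x' x'y].
- by have [_ /(_ y (Ny x xy))[]] := kNP x xy.
- have [_ /(_ y (Ny x xy))[_ _ [i [Wx Wk]]]] := kNP x xy.
  have [_ /(_ y (Ny x' xy'))[_ _ [i' [Wx' Wk']]]] := kNP x' xy'.
  have ii : i = i' by apply: dis; exists ((kN x).1 y); split=> //; rewrite e.
  by subst i'; apply: (winj i) => //; rewrite xy xy'.
have [j _ Wx'] : (\bigcup_i W i) x' by rewrite -cov /= x'y.
have [x Wx xy] := sec j y0 Vy0; exists x => //.
have [_ /(_ y (Ny x xy))[fk _ [i [Wix Wik]]]] := kNP x xy.
have ij : i = j by apply: dis; exists x.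
by subst j; apply: (winj i) => //; rewrite fk x'y.
Qed.

End FiberSums.

Section CoveringPart.
Variables (X Y : topologicalType) (f : X -> Y).
Hypotheses (cf : continuous f) (ff : finite_fibers f) (fsurj : forall y, exists x, f x = y).
Variables (A : set Y) (oA : open A).
Hypothesis Acov : forall y, A y -> evenly_covered f y.

Local Notation cp := (@restrict_preimage_continuous X Y f cf A).
Local Notation fp := (@restrict_preimage_fibers X Y f ff A).
Local Notation E := (set_type (f @^-1` A)).
Local Notation p := (@restrict_preimage X Y f A).
Local Notation Q := (constant_sheaf (set_type A)).
Local Notation L := (trace_kernel cp fp).
Local Notation G := (rests oA (pushs cf (constant_sheaf X))).

Definition trace_val (V : opens (set_type A)) (l : L V) : E -> rat :=
  constant_val (U := opreim cp V) (submod_val l).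

Lemma trace_valL V a (l l' : L V) e :
  trace_val (a *: l + l') e = a * trace_val l e + trace_val l' e.
Proof. exact: (@constant_valL _ (opreim cp V)). Qed.

Lemma preim_ext (V : opens (set_type A)) x : oset (opreim cf (ext_open oA V)) x ->
  exists e : E, set_val e = x /\ oset V (p e).
Proof.
move=> [z Vz zx]; have Ax : A (f x) by rewrite -zx; exact: set_valP.
exists (exist _ x (mem_set Ax)); split=> //.
by rewrite (_ : p _ = z) //; apply: val_inj; rewrite /= -zx.
Qed.

Lemma preim_extE (V : opens (set_type A)) (e : E) :
  oset V (p e) -> oset (opreim cf (ext_open oA V)) (set_val e).
Proof. by move=> Ve; exists (p e). Qed.

Definition cover_val (V : opens (set_type A)) (s : dsums Q L V) (x : X) : rat :=
  extend0 (constant_val s.1) (f x) + extend0 (trace_val s.2) x.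

Lemma cover_valE V (s : dsums Q L V) (e : E) :
  cover_val s (set_val e) = constant_val s.1 (p e) + trace_val s.2 e.
Proof. by rewrite /cover_val (extend0E (trace_val s.2)) (extend0E _ (p e)). Qed.

Lemma cover_val_local V (s : dsums Q L V) : local_on (opreim cf (ext_open oA V)) (cover_val s).
Proof.
move=> x /preim_ext[e [<- Ve]].
have [V1 [_ V1e q1]] := constant_val_local s.1 Ve.
have [V2 [_ V2e l2]] := @constant_val_local _ (opreim cp V) (submod_val s.2) e Ve.
have [O OV] := opens_subspace V2.
exists (opensI (opreim cf (ext_open oA V1)) O).
  by split; [exact: preim_extE|exact/OV].
move=> y [/preim_ext[e' [<- V1e']] Oe'] _; rewrite !cover_valE q1 //.
by congr (_ + _); apply: l2; exact/OV.
Qed.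

Definition cover_map : sheaf_map (dsums Q L) G.
Proof.
refine (@SheafMap _ (dsums Q L) G
  (fun V s => constant_sec (@cover_val_local V s) : G V) _ _).
- move=> V c s t; apply: constant_val_eq => x Ux.
  have [e [ex Ve]] := preim_ext Ux; subst x.
  rewrite [RHS]constant_valL !constant_secE // !cover_valE.
  rewrite [constant_val _ _]constant_valL [trace_val _ _]trace_valL; ring.
- move=> U V h s; apply: constant_val_eq => x Vx.
  have [e [ex Ve]] := preim_ext Vx; subst x.
  rewrite [RHS]constant_val_res // !constant_secE //; last by apply: preim_extE; exact: h.
  rewrite !cover_valE [constant_val _ _]constant_val_res //; congr (_ + _).
  exact: (@constant_val_res _ (opreim cp U) (opreim cp V)).
Defined.

Lemma fiber_reindex (F : X -> rat) (z : set_type A) :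
  \sum_(x \in f @^-1` [set set_val z]) F x = \sum_(e \in p @^-1` [set z]) F (set_val e).
Proof.
apply: (reindex_fsbig (fun e : E => set_val e)); split=> [e /= <- //|e e' _ _ /val_inj //|x /= xz].
have Ax : A (f x) by rewrite xz; exact: set_valP.
by exists (exist _ x (mem_set Ax)) => //=; apply: val_inj; rewrite /= xz.
Qed.

Lemma sheet_count_neq0 y : \sum_(x \in f @^-1` [set y]) (1 : rat) != 0.
Proof.
have [x xy] := fsurj y; apply/eqP => s0.
have := @pfsumr_eq0 _ _ (f @^-1` [set y]) (fun=> 1 : rat) (ff y) (fun _ _ => ler01) s0 x xy.
by move/eqP; rewrite oner_eq0.
Qed.

(** Summing over a fibre kills the trace-zero part and multiplies the other by the number of sheets,
    which is not zero. *)
Lemma cover_map_inj V s : cover_map V s = 0 -> s = 0.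
Proof.
move=> s0; have val0 e : oset V (p e) -> constant_val s.1 (p e) + trace_val s.2 e = 0.
  move=> Ve; rewrite -cover_valE -(constant_secE (@cover_val_local V s)); last exact: preim_extE.
  by rewrite -[RHS](constant_val0 (opreim cf (ext_open oA V)) (set_val e)); congr constant_val.
have q0 z : oset V z -> constant_val s.1 z = 0.
  move=> Vz; have tr0 := submod_valP s.2 z Vz.
  have : \sum_(e \in p @^-1` [set z]) (constant_val s.1 z * 1 + trace_val s.2 e) = 0.
    by apply: fsbig1 => e /= ez; rewrite mulr1 -ez val0 // ez.
  rewrite fsbig_split /=; last exact: fp.
  rewrite [X in _ + X]tr0 addr0 -mulr_fsumr -(fiber_reindex (fun=> 1)) => /eqP.
  by rewrite mulf_eq0 (negbTE (sheet_count_neq0 _)) orbF => /eqP.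
case: s s0 val0 q0 => q l _ val0 q0; congr pair.
  by apply: constant_val_eq => z Vz; rewrite q0 // constant_val0.
apply: submod_val_inj; apply: (@constant_val_eq _ (opreim cp V)) => e Ve.
have := val0 e Ve; rewrite /= q0 // add0r => l0.
by rewrite [RHS](constant_val0 (opreim cp V)).
Qed.

(** The component in [Q] is the average over the fibre; what remains has trace zero. *)
Lemma cover_map_surj V s : exists t, cover_map V t = s.
Proof.
have gloc z x : oset V z -> f x = set_val z ->
    exists2 W : opens X, oset W x & forall x', oset W x' -> constant_val s x' = constant_val s x.
  move=> Vz xz; have [|W [_ Wx sW]] := @constant_val_local _ (opreim cf (ext_open oA V)) s x.
    by exists z.
  by exists W.
pose S (y : Y) : rat := \sum_(x \in f @^-1` [set y]) constant_val s x.
pose c (y : Y) : rat := \sum_(x \in f @^-1` [set y]) (1 : rat).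
have avg_loc z : oset V z -> exists2 N : opens Y, oset N (set_val z) &
    forall y, oset N y -> S y / c y = S (set_val z) / c (set_val z).
  move=> Vz; have zc := Acov (set_valP z).
  have [N1 N1z S1] := @fiber_sum_local X Y f ff (constant_val s) _ zc (fun x => gloc z x Vz).
  have [|N2 N2z c2] := @fiber_sum_local X Y f ff (fun=> 1) _ zc.
    by move=> x _; exists (opensT X).
  exists (opensI N1 N2); first by split.
  by move=> y [N1y N2y]; rewrite /S /c S1 // c2.
have q_loc : local_on V (fun z => S (set_val z) / c (set_val z)).
  move=> z Vz; have [N Nz NS] := avg_loc z Vz.
  by exists (trace_open A N) => // z' Nz' _; exact: NS.
have l_loc : local_on (opreim cp V)
    (fun e => constant_val s (set_val e) - S (set_val (p e)) / c (set_val (p e))).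
  move=> e Ve; have [N Ne NS] := avg_loc _ Ve; have [W We sW] := gloc (p e) (set_val e) Ve erefl.
  exists (opensI (trace_open _ W) (opreim cp (trace_open A N))) => [|e' [We' Ne'] _]; first by split.
  by rewrite sW // NS.
have l0 : trace_zero (constant_sec l_loc : pushs cp (constant_sheaf E) V).
  move=> z Vz; rewrite (eq_fsbigr (fun e => constant_val s (set_val e) +
      - (S (set_val z) / c (set_val z)) * 1)); last first.
    by move=> e /set_mem ez; rewrite constant_secE /= ?ez // mulr1.
  rewrite -(fiber_reindex (fun x => constant_val s x + - (S (set_val z) / c (set_val z)) * 1)).
  rewrite fsbig_split // -mulr_fsumr -/(S (set_val z)) -/(c (set_val z)) mulNr divfK.
    exact: subrr.
  exact: sheet_count_neq0.
exists (constant_sec q_loc, submod_mk (lc_submod (trace_zero_local cp fp) V) l0).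
apply: constant_val_eq => x Ux; rewrite constant_secE //.
have [e [ex Ve]] := preim_ext Ux; subst x; rewrite cover_valE constant_secE //.
by rewrite /trace_val /= (constant_secE l_loc) // addrC subrK.
Qed.

Lemma cover_split : exists a : sheaf_map G (dsums Q L),
  (forall U s, a U s = 0 -> s = 0) /\ forall U t, exists s, a U s = t.
Proof.
have [a [aK bK]] := sheaf_map_inverse cover_map_inj cover_map_surj.
exists a; split=> [U s s0|U t]; last by exists (cover_map U t).
by rewrite -[s]bK s0 smap0.
Qed.

End CoveringPart.

(** * Constructibility *)

Definition stalk_basis (T : topologicalType) (F : sheaf T) (V : opens T) (r : nat)
    (s : 'I_r -> F V) (y : T) : Prop :=
  (forall c : 'I_r -> rat, (exists (W : opens T) (h : W `<=` V), oset W y /\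
     res h (\sum_j c j *: s j) = 0) -> forall j, c j = 0) /\
  (forall (W : opens T) (WV : W `<=` V) (z : F W), oset W y ->
     exists (c : 'I_r -> rat) (W' : opens T) (k : W' `<=` W),
       oset W' y /\ res k (z - res WV (\sum_j c j *: s j)) = 0).

Definition constructible_sheaf (T : topologicalType) (F : sheaf T) : Prop :=
  exists (N : nat) (Z : nat -> set T),
  [/\ forall j, closed (Z j), forall j, Z j `<=` Z j.+1, Z N = setT &
      forall j x, strata Z j x -> exists (V : opens T) (r : nat) (s : 'I_r -> F V),
        oset V x /\ forall y, oset V y -> strata Z j y -> stalk_basis s y].

Lemma smap_sum (T : topologicalType) (F G : sheaf T) (u : sheaf_map F G) U r
    (c : 'I_r -> rat) (s : 'I_r -> F U) :
  u U (\sum_j c j *: s j) = \sum_j c j *: u U (s j).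
Proof.
rewrite (big_morph (u U) (smapD u (U := U)) (smap0 u U)).
by apply: eq_bigr => j _; exact: smapZ.
Qed.

Lemma concentrated_constructible (T : topologicalType) m (F : sheaf T) (K : complex T)
    (a : sheaf_map F (K m)) :
  concentrated a -> constructible_sheaf F -> bounded_constructible K.
Proof.
(* One number has to bound both the degree [m] and the length of the filtration. *)
move=> ca [N [Z [cZ ZS ZN loc]]]; exists (N + `|m|%N)%N, Z; split=> //.
- by move=> i iN U s x ds Ux; apply: (cc_exact ca) => // im; move: iN; rewrite im; lia.
- by apply/seteqP; split=> // x _; apply: (skeleton_mono ZS (leq_addr _ _)); rewrite ZN.
move=> i j; have [->|im] := pselect (i = m); last first.
  move=> x xj; exists (opensT T), 0%N, (fun=> 0); split=> // [[]//|y _ yj].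
  split=> [c _ []//|W WV z Wy dz]; exists (fun=> 0).
  by rewrite big_ord0 res0 subr0; exact: (cc_exact ca).
move=> x xj; have [V [r [s [Vx sb]]]] := loc j x xj.
exists V, r, (fun k => a V (s k)); split=> // [k|y Vy yj]; first exact: (cc_cocycle ca).
have [free span] := sb y Vy yj; split=> [c|W WV z Wy dz].
  by rewrite -smap_sum => /(cc_inj ca Vy); exact: free.
have [W1 [h [s' [W1y b]]]] := cc_surj ca Wy dz.
have [c [W2 [k [W2y E]]]] := span W1 (subset_trans h WV) s' W1y; exists c.
apply: (@coboundary_at_res_inv _ _ _ _ _ (subset_trans k h)).
have -> : res (subset_trans k h) (z - res WV (\sum_j0 c j0 *: a V (s j0))) = res k (res h z - a W1 s').
  rewrite -smap_sum !resB !res_res; congr (_ - _).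
  rewrite -!smap_res; congr (a _ _); apply/esym/eqP; rewrite -subr_eq0; apply/eqP.
  by rewrite -[RHS]E resB res_res; congr (_ - _); exact: res_irr.
exact: coboundary_at_res.
Qed.

(** * Stratification by the cardinality of the fibres *)

Section FiberCardinality.
Variables (X Y : topologicalType) (f : X -> Y).
Hypothesis ff : finite_fibers f.

Definition fiber_card (y : Y) : nat := size (finmap.enum_fset (fset_set (f @^-1` [set y]))).

Lemma mem_fiber y x : (x \in finmap.enum_fset (fset_set (f @^-1` [set y]))) = (f x == y :> Y).
Proof.
have e : (x \in finmap.enum_fset (fset_set (f @^-1` [set y]))) = (x \in f @^-1` [set y]).
  exact: (in_fset_set (ff y) x).
rewrite e; apply/idP/eqP => [/set_mem //|xy]; exact: mem_set.
Qed.

Lemma fiber_card_ge y k (g : 'I_k -> X) : injective g -> (forall i, f (g i) = y) ->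
  (k <= fiber_card y)%N.
Proof.
move=> gi gy; rewrite -[k]size_enum_ord -(size_map g); apply: uniq_leq_size.
  by rewrite map_inj_uniq // enum_uniq.
by move=> _ /mapP[i _ ->]; rewrite mem_fiber gy.
Qed.

Lemma fiber_points y : exists g : 'I_(fiber_card y) -> X,
  [/\ injective g, forall i, f (g i) = y & forall x, f x = y -> exists i, x = g i].
Proof.
exists (tnth (in_tuple (finmap.enum_fset (fset_set (f @^-1` [set y]))))); split.
- apply/tuple_uniqP; exact: finmap.fset_uniq.
- by move=> i; apply/eqP; rewrite -mem_fiber; exact: mem_tnth.
by move=> x xy; apply/tnthP; rewrite mem_fiber xy.
Qed.

Lemma fiber_cover y k (g : 'I_k -> X) : injective g -> (forall i, f (g i) = y) ->
  (fiber_card y <= k)%N -> forall x, f x = y -> exists i, x = g i.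
Proof.
move=> gi gy yk x xy.
have gu : uniq [seq g i | i <- enum 'I_k] by rewrite map_inj_uniq // enum_uniq.
have [||_ E] := uniq_min_size gu (s2 := finmap.enum_fset (fset_set (f @^-1` [set y]))).
- by move=> _ /mapP[i _ ->]; rewrite mem_fiber gy.
- by rewrite size_map size_enum_ord.
have : x \in [seq g i | i <- enum 'I_k] by rewrite E mem_fiber xy.
by case/mapP => i _ ->; exists i.
Qed.

Lemma fiber_card_sum y : \sum_(x \in f @^-1` [set y]) (1 : rat) = (fiber_card y)%:R.
Proof. by rewrite fsbig_finite // big_const_seq count_predT iter_addr_0. Qed.

Hypotheses (cf : continuous f) (hX : hausdorff_space X).
Hypothesis fcl : forall C, closed C -> closed (f @` C).
Hypothesis fop : forall U, open U -> open (f @` U).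

Lemma constant_val_sum (U : opens X) r (c : 'I_r -> rat) (s : 'I_r -> constant_sheaf X U) x :
  constant_val (\sum_j c j *: s j) x = \sum_j c j * constant_val (s j) x.
Proof.
have D (u v : constant_sheaf X U) : constant_val (u + v) x = constant_val u x + constant_val v x.
  by rewrite -{1}[u]scale1r constant_valL mul1r.
rewrite (big_morph (fun u : constant_sheaf X U => constant_val u x) D (constant_val0 U x)).
by apply: eq_bigr => j _; rewrite -[c j *: _]addr0 constant_valL constant_val0 addr0.
Qed.

(** Closedness of [f] keeps nearby fibres inside the union of the [W i]; openness makes them meet
    each [W i]. *)
Lemma fiber_sheets y : exists (W : 'I_(fiber_card y) -> opens X) (N : opens Y),
  [/\ oset N y, forall i j z, oset (W i) z -> oset (W j) z -> i = j,
      forall z, oset N (f z) -> exists i, oset (W i) z &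
      forall y', oset N y' -> exists g : 'I_(fiber_card y) -> X,
        [/\ injective g, forall i, f (g i) = y' & forall i, oset (W i) (g i)]].
Proof.
have [g [gi gy gs]] := fiber_points y.
have [//|W [N [Ny Wx _ dis cov]]] := @fiber_nbhd X Y f ff hX fcl y (fun=> opensT X).
have oN : open (N `&` \bigcap_(i in [set: 'I_(fiber_card y)]) (f @` W (g i))).
  apply: openI; first exact: oset_open.
  by apply: finite_open_bigcap => [|i _]; [exact: finite_finset|apply: fop; exact: oset_open].
have disg i j z : oset (W (g i)) z -> oset (W (g j)) z -> i = j.
  by move=> zi zj; apply: gi; exact: dis zi zj.
exists (fun i => W (g i)), (Opens oN); split=> // [|z [/cov[x xy Wxz] _]|y' [_ Ny']].
- by split=> // i _; exists (g i); [apply: Wx; exact: gy|exact: gy].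
- by have [i xi] := gs x xy; exists i; rewrite -xi.
have ex i : exists x, oset (W (g i)) x /\ f x = y' by have [x Wix xy] := Ny' i I; exists x.
have [g' g'P] := choice ex; exists g'; split=> [i j e|i|i]; try by have [] := g'P i.
have [Wi _] := g'P i; have [Wj _] := g'P j.
by apply: disg Wi _; rewrite e.
Qed.

Lemma fiber_card_lower y : exists2 N : opens Y, oset N y & forall y', oset N y' ->
  (fiber_card y <= fiber_card y')%N.
Proof.
have [W [N [Ny _ _ NP]]] := fiber_sheets y; exists N => // y' /NP[g [gi gy _]].
exact: fiber_card_ge gi gy.
Qed.

Definition card_strata (j : nat) : set Y := [set y | (fiber_card y <= j)%N].

Lemma card_strata_closed j : closed (card_strata j).
Proof.
rewrite -[card_strata j]setCK; apply: open_closedC; rewrite openE => y /= /negP.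
rewrite -ltnNge => jy; have [N Ny NP] := fiber_card_lower y.
apply: filterS (open_nbhs_nbhs (conj (oset_open N) Ny)) => y' /NP yy' /= y'j.
by have := leq_trans jy (leq_trans yy' y'j); rewrite ltnn.
Qed.

Lemma card_strataP j y : strata card_strata j y -> fiber_card y = j.
Proof.
case: j => [|j] [/= yj nj]; first by apply/eqP; rewrite -leqn0.
by apply/eqP; rewrite eqn_leq yj ltnNge; apply/negP.
Qed.

(** On a stratum the fibre has as many points as there are sheets, so each sheet contains exactly
    one, and the indicator functions of the sheets form a basis of the stalk. *)
Lemma push_constant_strata j x : strata card_strata j x ->
  exists (V : opens Y) (r : nat) (s : 'I_r -> pushs cf (constant_sheaf X) V),
    oset V x /\ forall y, oset V y -> strata card_strata j y -> stalk_basis s y.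
Proof.
move=> /card_strataP <-; have [W [N [Nx dis cov NP]]] := fiber_sheets x.
pose phi i z : rat := if `[< oset (W i) z >] then 1 else 0.
have phiE i j' z : oset (W j') z -> phi i z = (i == j')%:R.
  move=> Wj; rewrite /phi; case: asboolP => [Wi|]; first by rewrite (dis _ _ _ Wi Wj) eqxx.
  by case: eqVneq => // ->.
have phi_loc i : local_on (opreim cf N) (phi i).
  move=> z /cov[j' Wj]; exists (W j') => // z' Wj' _.
  by rewrite !(phiE _ j').
pose s i : pushs cf (constant_sheaf X) N := constant_sec (phi_loc i).
have sE (c : 'I_(fiber_card x) -> rat) z j' : oset N (f z) -> oset (W j') z ->
    constant_val (U := opreim cf N) (\sum_i c i *: s i) z = c j'.
  move=> Nz Wj; rewrite constant_val_sum (bigD1 j') //= big1 ?addr0.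
    by rewrite constant_secE // (phiE _ _ _ Wj) eqxx mulr1.
  by move=> i /negbTE ij; rewrite constant_secE // (phiE _ _ _ Wj) ij mulr0.
exists N, (fiber_card x), s; split=> // y Ny /card_strataP yx.
have [g [gi gy gW]] := NP y Ny.
have gN i : oset N (f (g i)) by rewrite gy.
have gs := fiber_cover gi gy (eq_leq yx).
split=> [c [W' [h [Wy E]]] i|W' WN z Wy].
  rewrite -(sE c (g i) i (gN i) (gW i)).
  have Wg : oset (opreim cf W') (g i) by rewrite /= gy.
  rewrite -(@constant_val_res _ (opreim cf N) (opreim cf W') (fun x Vx => h _ Vx)) //.
  by rewrite -(constant_val0 (opreim cf W') (g i)); congr constant_val; exact: E.
pose c i := constant_val (U := opreim cf W') z (g i).
have ex i : exists D : opens X, oset D (g i) /\ forall x', oset D x' ->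
    oset (W i) x' /\ constant_val (U := opreim cf W') z x' = c i.
  have [|D [_ Dg zD]] := @constant_val_local _ (opreim cf W') z (g i); first by rewrite /= gy.
  by exists (opensI (W i) D); split=> // x' [Wx' Dx']; split=> //; exact: zD.
have [D DP] := choice ex.
have oO : open (\bigcup_i D i) by apply: bigcup_open => i _; exact: oset_open.
have [|V Vy VO] := @fiber_tube X Y f fcl y (Opens oO).
  by move=> x' /gs[i ->]; exists i => //; exact: (DP i).1.
exists c, (opensI V W'), opensIr; split=> //.
apply: (@constant_val_eq _ (opreim cf (opensI V W'))) => x' [Vx' Wx'].
have [i _ Dx'] := VO x' Vx'; have [Wi zi] := (DP i).2 x' Dx'.
rewrite [RHS]constant_val0.
rewrite [LHS](@constant_val_res _ (opreim cf W') (opreim cf (opensI V W')) (fun x Vx => opensIr _ Vx)); last by split.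
have B (u v : constant_sheaf X (opreim cf W')) : constant_val (u - v) x' = constant_val u x' - constant_val v x'.
  by rewrite addrC -scaleN1r constant_valL mulN1r addrC.
rewrite B zi (@constant_val_res _ (opreim cf N) (opreim cf W') (fun x Vx => WN _ Vx)) //.
by rewrite (sE c x' i) ?subrr //; exact: WN.
Qed.

Lemma push_constant_constructible N : (forall y, (fiber_card y <= N)%N) ->
  constructible_sheaf (pushs cf (constant_sheaf X)).
Proof.
move=> bound; exists N, card_strata; split.
- exact: card_strata_closed.
- by move=> j y /= yj; exact: leqW.
- by apply/seteqP; split=> // y _; exact: bound.
exact: push_constant_strata.
Qed.

End FiberCardinality.

(** * A uniform bound on the fibres *)

Section FiberBound.
Variables (R : realType) (n : nat) (X Y : topologicalType) (f : X -> Y).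
Hypotheses (cf : continuous f) (ff : finite_fibers f) (fsurj : forall y, exists x, f x = y).
Hypothesis fop : forall U, open U -> open (f @` U).
Hypothesis Xeucl : forall x : X, locally_euclidean_at R n x.
Hypothesis hX : hausdorff_space X.
Hypothesis cX : compact [set: X].
Hypothesis fcl : forall C, closed C -> closed (f @` C).
Variables (B : set Y) (cB : closed B).
Hypothesis Bcov : forall y, ~ B y -> evenly_covered f y.
Variables (FY : nat -> set Y) (FB : nat -> set (set_type B)).
Hypotheses (sY : stratification R n FY) (sB : stratification R (n - 2) FB).
Hypothesis n2 : (2 <= n)%N.

(* The number of sheets, a locally constant function away from the branch locus,
   extends to a locally constant function on the compact space [X]. *)
Lemma sheet_bound : exists N, forall x, ~ B (f x) -> (fiber_card f (f x) <= N)%N.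
Proof.
have [P _] := resolutionP (constant_sheaf X).
pose W0 : opens X := opreim cf (Opens (closed_openC cB)).
pose phi x : rat := (fiber_card f (f x))%:R.
have phi_loc : local_on W0 phi.
  move=> x Bx; have [|N Nx NP] := @fiber_sum_local X Y f ff (fun=> 1) _ (Bcov Bx).
    by move=> z _; exists (opensT X).
  exists (opreim cf N) => // z Nz _; rewrite /phi -!fiber_card_sum //; exact: NP.
have W0T : W0 `<=` opensT X by [].
have W0E x : oset W0 x <-> oset (opensT X) x /\ refined_open n FY FB 2 (f x).
  by split=> [Wx|[]].
(* The number of sheets gives a cocycle of degree 0 off the preimage of [B], which has codimension
   2; so it extends to a cocycle over all of [X]. *)
have [|t [dt tE]] := @cocycle_extend R n X Y f cf ff Xeucl B cB FY FB sY sB P 2 0 (opensT X) W0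
    W0T (rl_aug P W0 (constant_sec phi_loc)) n2 isT W0E; first exact: rl_diff_aug.
have /compact_near_coveringP nc := cX.
have [|N _ NP] := nc nat \oo (fun N x => ~ B (f x) -> (fiber_card f (f x) <= N)%N) _.
  move=> x _; have [V [h [t0 [Vx t0E]]]] := @rl_exact0 _ _ P x (opensT X) t I dt.
  have [V' [V'V V'x t0c]] := constant_val_local t0 Vx.
  have phi_t0 z : oset V' z -> ~ B (f z) -> phi z = constant_val t0 x.
    move=> V'z Bz; pose W := opensI V W0; have Wz : oset W z by split=> //; exact: V'V.
    rewrite -(t0c z V'z) -(constant_secE phi_loc) //.
    rewrite -(@constant_val_res _ _ _ (@opensIr _ V W0) _ z Wz).
    rewrite -(@constant_val_res _ _ _ (@opensIl _ V W0) t0 z Wz); congr constant_val.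
    apply/eqP; rewrite -subr_eq0; apply/eqP/(@rl_aug_inj _ _ P); rewrite smapB !smap_res -tE -t0E.
    by rewrite !res_res (res_irr _ (subset_trans (@opensIl _ V W0) h)) subrr.
  have [[z [V'z Bz]]|none] := pselect (exists z, oset V' z /\ ~ B (f z)).
    exists (oset V', [set N | (fiber_card f (f z) <= N)%N]).
      by split; [exact: open_nbhs_nbhs (conj (oset_open V') V'x)|exists (fiber_card f (f z))].
    move=> [x' N] /= [V'x' zN] Bx'; suff -> : fiber_card f (f x') = fiber_card f (f z) by [].
    by apply/eqP; rewrite -(eqr_nat rat) -/(phi x') -/(phi z) !phi_t0.
  exists (oset V', setT); first by split; [exact: open_nbhs_nbhs (conj (oset_open V') V'x)|exact: filterT].
  by move=> [x' N] /= [V'x' _] Bx'; case: none; exists x'.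
by exists N => x; exact: (NP N (leqnn N) x I).
Qed.

(** The bound off [B] passes to every fibre by lower semicontinuity, provided points off [B] occur
    nearby: otherwise [constant_restrict_inj] would make the constant 1 vanish. *)
Lemma fiber_bound : exists N, forall y, (fiber_card f y <= N)%N.
Proof.
have [P _] := resolutionP (constant_sheaf X); have [N NB] := sheet_bound.
exists N => y; have [O Oy Ocard] := fiber_card_lower ff hX fcl fop y.
have [x xy] := fsurj y.
pose W := opreim cf O; pose W0 : opens X := opensI W (opreim cf (Opens (closed_openC cB))).
have W0E z : oset W0 z <-> oset W z /\ refined_open n FY FB 2 (f z) by [].
have [[z [Oz Bz]]|none] := pselect (exists z, oset W0 z).
  exact: leq_trans (Ocard _ Oz) (NB z Bz).
have Wx : oset W x by rewrite /= xy.
have one0 : const_sec W 1 = 0.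
  apply: (@constant_restrict_inj R n X Y f cf ff Xeucl B cB FY FB sY sB P 2 W W0 opensIl
    _ isT n2 W0E).
  by apply: constant_val_eq => z W0z; case: none; exists z.
have : constant_val (const_sec W 1) x = 1 by rewrite constant_val_in.
by rewrite one0 constant_val0 => /eqP; rewrite eq_sym oner_eq0.
Qed.

End FiberBound.

Theorem theorem35 (R : realType) (n : nat) (X Y : topologicalType) (f : X -> Y)
    (hf : branched_covering R f)
    (hX : closed_manifold R n X)
    (hYc : compact [set: Y]) (hY : pseudomanifold R n Y)
    (hn : (2 <= n)%N)
    (hB : closed (branch_locus f))
    (FX : nat -> set X) (hFX : intrinsic R n FX)
    (FY : nat -> set Y) (hFY : intrinsic R n FY)
    (FB : nat -> set (set_type (branch_locus f)))
    (hFB : intrinsic R (n - 2)%N FB)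
    (FC : nat -> set (set_type (f @^-1` branch_locus f)))
    (hFC : intrinsic R (n - 2)%N FC)
    (hflatY : locally_flat R n FY (n - 2)%N FB)
    (hflatX : locally_flat R n FX (n - 2)%N FC)
    (p : nat -> nat) (hp : p = lower_middle \/ p = upper_middle) :
  iso_Dbc
    (Rpush (bc_cont hf) (cshift (conc (constant_sheaf X)) n%:Z))
    (dsum
       (IC n FY FB p (constant_sheaf (set_type (~` branch_locus f))))
       (IC n FY FB p (branch_local_system hf))).
Proof.
have [hausX _ cX Xeucl] := hX; have [sY _ _] := hFY; have [sB _ _] := hFB.
have ff := bc_fin hf; have fop := bc_open hf; have fsurj := bc_surj hf.
have fcl C : closed C -> closed (f @` C).
  move=> cC; apply: compact_closed; first exact: bc_hausY hf.
  apply: continuous_compact; first exact: continuous_subspaceT (bc_cont hf).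
  exact: subclosed_compact cC cX _.
have Bcov y : ~ branch_locus f y -> evenly_covered f y by move/contrapT.
have pk k : (2 <= k)%N -> (p k <= k - 2)%N.
  by move=> k2; case: hp => ->; rewrite /lower_middle /upper_middle; lia.
have mn : - n%:Z + n%:Z = 0 by rewrite addNr.
(* [refined_open] at codimension 2 computes to the complement of the branch locus, so [cover_split]
   can be stated on it. *)
pose oA := @refined_open_open R n Y _ hB FY FB sY sB 2.
have [a0 [a0_inj a0_surj]] := @cover_split X Y f (bc_cont hf) (bc_fin hf) fsurj (~` branch_locus f)
  oA Bcov.
have [a ca] := @IC_concentrated R n X Y f (bc_cont hf) ff Xeucl hausX fcl _ hB FY FB sY sB hn p pk
  (constant_sheaf (set_type (~` branch_locus f))) (branch_local_system hf) a0 a0_inj a0_surj.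
have [_ _ [phi qphi]] := injective_modelP (@shift_zero_below X (constant_sheaf X) n%:Z).
have cI := push_concentrated (bc_cont hf) ff hausX fcl
  (concentrated_comp (concentrated_shift (constant_sheaf X) mn) qphi).
have [N bound] := @fiber_bound R n X Y f (bc_cont hf) ff fsurj fop Xeucl hausX cX fcl _ hB Bcov
  FY FB sY sB hn.
have cG := push_constant_constructible ff (bc_cont hf) hausX fcl fop bound.
split.
- exact: concentrated_constructible cI cG.
- exact: concentrated_constructible ca cG.
- exact: (derived_iso_zigzag (concentrated_quasi_iso mn cI) (concentrated_quasi_iso mn ca)).
Qed.
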